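(* Let $\beta>0$, let $\mu\in\mathcal{M}_\beta$, let $n_0\in N$, and suppose that for some $t_0>0$ $$\sup_{0<r<t_0}\frac{|\mu|(B(n_0,r))}{m(B(n_0,r))}<\infty .$$ If $u=\mathcal{Q}_{i\beta}[\mu]$ has a sectorial limit $L\in\mathbb{C}$ at $n_0$, then $u$ has admissible limit $L$ at $n_0$.
   Context: Groups. Let $\mathfrak{n}=\mathfrak{v}\oplus\mathfrak{z}$ be an $H$-type Lie algebra: a (noncommutative) two-step nilpotent real Lie algebra with inner product, center $\mathfrak{z}$, $\mathfrak{v}=\mathfrak{z}^\perp$, such that for every $Z\in\mathfrak{z}$ the map $J_Z:\mathfrak{v}\to\mathfrak{v}$ given by $\langle J_ZX,Y\rangle=\langle Z,[X,Y]\rangle$ satisfies $J_Z^2=-\|Z\|^2 I$. Let $\dim\mathfrak{v}=2p$, $\dim\mathfrak{z}=k$. The connected simply connected Lie group $N$ of $\mathfrak{n}$ is identified, via the exponential map, with $\mathfrak{v}\times\mathfrak{z}$, with product $(X,Z)(X',Z')=(X+X',Z+Z'+\frac12[X,X'])$ and identity $\underline{0}$; $m$ denotes the Haar measure $dX\,dZ$. For $a\in A=(0,\infty)$ put $\delta_a(X,Z)=(\sqrt a X,aZ)$. $S=NA$ is the semidirect product, with elements $(n,a)$, $n\in N$, $a>0$, and product $(n,a)(n',a')=(n\,\delta_a(n'),aa')$. Put $Q=p+k$, $\rho=Q/2$. Norm and balls. $d(X,Z)=(\|X\|^4+16\|Z\|^2)^{1/2}$ on $N$, and $B(n,r)=\{n_1\in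 N: d(n_1^{-1}n)<r\}$. Kernel. For $\beta>0$, $a>0$, $n=(X,Z)\in N$, $$q_a^{i\beta}(n)=c_\beta\,\frac{a^{2\beta}}{(16a^2+8a\|X\|^2+d(n)^2)^{\rho+\beta}},$$ where $c_\beta>0$ is the constant for which $\int_N q^{i\beta}_a\,dm=1$. For a (complex or signed, locally finite) Radon measure $\mu$ on $N$, with total variation $|\mu|$, $$\mathcal{Q}_{i\beta}[\mu](n,a)=\int_N q_a^{i\beta}(n_1^{-1}n)\,d\mu(n_1),$$ and it is called well-defined if the integral converges absolutely for every $(n,a)\in S$. $\mathcal{M}_\beta$ is the set of all Radon measures $\mu$ on $N$ such that $\mathcal{Q}_{i\beta}[|\mu|]$ is well-defined. Limits. A function $u$ on $S$ has admissible limit $L$ at $n_0\in N$ if for each $\alpha>0$, $u(n,a)\to L$ as $a\to0$ with $(n,a)\in\Gamma_\alpha(n_0)=\{(n,a)\in S: d(n_0^{-1}n)<\alpha a\}$. Let $\partial\Gamma_\alpha(n_0)=\{(n,a)\in S: d(n_0^{-1}n)=\alpha a\}$. For $\alpha>0$, $\omega\in S^{2p-1}\subset\mathfrak{v}$, $\zeta\in S^{k-1}\subset\mathfrak{z}$ (Euclidean unit spheres) and $\theta\in[0,2\pi)$, the ray emanating from $n_0$ is the curve $$\gamma_{n_0,\alpha,\omega,\zeta,\theta}(a)=\Big(n_0\big(\sqrt{\alpha a|\cos\theta|}\,\omega,\ \tfrac14\alpha a|\sin\theta|\,\zeta\big),\,a\Big),\quad a>0,$$ which lies in $\partial\Gamma_\alpha(n_0)$.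 A sector of $\partial\Gamma_\alpha(n_0)$ is a set $\bigcup_{\omega\in\mathcal{O}_1}\bigcup_{\zeta\in\mathcal{O}_2}\bigcup_{\theta\in\mathcal{O}_3}\gamma_{n_0,\alpha,\omega,\zeta,\theta}(0,\infty)$ with $\mathcal{O}_1,\mathcal{O}_2,\mathcal{O}_3$ nonempty relatively open subsets of $S^{2p-1},S^{k-1},[0,2\pi)$ respectively. A function $u$ on $S$ has sectorial limit $L$ at $n_0$ if for some $\alpha>0$ there is a sector of $\partial\Gamma_\alpha(n_0)$ such that $\lim_{a\to0}u(\gamma(a))=L$ for every ray $\gamma=\gamma_{n_0,\alpha,\omega,\zeta,\theta}$ in the sector. *)

(* Defs.v *)
From HB Require Import structures.
From mathcomp Require Import all_boot all_order all_algebra.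
From mathcomp Require Import all_classical all_reals all_analysis.
From mathcomp Require Import complex.

Set Implicit Arguments.
Unset Strict Implicit.
Unset Printing Implicit Defensive.

Import Order.TTheory GRing.Theory Num.Theory.
Import numFieldNormedType.Exports.

Local Open Scope classical_set_scope.
Local Open Scope ring_scope.

(* The topology of a row space is that of the library's (sup) norm; its
   Euclidean structure has to be introduced separately. *)
Definition dotr (R : realType) (n : nat) (x y : 'rV[R]_n) : R :=
  \sum_(i < n) x 0 i * y 0 i.

Definition enorm (R : realType) (n : nat) (x : 'rV[R]_n) : R :=
  Num.sqrt (dotr x x).

Definition esphere (R : realType) (n : nat) : set 'rV[R]_n :=
  [set x | enorm x = 1].
Arguments esphere : clear implicits.

(* v (+) z in orthonormal coordinates of v and of z. It is the underlying inner
   product space of the Lie algebra and, through the exponential map, also the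
   underlying manifold of the group N. *)
Definition carrier (R : realType) (p k : nat) : normedModType R :=
  ('rV[R]_p.*2 * 'rV[R]_k)%type.

Definition borel (R : realType) (p k : nat) :=
  g_sigma_algebraType (@open (carrier R p k)).

Record htype (R : realType) (p k : nat) := HType {
  bracket :> carrier R p k -> carrier R p k -> carrier R p k;
  bracket_linear_r : forall x, linear (bracket x);
  bracket_linear_l : forall y, linear (bracket^~ y);
  bracket_alt : forall x, bracket x x = 0;
  bracket_jacobi : forall x y w,
    bracket x (bracket y w) + bracket y (bracket w x)
    + bracket w (bracket x y) = 0;
  bracket_noncomm : exists x y, bracket x y != 0;
  bracket_two_step : forall x y w, bracket (bracket x y) w = 0;
  bracket_center : forall x, (forall y, bracket x y = 0) <-> x.1 = 0;
  jmap : 'rV[R]_k -> 'rV[R]_p.*2 -> 'rV[R]_p.*2;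
  jmapP : forall Z X Y,
    dotr (jmap Z X) Y = dotr Z (bracket (X, 0) (Y, 0)).2;
  jmap_sqr : forall Z X, jmap Z (jmap Z X) = - (enorm Z ^+ 2) *: X
}.

Section group.
Context {R : realType} {p k : nat} (h : htype R p k).
Local Notation N := (carrier R p k).

(* [X, X'] lies in [n, n], hence in z, so only its second component matters. *)
Definition nmul (x y : N) : N :=
  (x.1 + y.1, x.2 + y.2 + 2^-1 *: (h (x.1, 0) (y.1, 0)).2).

Definition ninv (x : N) : N := (- x.1, - x.2).

Definition ngauge (x : N) : R :=
  Num.sqrt (enorm x.1 ^+ 4 + 16 * enorm x.2 ^+ 2).

Definition nball (n : N) (r : R) : set N :=
  [set n1 | ngauge (nmul (ninv n1) n) < r].

(* Points of S are the pairs (n, a) of N * R with 0 < a. *)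
Definition cone (alpha : R) (n0 : N) : set (N * R) :=
  [set x | 0 < x.2 /\ ngauge (nmul (ninv n0) x.1) < alpha * x.2].

Definition ray (n0 : N) (alpha : R) (omega : 'rV[R]_p.*2) (zeta : 'rV[R]_k)
    (theta a : R) : N * R :=
  (nmul n0 (Num.sqrt (alpha * a * `|cos theta|) *: omega,
            (4^-1 * (alpha * a * `|sin theta|)) *: zeta), a).

End group.

(* Lebesgue measure dX dZ on v x z, as the Borel measure giving each closed box
   its elementary volume. *)
Definition is_lebesgue (R : realType) (p k : nat)
    (m : {measure set (borel R p k) -> \bar R}) : Prop :=
  forall lo hi : carrier R p k,
    (forall i, lo.1 0 i <= hi.1 0 i) -> (forall j, lo.2 0 j <= hi.2 0 j) ->
    m [set x : carrier R p k |
        (forall i, lo.1 0 i <= x.1 0 i <= hi.1 0 i) /\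
        (forall j, lo.2 0 j <= x.2 0 j <= hi.2 0 j)] =
    ((\prod_i (hi.1 0 i - lo.1 0 i)) * (\prod_j (hi.2 0 j - lo.2 0 j)))%:E.

Section radon.
Context {R : realType} {p k : nat}.
Local Notation N := (carrier R p k).

Definition bounded_borel : set (set N) :=
  [set E | measurable (E : set (borel R p k)) /\ precompact E].

(* A locally finite complex measure may have infinite total variation, and is
   therefore only meaningful as a set function on relatively compact Borel
   sets; its variation is defined on all Borel sets. *)
Definition tvar (mu : set N -> R[i]) (A : set N) : \bar R :=
  ereal_sup [set x | exists l (E : 'I_l -> set N),
    [/\ forall i, bounded_borel (E i), forall i, E i `<=` A,
        trivIset setT E &
        x = (\sum_i Normc.normc (mu (E i)))%:E]].

(* Locally finite Borel measures on a finite dimensional space are regular, so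
   that no separate regularity axiom is needed. The values of cradon_fun outside
   bounded_borel are irrelevant. *)
Record cradon := CRadon {
  cradon_fun :> set N -> R[i];
  cradon_sigma_additive : forall E : (set N)^nat,
    (forall i, bounded_borel (E i)) -> trivIset setT E ->
    bounded_borel (\bigcup_i E i) ->
    series (fun i => cradon_fun (E i)) @ \oo
      --> (cradon_fun (\bigcup_i E i) : R[i]^o);
  cradon_locally_finite : forall K : set N, compact K ->
    (tvar cradon_fun K < +oo)%E
}.

(* Positive part in the Jordan decomposition. The library's integral is defined
   for an arbitrary set function; on Borel sets jpos, jneg (for the real and
   imaginary parts of a cradon) and tvar are measures. The two integrals below
   are finite as soon as f is absolutely integrable, i.e. integrable for tvar. *)
Definition jpos (s : set N -> R) (A : set N) : \bar R :=
  ereal_sup [set (s B)%:E | B in [set B | bounded_borel B /\ B `<=` A]].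

Definition jneg (s : set N -> R) : set N -> \bar R := jpos (fun A => - s A).

Definition rintegral_signed (s : set N -> R) (f : N -> R) : R :=
  fine (@integral _ (borel R p k) R (jpos s) setT (EFin \o f)) -
  fine (@integral _ (borel R p k) R (jneg s) setT (EFin \o f)).

Definition cintegral (mu : set N -> R[i]) (f : N -> R) : R[i] :=
  Complex (rintegral_signed (fun A => complex.Re (mu A)) f)
          (rintegral_signed (fun A => complex.Im (mu A)) f).

End radon.
Arguments cradon : clear implicits.

Section poisson.
Context {R : realType} {p k : nat} (h : htype R p k).
Local Notation N := (carrier R p k).

Definition rho : R := (p + k)%:R / 2.

Definition qker (c beta a : R) (n : N) : R :=
  c * (a `^ (2 * beta)
       / (16 * a ^+ 2 + 8 * a * enorm n.1 ^+ 2 + ngauge n ^+ 2)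
           `^ (rho + beta)).

Definition is_qconst (m : {measure set (borel R p k) -> \bar R})
    (beta c : R) : Prop :=
  0 < c /\ forall a : R, 0 < a ->
    @integral _ (borel R p k) R m setT (EFin \o qker c beta a) = 1%E.

Definition Qtrans (c beta : R) (mu : set N -> R[i]) (x : N * R) : R[i] :=
  cintegral mu (fun n1 => qker c beta x.2 (nmul h (ninv n1) x.1)).

(* mu belongs to the class M_beta; the kernel being positive, this is the
   absolute convergence of the integrals defining Qtrans. *)
Definition Qwell_defined (c beta : R) (mu : set N -> R[i]) : Prop :=
  forall (n : N) (a : R), 0 < a ->
    (@integral _ (borel R p k) R (tvar mu) setT
       (fun n1 => (qker c beta a (nmul h (ninv n1) n))%:E) < +oo)%E.

Definition admissible_limit (u : N * R -> R[i]) (n0 : N) (L : R[i]) : Prop :=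
  forall alpha : R, 0 < alpha -> forall eps : R, 0 < eps ->
    \forall a \near 0^'+, forall n, cone h alpha n0 (n, a) ->
      Normc.normc (u (n, a) - L) < eps.

Definition relatively_open (T : topologicalType) (D O : set T) : Prop :=
  exists2 U, open U & O = D `&` U.

Definition is_sector (n0 : N) (alpha : R) (E : set (N * R)) : Prop :=
  exists (O1 : set 'rV[R]_p.*2) (O2 : set 'rV[R]_k) (O3 : set R),
    [/\ relatively_open (esphere R p.*2) O1 /\ O1 !=set0,
        relatively_open (esphere R k) O2 /\ O2 !=set0,
        relatively_open `[0, 2 * pi[ O3 /\ O3 !=set0 &
        E = \bigcup_(omega in O1) \bigcup_(zeta in O2) \bigcup_(theta in O3)
              (ray h n0 alpha omega zeta theta @` `]0, +oo[)].

Definition sectorial_limit (u : N * R -> R[i]) (n0 : N) (L : R[i]) : Prop :=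
  exists (alpha : R) E, [/\ 0 < alpha, is_sector n0 alpha E &
    forall omega zeta (theta : R),
      esphere R p.*2 omega -> esphere R k zeta -> theta \in `[0, 2 * pi[ ->
      ray h n0 alpha omega zeta theta @` `]0, +oo[ `<=` E ->
      u (ray h n0 alpha omega zeta theta a) @[a --> 0^'+] --> (L : R[i]^o)].

End poisson.
Arguments rho : clear implicits.

(* Main.v *)
Require Import Defs.
From HB Require Import structures.
From mathcomp Require Import all_boot all_order all_algebra.
From mathcomp Require Import all_classical all_reals all_analysis.
From mathcomp Require Import complex ring lra zify.
From mathcomp Require Import measurable_realfun.

(** Why the theorem holds. Near n0 everything is read at all scales at once. By
    homogeneity of the kernel, the value of u at the point n0 (dil r n) of height r a is
    Lam r G, where G is the kernel attached to the point (n, a) of the half space and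
    Lam r is the measure rescaled at n0 by r. The bound on the averages of the measure
    over balls makes the functionals Lam r, for small r, uniformly bounded on the
    functions dominated by one fixed kernel (bounded_kernel_integral, Lam_bound). In
    these terms an admissible limit is convergence of Lam r G to L uniformly for a = 1
    and n in a compact set, and a sectorial limit gives convergence at the points (n, 1)
    of an open piece of the boundary of a cone. The real and imaginary parts of u are
    treated separately, each as a difference of two integrals against the Jordan parts
    of a signed measure (jordan_pos), both of which are at most the variation of mu.

    The passage from the sector to the cones uses two properties of the kernel, both
    with estimates relative to the kernel itself and uniform in the point of
    integration.

    First, it is real analytic along polynomial curves (kernel_expansion). Applied to
    such an expansion, Lam r gives a family of power series in the parameter of the curve,
    with bounds uniform in r; as in Vitali's theorem, convergence on a small interval
    forces convergence along the whole curve (power_family_cvg, tends_propagate). The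
    boundary of the cone, up to dilations, contains a polynomial curve between
    any point of the sector and any other point, up to the choice of a pole as in
    stereographic projection (boundary_curve), hence the limit holds on the whole
    boundary (lsup_boundary).

    Second, it satisfies a second-order equation, where the type H condition enters
    (kernel_equation). The upper limit lsup of the distance from Lam r G to L, a
    function of (n, a) that is invariant under dilations, is therefore subharmonic for
    this equation, and the maximum principle shows that it vanishes inside the cone as
    soon as it does on the boundary (lsup_max_principle).

    Once the limit holds in the cone, analyticity along segments spreads it to all
    points of the half space (lsup_everywhere), and equicontinuity makes it uniform on
    compact sets (uniform_limit), which is the admissible limit. *)

Set Implicit Arguments.
Unset Strict Implicit.
Unset Printing Implicit Defensive.

Import Order.TTheory GRing.Theory Num.Theory.
Import numFieldNormedType.Exports.

Local Open Scope classical_set_scope.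
Local Open Scope ring_scope.

(** * Weighted coefficient norms of polynomials *)

Section wnorm.
Context {R : realType}.
Implicit Types (p q : {poly R}) (k : nat).

(** These norms are submultiplicative for every exponent k, and raising k by one
    pays for a differentiation. *)
Definition wnorm k p : R := \sum_(i < size p) i.+1%:R ^+ k * `|p`_i|.

Lemma weight_ge1 k i : 1 <= i.+1%:R ^+ k :> R.
Proof. by rewrite exprn_ege1// ler1n. Qed.

Lemma wnorm_widen k n p : (size p <= n)%N ->
  wnorm k p = \sum_(i < n) i.+1%:R ^+ k * `|p`_i|.
Proof.
move=> pn; rewrite /wnorm (big_ord_widen n (fun i => i.+1%:R ^+ k * `|p`_i|) pn).
rewrite [RHS](bigID (fun i : 'I_n => (i < size p)%N)) /=.
rewrite [X in _ = _ + X]big1 ?addr0// => i; rewrite -leqNgt => ip.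
by rewrite nth_default// normr0 mulr0.
Qed.

Lemma wnorm_ge0 k p : 0 <= wnorm k p.
Proof. by apply: sumr_ge0 => i _; rewrite mulr_ge0// exprn_ge0. Qed.

Lemma wnormD k p q : wnorm k (p + q) <= wnorm k p + wnorm k q.
Proof.
pose n := maxn (size p) (size q).
rewrite (@wnorm_widen k n (p + q)) ?(leq_trans (size_polyD _ _))//.
rewrite (@wnorm_widen k n p) ?leq_maxl// (@wnorm_widen k n q) ?leq_maxr//.
rewrite -big_split/=; apply: ler_sum => i _.
by rewrite coefD -mulrDr ler_wpM2l ?exprn_ge0// ler_normD.
Qed.

Lemma wnorm0 k : wnorm k 0 = 0.
Proof. by rewrite /wnorm size_poly0 big_ord0. Qed.

Lemma wnorm_sum k I (r : seq I) (P : pred I) (F : I -> {poly R}) :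
  wnorm k (\sum_(i <- r | P i) F i) <= \sum_(i <- r | P i) wnorm k (F i).
Proof.
elim/big_ind2 : _ => //[|x1 x2 y1 y2 h1 h2]; first by rewrite wnorm0.
exact: le_trans (wnormD _ _ _) (lerD h1 h2).
Qed.

Lemma wnormZ k c p : wnorm k (c *: p) = `|c| * wnorm k p.
Proof.
rewrite (@wnorm_widen _ (size p)) ?size_scale_leq// /wnorm mulr_sumr.
by apply: eq_bigr => i _; rewrite coefZ normrM mulrCA.
Qed.

Lemma wnormN k p : wnorm k (- p) = wnorm k p.
Proof. by rewrite -scaleN1r wnormZ normrN1 mul1r. Qed.

Lemma wnormC k c : wnorm k c%:P = `|c|.
Proof.
rewrite (@wnorm_widen _ 1%N) ?size_polyC_leq1// big_ord1 coefC eqxx.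
by rewrite expr1n mul1r.
Qed.

Lemma wnormXnM k n p : wnorm k ('X^n * p) <= n.+1%:R ^+ k * wnorm k p.
Proof.
have sz : (size ('X^n * p)%R <= n + size p)%N.
  by rewrite (leq_trans (size_polyMleq _ _))// size_polyXn.
rewrite (wnorm_widen _ sz) big_split_ord/= big1 ?add0r; last first.
  by move=> i _; rewrite coefXnM ltn_ord normr0 mulr0.
rewrite /wnorm mulr_sumr; apply: ler_sum => i _.
rewrite coefXnM ltnNge leq_addr/= addKn mulrA ler_wpM2r//.
by rewrite -exprMn lerXn2r ?nnegrE// -natrM ler_nat mulnS mulSn; lia.
Qed.

(** Only the inequality n + m + 1 <= (n + 1) (m + 1) is needed, through the case
    of a monomial. *)
Lemma wnormM k p q : wnorm k (p * q) <= wnorm k p * wnorm k q.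
Proof.
rewrite -[p in p * q]coefK poly_def mulr_suml.
apply: (le_trans (wnorm_sum _ _ _ _)); rewrite [wnorm _ p]/wnorm mulr_suml.
apply: ler_sum => i _; rewrite -scalerAl wnormZ mulrAC mulrC.
by rewrite ler_wpM2r// wnormXnM.
Qed.

Lemma norm_coef_le k p i : `|p`_i| <= wnorm k p.
Proof.
have [ip|pi] := ltnP i (size p); last first.
  by rewrite nth_default// normr0 wnorm_ge0.
rewrite /wnorm (bigD1 (Ordinal ip))//=.
apply: (@le_trans _ _ (i.+1%:R ^+ k * `|p`_i|)).
  by rewrite ler_peMl// weight_ge1.
by rewrite lerDl; apply: sumr_ge0 => j _; rewrite mulr_ge0// exprn_ge0.
Qed.

Lemma sum_coef_le k p n : \sum_(i < n) `|p`_i| <= wnorm k p.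
Proof.
pose m := maxn n (size p).
rewrite (@wnorm_widen _ m) ?leq_maxr//.
rewrite (big_ord_widen m (fun i => `|p`_i|)) ?leq_maxl//.
rewrite big_mkcond/=; apply: ler_sum => i _; case: ifP => _.
  by rewrite ler_peMl// weight_ge1.
by rewrite mulr_ge0// exprn_ge0.
Qed.

Lemma norm_horner_le n p x : `|x| <= 1 -> (forall i, (i < n)%N -> p`_i = 0) ->
  `|p.[x]| <= `|x| ^+ n * wnorm 0 p.
Proof.
move=> x1 pn; rewrite horner_coef (le_trans (ler_norm_sum _ _ _))//.
rewrite /wnorm mulr_sumr; apply: ler_sum => i _; rewrite normrM normrX.
have [/pn ->|ni] := ltnP i n; first by rewrite normr0 mul0r !mulr0.
by rewrite mulrC expr0 mul1r ler_wpM2r// ler_wiXn2l.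
Qed.

Lemma wnormS k p : wnorm k p <= wnorm k.+1 p.
Proof.
apply: ler_sum => i _; rewrite ler_wpM2r// exprSr ler_peMr ?exprn_ge0//.
by rewrite ler1n.
Qed.

Lemma wnorm_deriv k p : wnorm k p^`() <= wnorm k.+1 p.
Proof.
case: (posnP (size p)) => [/eqP|p0].
  rewrite size_poly_eq0 => /eqP ->; by rewrite deriv0 wnorm0 wnorm_ge0.
pose F i := i.+1%:R ^+ k.+1 * `|p`_i|.
have sz : ((size p^`()).+1 <= size p)%N by rewrite lt_size_deriv// -size_poly_gt0.
apply: (@le_trans _ _ (\sum_(i < (size p^`()).+1) F i)).
  rewrite big_ord_recl/= -[leLHS]add0r lerD ?mulr_ge0 ?exprn_ge0//.
  apply: ler_sum => i _; rewrite coef_deriv normrMn -[`|_| *+ _]mulr_natl mulrA.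
  rewrite ler_wpM2r// exprSr ler_pM ?exprn_ge0//.
    by rewrite lerXn2r ?nnegrE// ler_nat.
  by rewrite ler_nat.
rewrite (big_ord_widen _ F sz) big_mkcond/=; apply: ler_sum => i _.
by case: ifP => // _; rewrite mulr_ge0// exprn_ge0.
Qed.

End wnorm.

(** * Products of real powers of polynomials *)

Section powseries.
Context {R : realType}.
Implicit Types p q : {poly R}.

(** Course-of-values recursion: the list of the values already computed is
    extended one step at a time. *)
Definition recseq (F : nat -> (nat -> R) -> R) : nat -> R :=
  fun n => nth 0 (iter n.+1 (fun s => rcons s (F (size s) (nth 0 s))) [::]) n.

Lemma recseqE F :
  (forall n c1 c2, (forall m, (m < n)%N -> c1 m = c2 m) -> F n c1 = F n c2) ->
  forall n, recseq F n = F n (recseq F).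
Proof.
move=> Fext n; pose L n := iter n (fun s => rcons s (F (size s) (nth 0 s))) [::].
have sL m : size (L m) = m by elim: m => //= m IH; rewrite size_rcons IH.
have LL m j : (m <= j)%N -> forall i, (i < m)%N -> nth 0 (L j) i = nth 0 (L m) i.
  move=> mj i im; elim: j mj => [|j IH]; first by rewrite leqn0 => /eqP ->.
  rewrite leq_eqVlt => /predU1P[-> //|mj]; rewrite /= -/(L j) nth_rcons sL.
  by rewrite (leq_trans im mj) IH.
rewrite {1}/recseq iterS -/(L n) nth_rcons sL ltnn eqxx.
by apply: Fext => m mn; rewrite /recseq -/(L _) (@LL m.+1 n).
Qed.

(** For q = b p1' p2 + e p1 p2' and p = p1 p2 the function p1^b p2^e solves
    p f' = q f; this is the recurrence satisfied by the Taylor coefficients of the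
    solution with f(0) = 1, when p(0) = 1. *)
Definition ode_step p q n (c : nat -> R) : R :=
  if n is n'.+1 then
    n%:R^-1 * \sum_(m < n) (q`_(n' - m) - m%:R * p`_(n - m)) * c m
  else 1.

Lemma ode_stepP p q : exists c : nat -> R, c 0%N = 1 /\
  forall n, c n.+1 = n.+1%:R^-1 *
    \sum_(m < n.+1) (q`_(n - m) - m%:R * p`_(n.+1 - m)) * c m.
Proof.
exists (recseq (ode_step p q)); split=> [|n]; rewrite recseqE//.
  all: case=> // m c1 c2 H /=; congr (_ * _); apply: eq_bigr => i _.
  all: by rewrite H.
Qed.

(** A majorant argument: dividing by n + 1 absorbs the factors m <= n + 1 of the
    recurrence, so that each step costs at most the sum of the norms of p and q. *)
Lemma ode_coef_bound p q B c : 1 <= B -> wnorm 0 p + wnorm 0 q <= B ->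
  c 0%N = 1 ->
  (forall n, c n.+1 = n.+1%:R^-1 *
    \sum_(m < n.+1) (q`_(n - m) - m%:R * p`_(n.+1 - m)) * c m) ->
  forall n, `|c n| <= B ^+ n.
Proof.
move=> B1 pqB c0 cS; elim/ltn_ind => -[_|n IH]; first by rewrite c0 normr1.
have B0 : 0 <= B by apply: le_trans B1.
rewrite cS normrM ger0_norm ?invr_ge0// mulrC ler_pdivrMr ?ltr0n//.
apply: (le_trans (ler_norm_sum _ _ _)).
apply: (@le_trans _ _ (\sum_(m < n.+1)
    n.+1%:R * B ^+ n * (`|q`_(n - m)| + `|p`_(n.+1 - m)|))).
  apply: ler_sum => m _; rewrite normrM [leRHS]mulrAC; apply: ler_pM => //.
    rewrite (le_trans (ler_normB _ _))// mulrDr lerD//.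
      by rewrite ler_peMl// ler1n.
    by rewrite normrM ger0_norm// ler_wpM2r// ler_nat ltnW// ltn_ord.
  by apply: (le_trans (IH _ _)) => //; rewrite ler_weXn2l// -ltnS.
rewrite -mulr_sumr exprS [X in _ <= X]mulrC -mulrA ler_wpM2l//.
rewrite mulrC ler_wpM2r ?exprn_ge0// (le_trans _ pqB)// big_split/= addrC lerD//.
  apply: le_trans (sum_coef_le 0 p n.+2).
  rewrite [leRHS]big_ord_recl/= (reindex_inj rev_ord_inj)/=.
  rewrite (_ : \sum_(i < n.+1) `|p`_(n.+1 - (n.+1 - i.+1))| =
     \sum_(i < n.+1) `|p`_(i.+1)|); first by rewrite lerDr.
  by apply: eq_bigr => i _; rewrite subKn// .
apply: le_trans (sum_coef_le 0 q n.+1).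
rewrite (reindex_inj rev_ord_inj)/=; apply: ler_sum => i _.
by rewrite subSS subKn// -ltnS.
Qed.

(** The recurrence makes the partial sum S solve p S' = q S up to terms of order
    at least n. *)
Lemma ode_residual_coef p q c n : p`_0 = 1 -> c 0%N = 1 ->
  (forall n, c n.+1 = n.+1%:R^-1 *
    \sum_(m < n.+1) (q`_(n - m) - m%:R * p`_(n.+1 - m)) * c m) ->
  let S := \poly_(j < n.+1) c j in
  forall l, (l < n)%N -> (p * S^`() - q * S)`_l = 0.
Proof.
move=> p0 c0 cS S l ln; rewrite coefB !coefMr.
have E1 : \sum_(j < l.+1) p`_(l - j) * S^`()`_j =
    \sum_(m < l.+2) m%:R * p`_(l.+1 - m) * c m.
  rewrite [RHS]big_ord_recl/= !mul0r add0r; apply: eq_bigr => i _.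
  rewrite coef_deriv coef_poly ltnS (leq_trans (ltn_ord i) ln).
  by rewrite /bump/= add1n subSS -[c _ *+ _]mulr_natl mulrCA mulrA.
have E2 : \sum_(j < l.+1) q`_(l - j) * S`_j = \sum_(m < l.+1) q`_(l - m) * c m.
  apply: eq_bigr => i _; rewrite coef_poly ifT// ltnS.
  by rewrite (leq_trans _ ln)// ltnW// ltn_ord.
rewrite E1 E2 big_ord_recr/= subnn p0 mulr1 cS mulrA mulfV ?pnatr_eq0// mul1r.
rewrite -big_split/= -sumrB big1// => i _.
ring.
Qed.

Lemma wnorm_poly_geo (B : R) (c : nat -> R) n : 1 <= B -> (forall n, `|c n| <= B ^+ n) ->
  wnorm 0 (\poly_(j < n) c j) <= (2 * B) ^+ n.
Proof.
move=> B1 cB; rewrite poly_def.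
have B0 : 0 <= B by apply: le_trans B1.
apply: (@le_trans _ _ (\sum_(j < n) (2 * B) ^+ j)).
  apply: le_trans (wnorm_sum _ _ _ _) _; apply: ler_sum => i _.
  rewrite wnormZ exprMn mulrC ler_pM ?wnorm_ge0//.
  rewrite -[X in wnorm _ X]mulr1 (le_trans (wnormXnM _ _ _))//.
  by rewrite expr0 mul1r wnormC normr1 exprn_ege1// ler1n.
elim: n => [|n IH]; first by rewrite big_ord0 expr0.
rewrite big_ord_recr/= exprS.
have H : 0 <= (2 * B) ^+ n by rewrite exprn_ge0// mulr_ge0.
apply: (le_trans (lerD IH (lexx _))).
by nra.
Qed.

Lemma powR_bounds (x e : R) : 2^-1 <= x <= 2 -> 2 `^ (- `|e|) <= x `^ e <= 2 `^ `|e|.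
Proof.
move=> /andP[x1 x2].
have x0 : 0 < x by apply: lt_le_trans x1; rewrite invr_gt0.
have l2 : ln x <= ln 2 :> R by rewrite ler_ln// posrE.
have l1 : - ln 2 <= ln x :> R by rewrite -lnV ?posrE// ler_ln ?posrE ?invr_gt0.
have lx : `|ln x| <= ln 2 by rewrite ler_norml l1 l2.
have : `|e * ln x| <= `|e| * ln 2 by rewrite normrM ler_wpM2l.
rewrite ler_norml => /andP[h1 h2].
rewrite /powR !gt_eqF// !ler_expR mulNr h1 h2//.
Qed.

Lemma is_derive_powR_poly p (e x : R) : 0 < p.[x] ->
  is_derive x 1 (fun t => p.[t] `^ e) (e * p.[x] `^ (e - 1) * p^`().[x]).
Proof.
move=> px; have := @is_derive1_powR R e _ px.
by move=> H; apply: is_derive1_comp.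
Qed.

Lemma wnorm_deriv2 (B : R) n (c : nat -> R) : 1 <= B -> (forall n, `|c n| <= B ^+ n) ->
  wnorm 0 (\poly_(j < n) c j)^`() <= (4 * B) ^+ n.
Proof.
move=> B1 cB; rewrite poly_def raddf_sum/=.
have B0 : 0 <= B by apply: le_trans B1.
apply: (@le_trans _ _ (\sum_(j < n) (4 * B) ^+ j)).
  apply: le_trans (wnorm_sum _ _ _ _) _; apply: ler_sum => i _.
  rewrite derivZ derivXn wnormZ exprMn mulrC ler_pM ?wnorm_ge0//.
  rewrite -[X in wnorm 0 (X *+ _)]mulr1 -scaler_nat wnormZ normr_nat.
  apply: (@le_trans _ _ ((i%:R : R) * (i.-1.+1%:R ^+ 0 * wnorm 0 (1%:P : {poly R})))).
    by rewrite ler_wpM2l// wnormXnM.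
  rewrite expr0 mul1r wnormC normr1 mulr1 -natrX ler_nat.
  exact/ltnW/ltn_expl.
elim: n => [|n IH]; first by rewrite big_ord0 expr0.
rewrite big_ord_recr/= exprS.
have H : 0 <= (4 * B) ^+ n by rewrite exprn_ge0// mulr_ge0.
apply: (le_trans (lerD IH (lexx _))).
by nra.
Qed.

End powseries.

Section expansion.
Context {R : realType}.
Implicit Types p q : {poly R}.

Lemma mvt_bound (f df : R -> R) (d M x : R) :
  (forall y, `|y| <= d -> is_derive y (1:R) f (df y)) ->
  (forall y, `|y| <= d -> `|df y| <= M) ->
  `|x| <= d -> `|f x - f 0| <= M * `|x|.
Proof.
move=> fd dM xd.
have key (a b : R) : a <= b -> `|a| <= d -> `|b| <= d -> `|f b - f a| <= M * (b - a).
  move=> ab ad bd.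
  have cd y : y \in `[a, b] -> `|y| <= d.
    move: ad bd; rewrite in_itv/= !ler_norml => /andP[? ?] /andP[? ?] /andP[? ?].
    by apply/andP; split; lra.
  have [z| |z zab ->] := @MVT_segment R f df a b ab.
  - move=> zab; apply: fd; apply: cd; move: zab; rewrite !in_itv/= => /andP[? ?].
    by rewrite !ltW.
  - apply: (@derivable_within_continuous R R f) => z zab.
    by have := fd _ (cd _ zab); case.
  rewrite normrM (@ger0_norm _ (b - a)) ?subr_ge0// ler_wpM2r ?subr_ge0//.
  exact/dM/cd.
have d0 : `|0 : R| <= d by rewrite normr0 (le_trans _ xd).
have [x0|x0] := leP 0 x.
  by have := key _ _ x0 d0 xd; rewrite subr0 (ger0_norm x0).
have := key _ _ (ltW x0) xd d0; rewrite sub0r distrC.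
by rewrite (_ : `|x| = - x)// ltr0_norm.
Qed.

(** The point is uniformity: the radius and the error constant depend only on b, e
    and a bound for the norms of p and q. The partial sum S of the formal solution
    is compared with p^b q^e through the quotient S p^(-b) q^(-e), whose derivative
    is the residual of S divided by the positive function p q p^b q^e; the mean value
    inequality then turns a residual of order n into an error of order n + 1. *)
Lemma power_expansion (b e C : R) : exists B : R, 1 <= B /\
  forall p q, p`_0 = 1 -> q`_0 = 1 -> wnorm 1 p <= C -> wnorm 1 q <= C ->
  exists c : nat -> R, [/\ c 0%N = 1, c 1%N = b * p`_1 + e * q`_1,
    c 2%N = b * p`_2 + b * (b - 1) / 2 * p`_1 ^+ 2 +
            e * q`_2 + e * (e - 1) / 2 * q`_1 ^+ 2 + b * e * p`_1 * q`_1,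
    forall n, `|c n| <= B ^+ n &
    forall t, B * `|t| <= 1 ->
    [/\ 2^-1 <= p.[t] <= 2, 2^-1 <= q.[t] <= 2 &
      forall n, `|p.[t] `^ b * q.[t] `^ e - \sum_(j < n) c j * t ^+ j|
        <= B * (B * `|t|) ^+ n] ].
Proof.
have [C1|C1] := leP 1 C; last first.
  exists 1; split=> // p q p0 _ pC _; exfalso.
  by have := norm_coef_le 1 p 0; rewrite p0 normr1; lra.
pose W : R := 2 `^ `|b| * 2 `^ `|e|.
have W1 : 1 <= W.
  rewrite -[1]mulr1 /W ler_pM//.
    by rewrite -[leLHS](powRr0 2) ler_powR// ler1n.
  by rewrite -[leLHS](powRr0 2) ler_powR// ler1n.
pose B0 := (1 + `|b| + `|e|) * C ^+ 2.
have C2 : C <= C ^+ 2 by rewrite expr2 ler_peMl//; lra.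
have be0 : 0 <= `|b| + `|e| by rewrite addr_ge0.
have B00 : 0 <= B0 by rewrite mulr_ge0 ?sqr_ge0 ?addr_ge0.
have B0E : B0 = C ^+ 2 + (`|b| + `|e|) * C ^+ 2 by rewrite /B0; ring.
have B0C : C ^+ 2 <= B0 by rewrite /B0; nra.
have B01 : 1 <= B0 by lra.
(* W bounds the powers of p and of q where these lie in [1/2, 2], B0 is the
   growth rate of the coefficients, and 4 B0 also absorbs the differentiation of
   a partial sum. *)
pose B := 4 * W ^+ 2 * B0.
have W2 : 1 <= W ^+ 2 by rewrite exprn_ege1.
have WW : W <= W ^+ 2 by rewrite expr2 ler_peMl//; lra.
have B4 : 4 * B0 <= B by rewrite /B; nra.
have BW : W <= B by rewrite /B; nra.
exists B; split; first lra.
move=> p q p0 q0 pC qC.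
pose P := p * q; pose Q := b *: (p^`() * q) + e *: (p * q^`()).
have P0 : P`_0 = 1 by rewrite coefM big_ord1 p0 q0 mulr1.
have p1C : wnorm 0 p <= C := le_trans (wnormS _ _) pC.
have q1C : wnorm 0 q <= C := le_trans (wnormS _ _) qC.
have pdC : wnorm 0 p^`() <= C := le_trans (wnorm_deriv _ _) pC.
have qdC : wnorm 0 q^`() <= C := le_trans (wnorm_deriv _ _) qC.
have PC : wnorm 0 P <= C ^+ 2.
  by rewrite (le_trans (wnormM _ _ _))// expr2 ler_pM ?wnorm_ge0.
have QC : wnorm 0 Q <= (`|b| + `|e|) * C ^+ 2.
  rewrite (le_trans (wnormD _ _ _))// !wnormZ mulrDl lerD// ler_wpM2l//.
    by rewrite (le_trans (wnormM _ _ _))// expr2 ler_pM ?wnorm_ge0.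
  by rewrite (le_trans (wnormM _ _ _))// expr2 ler_pM ?wnorm_ge0.
have [c [c0 cS]] := ode_stepP P Q.
have cB n : `|c n| <= B0 ^+ n.
  by apply: (ode_coef_bound _ _ c0 cS) => //; rewrite /B0; lra.
have Q0 : Q`_0 = b * p`_1 + e * q`_1.
  by rewrite coefD !coefZ !coefM !big_ord1/= !coef_deriv p0 q0 !mulr1n mulr1 mul1r.
have P1 : P`_1 = p`_1 + q`_1.
  by rewrite coefM big_ord_recl big_ord1/= p0 q0 mulr1 mul1r addrC.
have Q1 : Q`_1 = b * (2 * p`_2 + p`_1 * q`_1) + e * (2 * q`_2 + p`_1 * q`_1).
  rewrite coefD !coefZ !coefM !big_ord_recl !big_ord0/= !coef_deriv p0 q0 /bump/=.
  by rewrite !mulr1n -[p`_2 *+ 2]mulr_natl -[q`_2 *+ 2]mulr_natl; ring.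
have c1E : c 1%N = b * p`_1 + e * q`_1.
  by rewrite cS big_ord1/= subnn c0 mul0r subr0 Q0 invr1 mul1r mulr1.
exists c; split => //.
- rewrite cS big_ord_recl big_ord1/= c0 /bump/= add1n c1E ?subSS ?subn0 ?subnn.
  by rewrite Q0 P1 Q1 mul0r subr0; field.
- move=> n; rewrite (le_trans (cB n))// lerXn2r ?nnegrE//; lra.
move=> t Bt.
have t0 := normr_ge0 t.
have tC : `|t| * (4 * C) <= 1 by nra.
have t1 : `|t| <= 1 by nra.
have near1 (r : {poly R}) y : `|y| <= `|t| -> r`_0 = 1 -> wnorm 0 r <= C ->
    2^-1 <= r.[y] <= 2.
  move=> yt r0 rC; have y1 : `|y| <= 1 by lra.
  have : `|(r - 1%:P).[y]| <= `|y| ^+ 1 * wnorm 0 (r - 1%:P).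
    by apply: norm_horner_le => // -[|//]; rewrite coefB coefC r0 subrr.
  rewrite hornerD hornerN hornerC expr1 => H1.
  have : wnorm 0 (r - 1%:P) <= C + 1.
    by rewrite (le_trans (wnormD _ _ _))// lerD// wnormN wnormC normr1.
  move=> H2; have H3 : `|r.[y] - 1| <= 2^-1.
    apply: (le_trans H1); apply: (@le_trans _ _ (`|t| * (2 * C))); last by lra.
    by rewrite ler_pM ?wnorm_ge0//; lra.
  by move: H3; rewrite ler_norml => /andP[? ?]; apply/andP; split; lra.
have pt y : `|y| <= `|t| -> 2^-1 <= p.[y] <= 2 by move=> yt; apply: near1.
have qt y : `|y| <= `|t| -> 2^-1 <= q.[y] <= 2 by move=> yt; apply: near1.
have ppos y : `|y| <= `|t| -> 0 < p.[y] by move=> /pt/andP[? ?]; lra.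
have qpos y : `|y| <= `|t| -> 0 < q.[y] by move=> /qt/andP[? ?]; lra.
split; [exact: pt|exact: qt|].
have powW y (b' e' : R) : `|y| <= `|t| -> `|b'| = `|b| -> `|e'| = `|e| ->
    0 <= p.[y] `^ b' * q.[y] `^ e' <= W.
  move=> yt bb ee; rewrite mulr_ge0 ?powR_ge0//= ler_pM ?powR_ge0//.
    by have /andP[_] := powR_bounds b' (pt _ yt); rewrite bb.
  by have /andP[_] := powR_bounds e' (qt _ yt); rewrite ee.
case=> [|n].
  rewrite big_ord0 subr0 expr0 mulr1.
  by have /andP[h1 h2] := powW t b e (lexx _) erefl erefl; rewrite ger0_norm//; lra.
pose S := \poly_(j < n.+1) c j.
have -> : \sum_(j < n.+1) c j * t ^+ j = S.[t] by rewrite horner_poly.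
pose r := P * S^`() - Q * S.
have rE l : (l < n)%N -> r`_l = 0 by exact: (ode_residual_coef P0 c0 cS).
have rB : wnorm 0 r <= B0 * (4 * B0) ^+ n.+1.
  rewrite (le_trans (wnormD _ _ _))// wnormN.
  have h1 : wnorm 0 (P * S^`()) <= C ^+ 2 * (4 * B0) ^+ n.+1.
    by rewrite (le_trans (wnormM _ _ _))// ler_pM ?wnorm_ge0// wnorm_deriv2.
  have hh : (2 * B0) ^+ n.+1 <= (4 * B0) ^+ n.+1.
    have h24 : 2 * B0 <= 4 * B0 by apply: ler_wpM2r => //; rewrite ler_nat.
    by apply: lerXn2r h24; rewrite nnegrE mulr_ge0.
  have h2 : wnorm 0 (Q * S) <= (`|b| + `|e|) * C ^+ 2 * (4 * B0) ^+ n.+1.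
    rewrite (le_trans (wnormM _ _ _))// ler_pM ?wnorm_ge0//.
    exact: (le_trans (wnorm_poly_geo _ B01 cB)).
  by rewrite (le_trans (lerD h1 h2))// -mulrDl -B0E.
(* The quotient of the partial sum by the function that it approximates. *)
pose w y := p.[y] `^ (- b) * q.[y] `^ (- e).
pose f y := S.[y] * w y.
pose df y := w y / (p.[y] * q.[y]) * r.[y].
have fd y : `|y| <= `|t| -> is_derive y (1:R) f (df y).
  move=> yt; have py := ppos y yt; have qy := qpos y yt.
  have dp := is_derive_powR_poly (- b) py.
  have dq := is_derive_powR_poly (- e) qy.
  have dS := is_derive_poly S y.
  apply: is_derive_eq; rewrite /df /w /=.
  have sE (u v : R) : u *: (v : R^o) = u * v by [].
  rewrite !sE.
  rewrite !powRB ?(gt_eqF py) ?(gt_eqF qy) ?implybT// !powRr1 ?ltW//.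
  rewrite /r /P /Q hornerD hornerN !hornerM hornerD !hornerZ !hornerM.
  have : p.[y] != 0 by rewrite gt_eqF.
  have : q.[y] != 0 by rewrite gt_eqF.
  move=> ? ?; field.
  by apply/andP.
have dfM y : `|y| <= `|t| -> `|df y| <= 4 * W * (B0 * (4 * B0) ^+ n.+1 * `|t| ^+ n).
  move=> yt.
  have wW : `|w y| <= W.
    have /andP[h1 h2] := powW y (- b) (- e) yt (normrN _) (normrN _).
    by rewrite ger0_norm.
  have pqy : 0 < p.[y] * q.[y] by rewrite mulr_gt0 ?ppos ?qpos.
  have pq4 : `|(p.[y] * q.[y])^-1| <= 4.
    have /andP[p1 _] := pt _ yt; have /andP[q1 _] := qt _ yt.
    have pq : 4^-1 <= p.[y] * q.[y].
      apply: (@le_trans _ _ (2^-1 * 2^-1)); last by rewrite ler_pM.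
      by rewrite -invfM -natrM.
    rewrite ger0_norm ?invr_ge0 ?(ltW pqy)//.
    by rewrite -[leRHS]invrK lef_pV2 ?posrE ?invr_gt0.
  rewrite normrM; apply: ler_pM => //.
    by rewrite normrM mulrC; apply: ler_pM.
  have y1 : `|y| <= 1 by lra.
  rewrite (le_trans (norm_horner_le y1 rE))// mulrC ler_pM ?wnorm_ge0 ?exprn_ge0//.
  by rewrite lerXn2r ?nnegrE.
have := mvt_bound fd dfM (lexx _).
have -> : f 0 = 1.
  rewrite /f /w !horner_coef0 p0 q0 !powR1 !mulr1 coef_poly//=.
move=> fle.
set g := p.[t] `^ b * q.[t] `^ e.
have gw : g * w t = 1.
  rewrite /g /w mulrACA -!powRD ?(gt_eqF (ppos _ (lexx _))) ?(gt_eqF (qpos _ (lexx _))) ?implybT//.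
  by rewrite !subrr !powRr0 mulr1.
have -> : g - S.[t] = - (g * (f t - 1)).
  by rewrite mulrBr mulrCA gw; ring.
have /andP[g0 gW] := powW t b e (lexx _) erefl erefl.
rewrite normrN normrM (ger0_norm g0).
apply: (le_trans (ler_pM g0 (normr_ge0 _) gW fle)).
rewrite (_ : W * _ = B * ((4 * B0) ^+ n.+1 * `|t| ^+ n.+1)); last first.
  by rewrite /B [`|t| ^+ n.+1]exprS; ring.
rewrite -exprMn ler_wpM2l//; first by lra.
rewrite lerXn2r ?nnegrE//; [apply: mulr_ge0; lra|apply: mulr_ge0; lra|].
by rewrite ler_wpM2r.
Qed.

End expansion.

(** * The group, its dilations and the kernel *)

Section dotr.
Context {R : realType} {n : nat}.
Implicit Types x y z : 'rV[R]_n.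

Lemma dotrC x y : dotr x y = dotr y x.
Proof. by apply: eq_bigr => i _; rewrite mulrC. Qed.

Lemma dotrDl x y z : dotr (x + y) z = dotr x z + dotr y z.
Proof. by rewrite /dotr -big_split/=; apply: eq_bigr => i _; rewrite mxE mulrDl. Qed.

Lemma dotrZl a x y : dotr (a *: x) y = a * dotr x y.
Proof. by rewrite /dotr mulr_sumr; apply: eq_bigr => i _; rewrite mxE mulrA. Qed.

Lemma dotrDr x y z : dotr z (x + y) = dotr z x + dotr z y.
Proof. by rewrite dotrC dotrDl !(dotrC z). Qed.

Lemma dotrZr a x y : dotr x (a *: y) = a * dotr x y.
Proof. by rewrite dotrC dotrZl (dotrC x). Qed.

Lemma dotrNl x y : dotr (- x) y = - dotr x y.
Proof. by rewrite -scaleN1r dotrZl mulN1r. Qed.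

Lemma dotrNr x y : dotr x (- y) = - dotr x y.
Proof. by rewrite -scaleN1r dotrZr mulN1r. Qed.

Lemma dotr0l y : dotr 0 y = 0.
Proof. by rewrite /dotr big1// => i _; rewrite mxE mul0r. Qed.

Lemma dotr0r y : dotr y 0 = 0.
Proof. by rewrite dotrC dotr0l. Qed.

Lemma dotr_ge0 x : 0 <= dotr x x.
Proof. by apply: sumr_ge0 => i _; rewrite -expr2 sqr_ge0. Qed.

Lemma enorm_sqr x : enorm x ^+ 2 = dotr x x.
Proof. by rewrite /enorm sqr_sqrtr// dotr_ge0. Qed.

Lemma dotr_delta x i : dotr x (delta_mx 0 i) = x 0 i.
Proof.
rewrite /dotr (bigD1 i)//= mxE !eqxx mulr1 big1 ?addr0// => j ji.
by rewrite mxE eqxx (negbTE ji) mulr0.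
Qed.

Lemma coef_sqr_le x i : (x 0 i) ^+ 2 <= dotr x x.
Proof.
rewrite /dotr (bigD1 i)//= -expr2 lerDl; apply: sumr_ge0 => j _.
by rewrite -expr2 sqr_ge0.
Qed.

Lemma esphereE x : esphere R n x <-> dotr x x = 1.
Proof.
rewrite /esphere/=; split => [e|e]; first by rewrite -enorm_sqr e expr1n.
by rewrite /enorm e sqrtr1.
Qed.

End dotr.

Section group.
Context {R : realType} {p k : nat} (h : htype R p k).
Local Notation N := (carrier R p k).

(** The part of the bracket of two horizontal vectors that enters the group law. *)
Definition bil (X Y : 'rV[R]_p.*2) : 'rV[R]_k := (h (X, 0) (Y, 0)).2.

Lemma bilDr X Y Z : bil X (Y + Z) = bil X Y + bil X Z.
Proof.
have := @bracket_linear_r _ _ _ h (X, 0) 1 (Y, 0) (Z, 0).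
rewrite !scale1r /bil => E.
have -> : (Y + Z, 0) = (Y, 0) + (Z, 0) :> N by rewrite /GRing.add/= /add_pair/= addr0.
by rewrite E.
Qed.

Lemma bilDl X Y Z : bil (Y + Z) X = bil Y X + bil Z X.
Proof.
have := @bracket_linear_l _ _ _ h (X, 0) 1 (Y, 0) (Z, 0).
rewrite !scale1r /bil => E.
have -> : (Y + Z, 0) = (Y, 0) + (Z, 0) :> N by rewrite /GRing.add/= /add_pair/= addr0.
by rewrite E.
Qed.

Lemma bil0r X : bil X 0 = 0.
Proof. by apply: (addrI (bil X 0)); rewrite -bilDr !addr0. Qed.

Lemma bil0l X : bil 0 X = 0.
Proof. by apply: (addrI (bil 0 X)); rewrite -bilDl !addr0. Qed.

Lemma bilZr a X Y : bil X (a *: Y) = a *: bil X Y.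
Proof.
have := @bracket_linear_r _ _ _ h (X, 0) a (Y, 0) 0.
rewrite addr0 (_ : h (X, 0) 0 = 0); last first.
  have := @bracket_linear_r _ _ _ h (X, 0) 1 0 0.
  rewrite !scale1r addr0 => E.
  by apply: (addrI (h (X, 0) 0)); rewrite -E addr0.
rewrite addr0 /bil => E.
rewrite (_ : (a *: Y, 0) = a *: ((Y, 0) : N)) ?E//.
by apply/eqP; rewrite xpair_eqE/= scaler0 !eqxx.
Qed.

Lemma bil_alt X : bil X X = 0.
Proof. by rewrite /bil bracket_alt. Qed.

Lemma bil_anti X Y : bil X Y = - bil Y X.
Proof.
have := bil_alt (X + Y); rewrite bilDl !bilDr !bil_alt addr0 add0r.
by move/eqP; rewrite addr_eq0 => /eqP.
Qed.

Lemma bilZl a X Y : bil (a *: X) Y = a *: bil X Y.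
Proof. by rewrite bil_anti bilZr -scalerN -bil_anti. Qed.

Lemma bilNl X Y : bil (- X) Y = - bil X Y.
Proof. by rewrite -scaleN1r bilZl scaleN1r. Qed.

Lemma bilNr X Y : bil X (- Y) = - bil X Y.
Proof. by rewrite -scaleN1r bilZr scaleN1r. Qed.

Lemma bil_suml I (r : seq I) (F : I -> 'rV[R]_p.*2) Y :
  bil (\sum_(i <- r) F i) Y = \sum_(i <- r) bil (F i) Y.
Proof. by elim/big_rec2 : _ => [|i x y _ <-]; [exact: bil0l|rewrite bilDl]. Qed.

Lemma bil_sumr I (r : seq I) (F : I -> 'rV[R]_p.*2) Y :
  bil Y (\sum_(i <- r) F i) = \sum_(i <- r) bil Y (F i).
Proof. by elim/big_rec2 : _ => [|i x y _ <-]; [exact: bil0r|rewrite bilDr]. Qed.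

(** Structure constants of the bracket in the coordinate bases. *)
Definition bcoef (i l : 'I_p.*2) (j : 'I_k) : R :=
  bil (delta_mx 0 i) (delta_mx 0 l) 0 j.

Lemma bilE X Y j :
  bil X Y 0 j = \sum_i \sum_l X 0 i * Y 0 l * bcoef i l j.
Proof.
rewrite {1}[X]row_sum_delta bil_suml summxE; apply: eq_bigr => i _.
rewrite {1}[Y]row_sum_delta bil_sumr summxE; apply: eq_bigr => l _.
by rewrite bilZl bilZr !mxE mulrA.
Qed.

Lemma nmulE (x y : N) : nmul h x y = (x.1 + y.1, x.2 + y.2 + 2^-1 *: bil x.1 y.1).
Proof. by []. Qed.

Lemma nmulA x y z : nmul h x (nmul h y z) = nmul h (nmul h x y) z.
Proof.
rewrite !nmulE/= bilDl bilDr !scalerDr; congr (_, _); first by rewrite addrA.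
by apply/rowP => i; rewrite !mxE; ring.
Qed.

Lemma nmul0 x : nmul h 0 x = x.
Proof. by rewrite nmulE/= bil0l scaler0 addr0 !add0r; case: x. Qed.

Lemma nmuln0 x : nmul h x 0 = x.
Proof. by rewrite nmulE/= bil0r scaler0 !addr0; case: x. Qed.

Lemma nmulKV x y : nmul h x (nmul h (ninv x) y) = y.
Proof.
rewrite nmulA (_ : nmul h x (ninv x) = 0) ?nmul0//.
by rewrite nmulE/= bilNr bil_alt oppr0 scaler0 addr0 !subrr.
Qed.

Lemma ninvM x y : ninv (nmul h x y) = nmul h (ninv y) (ninv x).
Proof.
rewrite !nmulE /ninv/=; congr (_, _); first by rewrite opprD addrC.
rewrite bilNl bilNr opprK (bil_anti y.1 x.1) scalerN !opprD.
by rewrite [- x.2 - _]addrC.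
Qed.

Lemma ninvK : involutive (@ninv R p k).
Proof. by case=> X Z; rewrite /ninv/= !opprK. Qed.

Definition dil (s : R) (x : N) : N := (Num.sqrt s *: x.1, s *: x.2).

Lemma dilM s x y : 0 <= s -> dil s (nmul h x y) = nmul h (dil s x) (dil s y).
Proof.
move=> s0; rewrite !nmulE /dil/=; congr (_, _); first by rewrite scalerDr.
rewrite bilZl bilZr !scalerDr; congr (_ + _).
rewrite !scalerA; congr (_ *: _).
by rewrite -expr2 sqr_sqrtr// mulrC.
Qed.

Lemma dil_ninv s x : dil s (ninv x) = ninv (dil s x).
Proof. by rewrite /dil /ninv/= !scalerN. Qed.

Lemma dilD s t x : 0 <= s -> 0 <= t -> dil s (dil t x) = dil (s * t) x.
Proof. by move=> s0 t0; rewrite /dil/= !scalerA -sqrtrM. Qed.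

Lemma dil1 x : dil 1 x = x.
Proof. by rewrite /dil sqrtr1 !scale1r; case: x. Qed.

Lemma dil0 s : dil s 0 = 0.
Proof. by rewrite /dil !scaler0. Qed.

Definition hsq (x : N) : R := dotr x.1 x.1.
Definition vsq (x : N) : R := dotr x.2 x.2.

Lemma hsq_ge0 x : 0 <= hsq x. Proof. exact: dotr_ge0. Qed.
Lemma vsq_ge0 x : 0 <= vsq x. Proof. exact: dotr_ge0. Qed.

Lemma hsq_dil s x : 0 <= s -> hsq (dil s x) = s * hsq x.
Proof. by move=> s0; rewrite /hsq dotrZl dotrZr mulrA -expr2 sqr_sqrtr. Qed.

Lemma vsq_dil s x : vsq (dil s x) = s ^+ 2 * vsq x.
Proof. by rewrite /vsq dotrZl dotrZr mulrA -expr2. Qed.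

(** The square of the homogeneous gauge, a polynomial in the coordinates. *)
Definition gsq (x : N) : R := hsq x ^+ 2 + 16 * vsq x.

Lemma gsq_ge0 x : 0 <= gsq x.
Proof. by rewrite addr_ge0 ?sqr_ge0// mulr_ge0// vsq_ge0. Qed.

Lemma ngauge_sqr x : ngauge x ^+ 2 = gsq x.
Proof.
have -> : ngauge x = Num.sqrt (gsq x).
  by rewrite /ngauge -[4%N]/(2 * 2)%N exprM !enorm_sqr.
by rewrite sqr_sqrtr// gsq_ge0.
Qed.

Lemma ngauge_ge0 (x : N) : 0 <= ngauge x.
Proof. exact: sqrtr_ge0. Qed.

Lemma ngauge_lt (x : N) r : 0 < r -> (ngauge x < r) = (gsq x < r ^+ 2).
Proof.
by move=> r0; rewrite -ngauge_sqr ltr_pXn2r// nnegrE ?ngauge_ge0// ltW.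
Qed.

Lemma gsq_dil s x : 0 <= s -> gsq (dil s x) = s ^+ 2 * gsq x.
Proof. by move=> s0; rewrite /gsq hsq_dil// vsq_dil; ring. Qed.

(** The base of the power in the kernel, with the square completed. *)
Definition dens (a : R) (x : N) : R := (4 * a + hsq x) ^+ 2 + 16 * vsq x.

Lemma densE a x : dens a x = 16 * a ^+ 2 + 8 * a * hsq x + gsq x.
Proof. rewrite /dens /gsq; ring. Qed.

Lemma dens_gt0 a x : 0 < a -> 0 < dens a x.
Proof.
move=> a0; rewrite ltr_wpDr ?mulr_ge0 ?vsq_ge0// exprn_gt0//.
by rewrite ltr_wpDr ?hsq_ge0// mulr_gt0.
Qed.

Lemma dens_dil s a x : 0 <= s -> dens (s * a) (dil s x) = s ^+ 2 * dens a x.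
Proof. by move=> s0; rewrite /dens hsq_dil// vsq_dil; ring. Qed.

Lemma hsq_le_gauge x : hsq x <= ngauge x.
Proof.
rewrite -(@ler_pXn2r _ 2)// ?nnegrE ?ngauge_ge0 ?hsq_ge0// ngauge_sqr.
by rewrite lerDl mulr_ge0// vsq_ge0.
Qed.

Variables (c beta : R).
Local Notation s := (rho R p k + beta).

Lemma qkerE a x : qker c beta a x = c * (a `^ (2 * beta) * dens a x `^ (- s)).
Proof. by rewrite /qker enorm_sqr ngauge_sqr -densE powRN. Qed.

Lemma two_s : 2 * s = (p + k)%:R + 2 * beta.
Proof. by rewrite /rho; field. Qed.

(** The homogeneous dimension is p + k, and the exponents in the kernel are balanced
    so as to make it homogeneous of the opposite degree. *)
Lemma qker_dil r a x : 0 < r -> 0 < a ->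
  qker c beta (r * a) (dil r x) = r ^- (p + k) * qker c beta a x.
Proof.
move=> r0 a0; rewrite !qkerE dens_dil ?ltW//.
rewrite (@powRM _ r a) ?ltW// (@powRM _ (r ^+ 2)) ?exprn_ge0 ?ltW ?dens_gt0//.
rewrite -(@powR_mulrn _ r 2) ?ltW// -powRrM mulrN two_s opprD powRD; last by rewrite (gt_eqF r0) implybT.
rewrite !powRN powR_mulrn ?ltW//.
have : dens a x `^ s != 0 by rewrite gt_eqF// powR_gt0// dens_gt0.
have : r `^ (2 * beta) != 0 by rewrite gt_eqF// powR_gt0.
have : r ^+ (p + k) != 0 by rewrite gt_eqF// exprn_gt0.
by move=> ? ? ?; field; rewrite ?andbT; do ?[apply/andP; split].
Qed.

Lemma qker_gt0 a (x : N) : 0 < c -> 0 < a -> 0 < qker c beta a x.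
Proof. by move=> c0 a0; rewrite qkerE !mulr_gt0// ?powR_gt0// dens_gt0. Qed.

End group.

(** * The kernel along polynomial curves *)

Section curve.
Context {R : realType} {p k : nat} (h : htype R p k).
Local Notation N := (carrier R p k).

(** Curves along which the kernel is a product of real powers of two polynomials. *)
Record pcurve := PCurve {
  hpol : 'I_p.*2 -> {poly R};
  vpol : 'I_k -> {poly R};
  apol : {poly R} }.

Definition cpoint (g : pcurve) (t : R) : N :=
  (\row_i (hpol g i).[t], \row_j (vpol g j).[t]).

Definition bounded_curve (C a0 : R) (g : pcurve) :=
  [/\ forall i, wnorm 1 (hpol g i) <= C, forall j, wnorm 1 (vpol g j) <= C,
      wnorm 1 (apol g) <= C & a0 <= (apol g)`_0].

Definition hdpol g (y : N) : {poly R} :=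
  4 *: apol g + \sum_i (hpol g i - (y.1 0 i)%:P) ^+ 2.

Definition vdpol g (y : N) j : {poly R} :=
  vpol g j - (y.2 0 j)%:P -
  2^-1 *: (\sum_i \sum_l (y.1 0 i * bcoef h i l j) *: hpol g l).

(** For a fixed base point y the quantity under the power in the kernel is a
    polynomial in the parameter of the curve (dpolE). *)
Definition dpol g (y : N) : {poly R} :=
  hdpol g y ^+ 2 + 16 *: \sum_j vdpol g y j ^+ 2.

Lemma hdpolE g y t :
  (hdpol g y).[t] = 4 * (apol g).[t] + hsq (nmul h (ninv y) (cpoint g t)).
Proof.
rewrite hornerD hornerZ horner_sum /hsq nmulE/=; congr (_ + _).
by apply: eq_bigr => i _; rewrite !mxE !(hornerE, horner_exp) expr2 addrC.
Qed.

Lemma vdpolE g y t j : (vdpol g y j).[t] = (nmul h (ninv y) (cpoint g t)).2 0 j.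
Proof.
rewrite !hornerE nmulE/= !mxE bilE [X in _ = X + _]addrC; congr (_ + _).
rewrite horner_sum -mulrN -sumrN; congr (_ * _); apply: eq_bigr => i _.
by rewrite horner_sum -sumrN; apply: eq_bigr => l _; rewrite hornerZ !mxE; ring.
Qed.

Lemma dpolE g y t :
  (dpol g y).[t] = dens (apol g).[t] (nmul h (ninv y) (cpoint g t)).
Proof.
rewrite hornerD horner_exp hdpolE hornerZ horner_sum /dens; congr (_ + _ * _).
by apply: eq_bigr => j _; rewrite horner_exp vdpolE expr2.
Qed.

Lemma wnorm_recenter m (q : {poly R}) : wnorm m (q - (q`_0)%:P) <= 2 * wnorm m q.
Proof.
rewrite (le_trans (wnormD _ _ _))// wnormN wnormC mulr_natl mulr2n lerD//.
exact: norm_coef_le.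
Qed.

Lemma wnorm_sqr_le m (q : {poly R}) (x K : R) : wnorm m q <= `|x| + K ->
  wnorm m (q ^+ 2) <= 2 * x ^+ 2 + 2 * K ^+ 2.
Proof.
move=> qxK; rewrite expr2 (le_trans (wnormM _ _ _))//.
have q0 := wnorm_ge0 m q.
have -> : x ^+ 2 = `|x| ^+ 2 by rewrite real_normK// num_real.
have : 0 <= (`|x| - K) ^+ 2 by apply: sqr_ge0.
nra.
Qed.

(** This is what makes all later estimates uniform in the base point y: the whole
    polynomial is controlled by its value at 0. In the horizontal part the
    constant term grows quadratically with y, the other coefficients at most
    linearly. In the vertical part the bracket makes the other coefficients grow
    linearly, and their squares are dominated by the square of the horizontal part. *)
Lemma dpol_bound (C a0 : R) : 0 <= C -> 0 < a0 -> exists C', forall g,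
  bounded_curve C a0 g -> forall y, wnorm 1 (dpol g y) <= C' * (dpol g y).[0].
Proof.
move=> C0 a00.
pose K1 := (4 * C + 16 * p%:R * C ^+ 2) / (4 * a0) + 2.
pose K2 := 1 + (1 + C) / (4 * a0).
pose Bs := \sum_i \sum_l \sum_j `|bcoef h i l j|.
pose K3 := 2 * C / (4 * a0) + C * K2 * Bs.
exists (K1 ^+ 2 + 2 + 32 * k%:R * K3 ^+ 2) => g [gX gZ ga ga0] y.
have p0 : 0 <= p%:R :> R by [].
have k0 : 0 <= k%:R :> R by [].
pose x i := (hpol g i - (y.1 0 i)%:P).[0].
pose A := (hdpol g y).[0].
have sx0 : 0 <= \sum_i x i ^+ 2 by apply: sumr_ge0 => i _; apply: sqr_ge0.
have AE : A = 4 * (apol g)`_0 + \sum_i x i ^+ 2.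
  rewrite /A hornerD hornerZ horner_coef0 horner_sum; congr (_ + _).
  by apply: eq_bigr => i _; rewrite horner_exp.
have A4 : 4 * a0 <= A by lra.
have Ax : \sum_i x i ^+ 2 <= A by lra.
have aA z : 0 <= z -> z <= z / (4 * a0) * A.
  by move=> z0; rewrite mulrAC ler_pdivlMr ?mulr_gt0// ler_wpM2l.
have C20 := sqr_ge0 C.
have K10 : 0 <= K1.
  by rewrite addr_ge0// divr_ge0//; [apply: addr_ge0; rewrite !mulr_ge0|rewrite mulr_ge0// ltW].
have K20 : 0 <= K2 by rewrite addr_ge0// divr_ge0// ?addr_ge0// mulr_ge0// ltW.
have Bs0 : 0 <= Bs by do 3!(apply: sumr_ge0 => ? _).
have K30 : 0 <= K3.
  rewrite addr_ge0// ?divr_ge0 ?mulr_ge0//; exact: ltW.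
(* A, the horizontal part at 0, bounds its own polynomial, the coordinates of y.1
   and the non constant coefficients of the vertical part, up to constants. *)
have h1 : wnorm 1 (hdpol g y) <= K1 * A.
  rewrite (le_trans (wnormD _ _ _))// wnormZ ger0_norm//.
  have : wnorm 1 (\sum_i (hpol g i - (y.1 0 i)%:P) ^+ 2) <=
      \sum_i (2 * x i ^+ 2 + 2 * (2 * C) ^+ 2).
    apply: (le_trans (wnorm_sum _ _ _ _)); apply: ler_sum => i _.
    apply: wnorm_sqr_le.
    rewrite -[hpol g i](subrK ((hpol g i)`_0)%:P) -addrA -rmorphB/=.
    rewrite (le_trans (wnormD _ _ _))// wnormC [in leRHS]addrC lerD//.
      by rewrite (le_trans (wnorm_recenter _ _))// ler_wpM2l.
    by rewrite /x hornerD hornerN hornerC horner_coef0.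
  rewrite big_split/= -mulr_sumr sumr_const card_ord => H.
  have := aA (4 * C + 16 * p%:R * C ^+ 2).
  rewrite addr_ge0 ?mulr_ge0// => /(_ isT).
  have pp : p.*2%:R = 2 * p%:R :> R by rewrite -mul2n natrM.
  rewrite -[(2 * (2 * C) ^+ 2) *+ _]mulr_natl pp in H.
  rewrite /K1 mulrDl; lra.
have h2 i : `|y.1 0 i| <= K2 * A.
  have xi : x i = (hpol g i)`_0 - y.1 0 i.
    by rewrite /x hornerD hornerN hornerC horner_coef0.
  have xiA : `|x i| <= 1 + A.
    have : x i ^+ 2 <= A.
      apply: le_trans Ax; rewrite (bigD1 i)//= lerDl.
      by apply: sumr_ge0 => ? _; apply: sqr_ge0.
    have -> : x i ^+ 2 = `|x i| ^+ 2 by rewrite real_normK// num_real.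
    have := sqr_ge0 (`|x i| - 1); nra.
  have -> : y.1 0 i = (hpol g i)`_0 - x i by rewrite xi; ring.
  rewrite (le_trans (ler_normB _ _))//.
  have : `|(hpol g i)`_0| <= C by apply: le_trans (gX i); apply: norm_coef_le.
  have := aA (1 + C); rewrite addr_ge0// => /(_ isT); rewrite /K2 mulrDl; lra.
have h3 j : wnorm 1 (vdpol g y j) <= `|(vdpol g y j).[0]| + K3 * A.
  rewrite -[vdpol g y j in leLHS](subrK ((vdpol g y j)`_0)%:P).
  rewrite (le_trans (wnormD _ _ _))// wnormC horner_coef0 addrC lerD//.
  have -> : vdpol g y j - ((vdpol g y j)`_0)%:P = (vpol g j - ((vpol g j)`_0)%:P) -
     2^-1 *: (\sum_i \sum_l (y.1 0 i * bcoef h i l j) *: (hpol g l - ((hpol g l)`_0)%:P)).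
    pose rc (q : {poly R}) := q - (q`_0)%:P.
    have rcD u v : rc (u + v) = rc u + rc v by rewrite /rc coefD polyCD; ring.
    have rcZ a u : rc (a *: u) = a *: rc u.
      by rewrite /rc coefZ scalerBr polyCM mul_polyC.
    have rcN u : rc (- u) = - rc u by rewrite -scaleN1r rcZ scaleN1r.
    have rc0 : rc 0 = 0 by rewrite /rc coef0 subr0.
    have rcC a : rc a%:P = 0 by rewrite /rc coefC subrr.
    rewrite -!/(rc _) /vdpol !rcD !rcN rcC oppr0 addr0 rcZ (big_morph _ rcD rc0).
    congr (_ - _ *: _); apply: eq_bigr => i _; rewrite (big_morph _ rcD rc0).
    by apply: eq_bigr => l _; rewrite rcZ.
  rewrite (le_trans (wnormD _ _ _))// wnormN wnormZ /K3 mulrDl lerD//.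
    rewrite (le_trans (wnorm_recenter _ _))// (le_trans _ (aA _ _)) ?mulr_ge0//.
    by rewrite ler_wpM2l.
  have -> : C * K2 * Bs * A = `|2^-1| * \sum_i \sum_l \sum_m (K2 * A * `|bcoef h i l m| * (2 * C)).
    rewrite ger0_norm// /Bs.
    have -> : \sum_i \sum_l \sum_m (K2 * A * `|bcoef h i l m| * (2 * C)) =
      2 * (C * K2 * A) * \sum_i \sum_l \sum_m `|bcoef h i l m|.
      rewrite mulr_sumr; apply: eq_bigr => i _; rewrite mulr_sumr; apply: eq_bigr => l _.
      by rewrite mulr_sumr; apply: eq_bigr => m _; ring.
    by field.
  rewrite ler_wpM2l//; apply: (le_trans (wnorm_sum _ _ _ _)); apply: ler_sum => i _.
  apply: (le_trans (wnorm_sum _ _ _ _)); apply: ler_sum => l _.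
  rewrite wnormZ; apply: (@le_trans _ _ (K2 * A * `|bcoef h i l j| * (2 * C))).
    rewrite ler_pM ?wnorm_ge0//; first by rewrite normrM ler_wpM2r.
    by rewrite (le_trans (wnorm_recenter _ _))// ler_wpM2l.
  have A0 : 0 <= A by lra.
  rewrite (bigD1 j)//= lerDl; apply: sumr_ge0 => m _; rewrite !mulr_ge0//.
have h4 : wnorm 1 (\sum_j vdpol g y j ^+ 2) <=
    2 * \sum_j (vdpol g y j).[0] ^+ 2 + 2 * k%:R * (K3 * A) ^+ 2.
  apply: (le_trans (wnorm_sum _ _ _ _)).
  apply: (@le_trans _ _ (\sum_j (2 * (vdpol g y j).[0] ^+ 2 + 2 * (K3 * A) ^+ 2))).
    by apply: ler_sum => j _; apply: wnorm_sqr_le.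
  rewrite big_split/= -mulr_sumr sumr_const card_ord.
  by rewrite -[(2 * (K3 * A) ^+ 2) *+ _]mulr_natl; lra.
rewrite (le_trans (wnormD _ _ _))// wnormZ (ger0_norm (x := 16))//.
have h5 : wnorm 1 (hdpol g y ^+ 2) <= K1 ^+ 2 * A ^+ 2.
  rewrite expr2 (le_trans (wnormM _ _ _))// -exprMn expr2.
  by rewrite ler_pM ?wnorm_ge0.
have -> : (dpol g y).[0] = A ^+ 2 + 16 * \sum_j (vdpol g y j).[0] ^+ 2.
  rewrite hornerD horner_exp hornerZ horner_sum; congr (_ + _ * _).
  by apply: eq_bigr => j _; rewrite horner_exp.
have V0 : 0 <= \sum_j (vdpol g y j).[0] ^+ 2 by apply: sumr_ge0 => j _; apply: sqr_ge0.
set V := (\sum_j _) in h4 V0 *.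
have A20 := sqr_ge0 A; have K120 := sqr_ge0 K1; have K320 := sqr_ge0 K3.
have kK : 0 <= 32 * k%:R * K3 ^+ 2 by rewrite !mulr_ge0.
rewrite exprMn in h4.
have := mulr_ge0 K120 V0; have := mulr_ge0 kK V0; have := mulr_ge0 kK A20.
nra.
Qed.

End curve.

Section kernel.
Context {R : realType} {p k : nat} (h : htype R p k).
Local Notation N := (carrier R p k).
Variables (c beta : R).
Hypothesis c0 : 0 < c.
Hypothesis beta0 : 0 < beta.
Local Notation s := (rho R p k + beta).

(** The kernel seen as a function of the point of integration, at which measures are
    paired with it. *)
Definition gker (P : N * R) (y : N) : R :=
  qker c beta P.2 (nmul h (ninv y) P.1).

Lemma gkerE P y :
  gker P y = c * (P.2 `^ (2 * beta) * dens P.2 (nmul h (ninv y) P.1) `^ (- s)).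
Proof. exact: qkerE. Qed.

Lemma gker_gt0 P y : 0 < P.2 -> 0 < gker P y.
Proof. by move=> ?; exact: qker_gt0. Qed.

Lemma s_gt0 : 0 < s.
Proof. by rewrite ltr_wpDl// divr_ge0. Qed.

Definition cpair (g : pcurve) (t : R) : N * R := (cpoint g t, (apol g).[t]).

(** Real analyticity of the kernel along a curve, with a radius and an error
    relative to the value at 0 that are uniform in y. The coefficients of order one
    and two are kept explicit since the differential equation of the kernel is read
    off from them. *)
Lemma kernel_expansion (C a0 : R) : 0 <= C -> 0 < a0 -> exists B, 1 <= B /\
  forall g, bounded_curve C a0 g ->
  (forall t, B * `|t| <= 1 -> 0 < (apol g).[t]) /\
  forall y, exists cf : nat -> R,
  let al i := (apol g)`_i / (apol g)`_0 in
  let ep i := (dpol h g y)`_i / (dpol h g y)`_0 in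
  [/\ cf 0%N = 1,
      cf 1%N = 2 * beta * al 1%N + (- s) * ep 1%N,
      cf 2%N = 2 * beta * al 2 + 2 * beta * (2 * beta - 1) / 2 * al 1%N ^+ 2 +
            (- s) * ep 2 + (- s) * (- s - 1) / 2 * ep 1%N ^+ 2 +
            2 * beta * (- s) * al 1%N * ep 1%N,
      forall n, `|cf n| <= B ^+ n &
      forall t, B * `|t| <= 1 -> forall n,
        `|gker (cpair g t) y - (\sum_(j < n) cf j * t ^+ j) * gker (cpair g 0) y|
        <= B * (B * `|t|) ^+ n * gker (cpair g 0) y].
Proof.
move=> C0 a00; have [D Db] := dpol_bound h C0 a00.
have [B [B1 HB]] := power_expansion (2 * beta) (- s) (Num.max (C / a0) D).
exists B; split=> // g gb; have [_ _ gC ga] := gb.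
have ag0 : 0 < (apol g)`_0 by rewrite (lt_le_trans a00).
(* Both polynomials are normalised to have constant term 1. *)
pose P := ((apol g)`_0)^-1 *: apol g.
have P0 : P`_0 = 1 by rewrite coefZ mulVf// gt_eqF.
have PC : wnorm 1 P <= Num.max (C / a0) D.
  rewrite le_max wnormZ ger0_norm ?invr_ge0 ?(ltW ag0)// mulrC.
  by rewrite ler_pM ?wnorm_ge0 ?invr_ge0 ?(ltW ag0)// lef_pV2.
have Pt t : (apol g).[t] = (apol g)`_0 * P.[t].
  by rewrite hornerZ mulrA mulfV ?mul1r// gt_eqF.
have d0 y : 0 < (dpol h g y)`_0.
  by rewrite -horner_coef0 dpolE dens_gt0// horner_coef0.
pose E y := ((dpol h g y)`_0)^-1 *: dpol h g y.
have E0 y : (E y)`_0 = 1 by rewrite coefZ mulVf// gt_eqF.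
have EC y : wnorm 1 (E y) <= Num.max (C / a0) D.
  apply: (@le_trans _ _ D); last by rewrite le_max lexx orbT.
  rewrite wnormZ ger0_norm ?invr_ge0 ?(ltW (d0 y))// mulrC.
  by rewrite ler_pdivrMr// -horner_coef0 Db.
have Et y t : (dpol h g y).[t] = (dpol h g y)`_0 * (E y).[t].
  by rewrite hornerZ mulrA mulfV ?mul1r// gt_eqF.
split=> [t Bt|y].
  have [cf [_ _ _ _ /(_ t Bt) [/andP[h1 _] _ _]]] := HB P (E 0) P0 (E0 0) PC (EC 0).
  by rewrite Pt mulr_gt0// (lt_le_trans _ h1)// invr_gt0.
have [cf [cf0 cf1 cf2 cfB cfE]] := HB P (E y) P0 (E0 y) PC (EC y).
exists cf => al ep.
have alE i : P`_i = al i by rewrite coefZ mulrC.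
have epE i : (E y)`_i = ep i by rewrite coefZ mulrC.
rewrite !alE !epE in cf1 cf2; split => // t Bt n.
have [/andP[Pt1 _] /andP[Et1 _] /(_ n) key] := cfE t Bt.
have Ppos : 0 < P.[t] by rewrite (lt_le_trans _ Pt1)// invr_gt0.
have Epos : 0 < (E y).[t] by rewrite (lt_le_trans _ Et1)// invr_gt0.
have GE u : gker (cpair g u) y =
    c * ((apol g).[u] `^ (2 * beta) * (dpol h g y).[u] `^ (- s)).
  by rewrite gkerE/= dpolE.
have G0 : 0 < gker (cpair g 0) y by rewrite gker_gt0//= horner_coef0.
have -> : gker (cpair g t) y =
    (P.[t] `^ (2 * beta) * (E y).[t] `^ (- s)) * gker (cpair g 0) y.
  rewrite !GE Pt Et !horner_coef0 !powRM; try exact: ltW; try exact: ltW (d0 y).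
  by ring.
by rewrite -mulrBl normrM (gtr0_norm G0) ler_wpM2r// ltW.
Qed.

Definition lin_curve (P : N * R) (V : N) (b : R) : pcurve := {|
  hpol := fun i => (P.1.1 0 i)%:P + V.1 0 i *: 'X;
  vpol := fun j => (P.1.2 0 j)%:P + V.2 0 j *: 'X;
  apol := P.2%:P + b *: 'X |}.

Lemma wnorm_lin m (x v : R) : wnorm m (x%:P + v *: 'X) <= `|x| + 2 ^+ m * `|v|.
Proof.
rewrite (le_trans (wnormD _ _ _))// wnormC wnormZ lerD// mulrC ler_wpM2r//.
have := @wnormXnM R m 1 1; rewrite expr1 mulr1 => H.
by rewrite (le_trans H)// wnormC normr1 mulr1.
Qed.

Lemma horner_lin (x v t : R) : (x%:P + v *: 'X).[t] = x + t * v.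
Proof. by rewrite !hornerE mulrC. Qed.

Lemma cpair_lin P V b t : cpair (lin_curve P V b) t = (P.1 + t *: V, P.2 + t * b).
Proof.
rewrite /cpair /cpoint /= horner_lin; congr (_, _).
have E (n : nat) (x v : 'rV[R]_n) :
   \row_i ((x 0 i)%:P + v 0 i *: 'X).[t] = x + t *: v.
  by apply/rowP => i; rewrite !mxE horner_lin.
by rewrite !E.
Qed.

Definition cbound (C : R) (x : N) :=
  (forall i, `|x.1 0 i| <= C) /\ (forall j, `|x.2 0 j| <= C).

Lemma bounded_lin (C a0 : R) P V b : 0 < a0 -> cbound C P.1 -> cbound C V ->
  a0 <= P.2 <= C -> `|b| <= C -> bounded_curve (3 * C) a0 (lin_curve P V b).
Proof.
move=> a00 [P1 P2] [V1 V2] /andP[a1 a2] bC.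
have key (x v : R) : `|x| <= C -> `|v| <= C -> wnorm 1 (x%:P + v *: 'X) <= 3 * C.
  by move=> xC vC; rewrite (le_trans (wnorm_lin _ _ _))// expr1; lra.
split => [i|j||] /=; try exact: key.
- by apply: key => //; rewrite ger0_norm// (le_trans (ltW a00)).
- by rewrite coefD coefC coefZ coefX/= mulr0 addr0.
Qed.

Lemma curve_bounded (g : @pcurve R p k) : exists2 C, 0 <= C & bounded_curve C (apol g)`_0 g.
Proof.
exists (\sum_i wnorm 1 (hpol g i) + \sum_j wnorm 1 (vpol g j) + wnorm 1 (apol g)).
  by rewrite !addr_ge0 ?wnorm_ge0// sumr_ge0// => i _; exact: wnorm_ge0.
have s1 : 0 <= \sum_i wnorm 1 (hpol g i) by apply: sumr_ge0 => i _; exact: wnorm_ge0.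
have s2 : 0 <= \sum_i wnorm 1 (vpol g i) by apply: sumr_ge0 => i _; exact: wnorm_ge0.
have s3 := wnorm_ge0 1 (apol g).
split => [i|j||//].
- apply: (@le_trans _ _ (\sum_i wnorm 1 (hpol g i))); last by lra.
  by rewrite (bigD1 i)//= lerDl sumr_ge0// => ? _; exact: wnorm_ge0.
- apply: (@le_trans _ _ (\sum_i wnorm 1 (vpol g i))); last by lra.
  by rewrite (bigD1 j)//= lerDl sumr_ge0// => ? _; exact: wnorm_ge0.
- by lra.
Qed.

(** Harnack inequality: the polynomial of the segment between two points is bounded
    at its end by a multiple of its value at its origin. *)
Lemma gker_compare (C a0 : R) : 0 <= C -> 0 < a0 -> exists2 K, 0 < K &
  forall P P' : N * R, cbound C P.1 -> cbound C P'.1 ->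
    a0 <= P.2 <= C -> a0 <= P'.2 <= C ->
    forall y, gker P y <= K * gker P' y.
Proof.
move=> C0 a00.
have C60 : 0 <= 3 * (2 * C) by rewrite !mulr_ge0.
have [D Db] := dpol_bound h C60 a00.
pose D1 := Num.max D 1.
have D10 : 0 < D1 by rewrite lt_max ltr01 orbT.
have [C00|Cn0] := ltP 0 C; last first.
  exists 1 => // P P' _ _ /andP[a1 a2]; exfalso.
  by have := lt_le_trans a00 (le_trans a1 (le_trans a2 Cn0)); rewrite ltxx.
exists ((C / a0) `^ (2 * beta) * D1 `^ s).
  by rewrite mulr_gt0// powR_gt0// divr_gt0.
move=> P P' [P1 P2] [P1' P2'] /andP[a1 a2] /andP[a1' a2'] y.
pose V : N := P'.1 - P.1.
have bC (u v : R) : `|u| <= C -> `|v| <= C -> `|u - v| <= 2 * C.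
  by move=> uC vC; rewrite (le_trans (ler_normB _ _))//; lra.
have aP : 0 < P.2 by rewrite (lt_le_trans a00).
have aP' : 0 < P'.2 by rewrite (lt_le_trans a00).
have CC : C <= 2 * C by lra.
pose g := lin_curve P V (P'.2 - P.2).
have gb : bounded_curve (3 * (2 * C)) a0 g.
  apply: bounded_lin => //.
  - by split=> ?; rewrite (le_trans _ CC).
  - by split=> ?; rewrite !mxE bC.
  - by rewrite a1 (le_trans a2).
  - by rewrite bC// gtr0_norm.
have dle : dens P'.2 (nmul h (ninv y) P'.1) <= D1 * dens P.2 (nmul h (ninv y) P.1).
  have E1 : cpair g 1 = P' by rewrite cpair_lin scale1r mul1r /V !subrKC; case: (P').
  have E0 : cpair g 0 = P by rewrite cpair_lin scale0r mul0r !addr0; case: (P).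
  have D1E : (dpol h g y).[1] = dens P'.2 (nmul h (ninv y) P'.1).
    by rewrite dpolE -[in RHS]E1.
  have D0E : (dpol h g y).[0] = dens P.2 (nmul h (ninv y) P.1).
    by rewrite dpolE -[in RHS]E0.
  have := Db g gb y; rewrite D0E => H.
  have : `|(dpol h g y).[1]| <= wnorm 1 (dpol h g y).
    rewrite (le_trans (@norm_horner_le _ 0 _ _ _ _)) ?normr1// expr0 mul1r.
    exact: wnormS.
  rewrite D1E gtr0_norm ?dens_gt0// => H1.
  rewrite (le_trans H1)// (le_trans H)// ler_wpM2r//; first exact/ltW/dens_gt0.
  by rewrite /D1 le_max lexx.
rewrite !gkerE [leRHS]mulrCA ler_wpM2l ?(ltW c0)//.
rewrite [leRHS]mulrACA ler_pM ?powR_ge0//.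
  rewrite -powRM ?divr_ge0 ?(ltW C00) ?(ltW a00) ?(ltW aP')//.
  have Pa : P.2 <= C / a0 * P'.2.
    by rewrite mulrAC ler_pdivlMr// ler_pM// ?(ltW aP) ?(ltW a00).
  apply: ge0_ler_powR => //; first by rewrite mulr_ge0// ltW.
    by rewrite nnegrE ltW.
  by rewrite nnegrE (le_trans (ltW aP)).
have dy : 0 < dens P.2 (nmul h (ninv y) P.1) by rewrite dens_gt0.
have dy' : 0 < dens P'.2 (nmul h (ninv y) P'.1) by rewrite dens_gt0.
have h2 : dens P'.2 (nmul h (ninv y) P'.1) `^ s <=
    D1 `^ s * dens P.2 (nmul h (ninv y) P.1) `^ s.
  rewrite -powRM ?(ltW D10) ?(ltW dy)// ge0_ler_powR ?(ltW s_gt0)//.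
    by rewrite nnegrE ltW.
  by rewrite nnegrE mulr_ge0 ?(ltW D10) ?(ltW dy).
have e1 : 0 < dens P.2 (nmul h (ninv y) P.1) `^ s by rewrite powR_gt0.
have e2 : 0 < dens P'.2 (nmul h (ninv y) P'.1) `^ s by rewrite powR_gt0.
move: e1 e2 h2; rewrite !powRN.
move: (dens P.2 _ `^ s) (dens P'.2 _ `^ s) (D1 `^ s) => u u' w u0 u'0 uw.
by rewrite ler_pdivlMr// mulrC ler_pdivrMr.
Qed.

(** The first order case of kernel_expansion, along the segment from P to P' run
    in time d. *)
Lemma gker_lip (C a0 : R) : 0 <= C -> 0 < a0 -> exists B, 1 <= B /\
  forall P P' : N * R, cbound C P.1 -> a0 <= P.2 <= C ->
    forall d, 0 < d -> B * d <= 1 -> cbound d (P'.1 - P.1) -> `|P'.2 - P.2| <= d ->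
    forall y, `|gker P' y - gker P y| <= B * d * gker P y.
Proof.
move=> C0 a00; pose C1 := Num.max C 1.
have C10 : 0 <= C1 by rewrite le_max ler01 orbT.
have [B [B1 HB]] := kernel_expansion (mulr_ge0 (ler0n _ 3) C10) a00.
exists (B * B); split; first by rewrite -[1]mulr1 ler_pM.
move=> P P' [P1 P2] /andP[a1 a2] d d0 Bd [D1 D2] Db y.
have B0 : 0 <= B by apply: le_trans B1.
pose g := lin_curve P (d^-1 *: (P'.1 - P.1)) (d^-1 * (P'.2 - P.2)).
have CC : C <= C1 by rewrite le_max lexx.
have C1' : 1 <= C1 by rewrite le_max lexx orbT.
have dle u : `|u| <= d -> `|d^-1 * u| <= C1.
  move=> ud; apply: le_trans C1'; rewrite normrM ger0_norm ?invr_ge0 ?(ltW d0)//.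
  by rewrite mulrC ler_pdivrMr// mul1r.
have gb : bounded_curve (3 * C1) a0 g.
  apply: bounded_lin => //.
  - by split=> ?; rewrite (le_trans _ CC).
  - by split=> i; rewrite mxE dle.
  - by rewrite a1 (le_trans a2).
  - exact: dle.
have [_ /(_ y)[cf [cf0 _ _ _ /(_ d)]]] := HB g gb.
have Bd1 : B * `|d| <= 1.
  rewrite gtr0_norm// (le_trans _ Bd)// ler_wpM2r ?(ltW d0)//.
  by rewrite ler_peMl.
move=> /(_ Bd1 1%N); rewrite big_ord1 cf0 expr0 mulr1 mul1r expr1 (gtr0_norm d0).
have -> : cpair g d = P'.
  rewrite cpair_lin scalerA mulrA mulfV ?gt_eqF// scale1r mul1r !subrKC.
  by case: (P').
have -> : cpair g 0 = P.
  by rewrite cpair_lin scale0r mul0r !addr0; case: (P).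
by rewrite mulrA.
Qed.

End kernel.

(** * Jordan decomposition of a locally finite signed measure *)

Section variation.
Context {R : realType} {p k : nat}.
Local Notation N := (carrier R p k).
Implicit Types (s : set N -> R) (A B : set N).

(** Countable additivity on relatively compact Borel sets, the only sets on which a
    locally finite signed measure has a value. *)
Definition sigma_add s := forall E : (set N)^nat,
  (forall i, bounded_borel (E i)) -> trivIset setT E ->
  bounded_borel (\bigcup_i E i) ->
  series (fun i => s (E i)) @ \oo --> s (\bigcup_i E i).

Lemma bounded_borel0 : bounded_borel (set0 : set N).
Proof.
split; first exact: (@measurable0 _ (borel R p k)).
by rewrite precompactE closure0; exact: compact0.
Qed.

Lemma bounded_borelU A B : bounded_borel A -> bounded_borel B -> bounded_borel (A `|` B).
Proof.
move=> [mA cA] [mB cB]; split; first exact: (@measurableU _ (borel R p k)).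
by rewrite precompactE closureU; apply: compactU; rewrite -precompactE.
Qed.

Lemma bounded_borelI A B : bounded_borel A -> measurable (B : set (borel R p k)) ->
  bounded_borel (A `&` B).
Proof.
move=> [mA cA] mB; split; first exact: (@measurableI _ (borel R p k)).
by apply: precompact_subset cA; exact: subIsetl.
Qed.

Section jordan.
Variable s : set N -> R.
Hypothesis sadd : sigma_add s.

Lemma sigma_add0 : s set0 = 0.
Proof.
have := sadd (fun=> bounded_borel0) (@trivIset_set0 _ _ _).
rewrite bigcup0// => /(_ bounded_borel0) H.
have /cvg_series_cvg_0 H0 : cvgn (series (fun i : nat => s set0)).
  by apply/cvg_ex; exists (s set0).
by rewrite -(cvg_lim (@Rhausdorff R) H0) lim_cst.
Qed.

Lemma sigma_addU A B : bounded_borel A -> bounded_borel B -> A `&` B = set0 ->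
  s (A `|` B) = s A + s B.
Proof.
move=> bA bB AB0.
have bE i : bounded_borel (bigcup2 A B i).
  by case: i => [|[|i]] //=; exact: bounded_borel0.
have tE : trivIset setT (bigcup2 A B).
  move=> i j _ _ [x []]; case: i => [|[|i]]; case: j => [|[|j]] //= h1 h2.
    by have : (A `&` B) x by []; rewrite AB0.
  by have : (A `&` B) x by []; rewrite AB0.
have := sadd bE tE; rewrite bigcup2E => /(_ (bounded_borelU bA bB)) H.
rewrite -(cvg_lim (@Rhausdorff R) H); apply: (cvg_lim (@Rhausdorff R)).
rewrite -(cvg_shiftn 2)/=.
have -> : (fun n => series (fun i => s (bigcup2 A B i)) (n + 2)%N) = cst (s A + s B).
  apply/funext => n; rewrite addnC /series/= !big_nat_recl//= big1 ?addr0// => i _.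
  exact: sigma_add0.
exact: cvg_cst.
Qed.

Lemma jpos_ge B A : bounded_borel B -> B `<=` A -> ((s B)%:E <= jpos s A)%E.
Proof. by move=> bB BA; apply: ereal_sup_ubound; exists B. Qed.

Lemma jpos_ge0 A : (0 <= jpos s A)%E.
Proof. by rewrite -[0%E]/((0:R)%:E) -sigma_add0 jpos_ge//; exact: bounded_borel0. Qed.

Lemma jpos0 : jpos s set0 = 0%E.
Proof.
apply/le_anti; rewrite jpos_ge0 andbT; apply: ge_ereal_sup => _ [B [_ B0] <-].
by move: B0; rewrite subset0 => ->; rewrite sigma_add0.
Qed.

Lemma jpos_le A B : A `<=` B -> (jpos s A <= jpos s B)%E.
Proof.
move=> AB; apply: ge_ereal_sup => _ [C [bC CA] <-].
by apply: jpos_ge => //; apply: subset_trans CA AB.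
Qed.

Lemma jpos_superadd A B : A `&` B = set0 -> (jpos s A + jpos s B <= jpos s (A `|` B))%E.
Proof.
move=> AB0.
have [->|fin] := eqVneq (jpos s (A `|` B)) +oo%E; first by rewrite leey.
have JA : (jpos s A <= jpos s (A `|` B))%E by apply: jpos_le; exact: subsetUl.
have JB : (jpos s B <= jpos s (A `|` B))%E by apply: jpos_le; exact: subsetUr.
have fU : jpos s (A `|` B) \is a fin_num by rewrite ge0_fin_numE ?jpos_ge0// ltey.
have fB : jpos s B \is a fin_num.
  by rewrite ge0_fin_numE ?jpos_ge0// (le_lt_trans JB)// ltey.
have fA : jpos s A \is a fin_num.
  by rewrite ge0_fin_numE ?jpos_ge0// (le_lt_trans JA)// ltey.
rewrite -leeBrDr//; apply: ge_ereal_sup => _ [C [bC CA] <-].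
rewrite leeBrDr// -leeBrDl//; apply: ge_ereal_sup => _ [D [bD DB] <-].
rewrite leeBrDl// -EFinD -sigma_addU//.
  apply: jpos_ge; first exact: bounded_borelU.
  exact: setUSS.
by apply/seteqP; split => // x [/CA ? /DB ?]; rewrite -AB0.
Qed.

(** A supremum over subsets is superadditive, whence one inequality; conversely any
    relatively compact B inside the union is cut into countably many pieces, whose
    values are bounded one by one. *)
Lemma jpos_sigma_additive : semi_sigma_additive (jpos s : set (borel R p k) -> \bar R).
Proof.
move=> F mF tF mUF.
have ge0 n : (0 <= jpos s (F n))%E by exact: jpos_ge0.
suff <- : (\sum_(0 <= i <oo) jpos s (F i) = jpos s (\bigcup_i F i))%E.
  exact: is_cvg_nneseries.
apply/le_anti/andP; split.
  apply: lime_le; first exact: is_cvg_nneseries.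
  apply: nearW => n; apply: (@le_trans _ _ (jpos s (\bigcup_(i < n) F i))).
    elim: n => [|n IH]; first by rewrite big_geq ?jpos_ge0.
    rewrite big_nat_recr//=; apply: le_trans (leeD IH (lexx _)) _.
    have -> : \bigcup_(i < n.+1) F i = \bigcup_(i < n) F i `|` F n.
      apply/seteqP; split => [x [i /= + Fx]|x [[i /= ltin Fx]|Fx]].
      - rewrite ltnS leq_eqVlt => /predU1P[<-|ltin]; first by right.
        by left; exists i.
      - by exists i => //=; rewrite ltnS ltnW.
      - by exists n => //=.
    apply: jpos_superadd; rewrite setI_bigcupl; apply: bigcup0 => i /= ltin.
    move/trivIsetP : tF => /(_ i n I I); apply.
    by rewrite neq_ltn ltin.
  by apply: jpos_le => x [i _ Fx]; exists i.
apply: ge_ereal_sup => _ [B [bB BF] <-].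
have bE i : bounded_borel (B `&` F i) by apply: bounded_borelI.
have EB : \bigcup_i (B `&` F i) = B.
  by rewrite -setI_bigcupr; apply/seteqP; split => [x []//|x Bx]; split => //; exact: BF.
have tBF : trivIset setT (fun i => B `&` F i).
  exact: (@trivIset_setIl _ _ setT F (fun=> B) tF).
have := sadd bE tBF; rewrite EB => /(_ bB) H.
have S0 : (0 <= \sum_(0 <= i <oo) jpos s (F i))%E by exact: nneseries_ge0.
have le_part n : ((series (fun i => s (B `&` F i)) n)%:E <=
    \sum_(0 <= i <oo) jpos s (F i))%E.
  apply: le_trans (nneseries_lim_ge n _) => //.
  rewrite /series/= -sumEFin; apply: lee_sum => i _.
  by apply: jpos_ge => //; exact: subIsetr.
case: (\sum_(0 <= i <oo) jpos s (F i))%E S0 le_part => [r||]//; last by move=> _ _; rewrite leey.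
move=> _ le_part; rewrite lee_fin -(cvg_lim (@Rhausdorff R) H).
apply: limr_le; first by apply/cvg_ex; exists (s B).
by apply: nearW => n; rewrite -lee_fin.
Qed.

Definition jordan_pos of sigma_add s : set (borel R p k) -> \bar R := jpos s.

HB.instance Definition _ := isMeasure.Build _ (borel R p k) R (jordan_pos sadd)
  jpos0 jpos_ge0 jpos_sigma_additive.

End jordan.

Import HBNNSimple.

(** The integral of a nonnegative function is a supremum of finite sums with
    nonnegative weights, so it is monotone in any nonnegative set function that
    vanishes at the empty set. This applies to the total variation without
    knowing that it is a measure. *)
Lemma le_integral_setfun (mu nu : set (borel R p k) -> \bar R) (f : N -> \bar R) :
  mu set0 = 0%E -> nu set0 = 0%E -> (forall A, 0 <= mu A)%E ->
  (forall A, mu A <= nu A)%E -> (forall x, 0 <= f x)%E ->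
  (@integral _ (borel R p k) R mu setT f <= @integral _ (borel R p k) R nu setT f)%E.
Proof.
move=> mu0 nu0 mu_ge0 munu f0.
have sE (la : set (borel R p k) -> \bar R) (g : {nnsfun (borel R p k) >-> R}) :
    la set0 = 0%E ->
    sintegral la g = (\sum_(x \in range g) x%:E * la (g @^-1` [set x]))%E.
  move=> la0; rewrite /sintegral (fsbig_widen (range g) setT)//= => x [_ Nfx] /=.
  by rewrite preimage10// la0 mule0.
have sle (g : {nnsfun (borel R p k) >-> R}) : (sintegral mu g <= sintegral nu g)%E.
  rewrite !sE//; apply: lee_fsum => // x [y _ <-].
  by apply: lee_wpmul2l => //; rewrite lee_fin.
have s0 (la : set (borel R p k) -> \bar R) (g : {nnsfun (borel R p k) >-> R}) :
    la set0 = 0%E -> (forall x, (g x)%:E <= 0)%E -> sintegral la g = 0%E.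
  move=> la0 g0; rewrite sE// fsbig1// => x [y _ <-].
  have -> : g y = 0.
    by apply/le_anti; rewrite fun_ge0 andbT -lee_fin.
  by rewrite mul0e.
rewrite /integral !patch_setT.
have -> : f^\+%E = f by apply/funext => x; rewrite (@ge0_funeposE _ _ setT)// inE.
have -> : f^\-%E = cst 0%E by apply/funext => x; rewrite (@ge0_funenegE _ _ setT)// inE.
have E0 (la : set (borel R p k) -> \bar R) : la set0 = 0%E ->
    ereal_sup [set sintegral la h | h in
     [set h : {nnsfun (borel R p k) >-> R} | forall x, ((h x)%:E <= 0)%E]] = 0%E.
  move=> la0; apply/le_anti/andP; split.
    by apply: ge_ereal_sup => _ [g gle <-]; rewrite s0.
  apply: ereal_sup_ubound; exists nnsfun0 => //; by rewrite s0.
rewrite !E0// !sube0; apply: ge_ereal_sup => _ [g gf <-].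
by apply: le_trans (sle g) _; apply: ereal_sup_ubound; exists g.
Qed.

Lemma tvar0 (mu : set N -> R[i]) : Normc.normc (mu set0) = 0 -> tvar mu set0 = 0%E.
Proof.
move=> m0; apply/le_anti/andP; split.
  apply: ge_ereal_sup => _ [l [E [bE E0 tE ->]]].
  rewrite big1// => i _; have := E0 i; rewrite subset0 => ->; exact: m0.
apply: ereal_sup_ubound; exists 0%N, (fun=> set0).
by split; [case|case|case|rewrite big_ord0].
Qed.

Lemma jpos_le_tvar (mu : set N -> R[i]) s A :
  (forall B, s B <= Normc.normc (mu B)) -> (jpos s A <= tvar mu A)%E.
Proof.
move=> smu; apply: ge_ereal_sup => _ [B [bB BA] <-].
apply: (@le_trans _ _ (Normc.normc (mu B))%:E); first by rewrite lee_fin.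
apply: ereal_sup_ubound; exists 1%N, (fun=> B).
by split; [by []|by []|move=> i j; rewrite !ord1|rewrite big_ord1].
Qed.

End variation.

(** * Bounded kernel integrals from bounded ball averages *)

Section measurability.
Context {R : realType} {p k : nat} (h : htype R p k).
Local Notation N := (carrier R p k).
Local Notation B := (borel R p k).

Lemma continuous_measurable_borel (f : N -> R) : continuous f ->
  measurable_fun setT (f : B -> R).
Proof.
move=> /continuousP cf; apply: (measurability _ (measurable_realfun.RGenOpens.measurableE R)).
move=> _ [_ [a [b ->] <-]]; rewrite setTI; apply: sub_sigma_algebra.
by apply: cf; exact: interval_open.
Qed.

Lemma continuous_hcoord i : continuous (fun y : N => y.1 0 i).
Proof.
move=> y; apply: (@continuous_comp _ _ _ (@fst _ _ : N -> _) (fun X : 'rV[R]_p.*2 => X 0 i)).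
  exact: cvg_fst.
exact: coord_continuous.
Qed.

Lemma continuous_vcoord j : continuous (fun y : N => y.2 0 j).
Proof.
move=> y; apply: (@continuous_comp _ _ _ (@snd _ _ : N -> _) (fun X : 'rV[R]_k => X 0 j)).
  exact: cvg_snd.
exact: coord_continuous.
Qed.

Lemma measurable_hcoord i : measurable_fun setT ((fun y : N => y.1 0 i) : B -> R).
Proof. by apply: continuous_measurable_borel; exact: continuous_hcoord. Qed.

Lemma measurable_vcoord j : measurable_fun setT ((fun y : N => y.2 0 j) : B -> R).
Proof. by apply: continuous_measurable_borel; exact: continuous_vcoord. Qed.

Lemma measurable_hsq n : measurable_fun setT ((fun y : N => hsq (nmul h (ninv y) n)) : B -> R).
Proof.
apply: measurable_sum => i; rewrite /= (_ : (fun _ => _) =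
  (fun y : N => (- y.1 0 i + n.1 0 i) * (- y.1 0 i + n.1 0 i))); last first.
  by apply/funext => y; rewrite !mxE.
apply: measurable_funM; apply: measurable_funD => //.
all: by apply: measurable_funN; exact: measurable_hcoord.
Qed.

Lemma measurable_vsq n : measurable_fun setT ((fun y : N => vsq (nmul h (ninv y) n)) : B -> R).
Proof.
have key j : measurable_fun setT
   ((fun y : N => (- y.2 0 j + n.2 0 j) + 2^-1 * \sum_i \sum_l (- y.1 0 i * n.1 0 l * bcoef h i l j)) : B -> R).
  apply: measurable_funD.
    by apply: measurable_funD => //; apply: measurable_funN; exact: measurable_vcoord.
  apply: measurable_funM => //; apply: measurable_sum => i; apply: measurable_sum => l.
  apply: measurable_funM => //; apply: measurable_funM => //; apply: measurable_funN.
  exact: measurable_hcoord.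
apply: measurable_sum => j; rewrite /= (_ : (fun _ => _) =
  (fun y : N => ((- y.2 0 j + n.2 0 j) + 2^-1 * \sum_i \sum_l (- y.1 0 i * n.1 0 l * bcoef h i l j)) *
   ((- y.2 0 j + n.2 0 j) + 2^-1 * \sum_i \sum_l (- y.1 0 i * n.1 0 l * bcoef h i l j)))); last first.
  apply/funext => y; rewrite !mxE.
  rewrite (_ : (h (- y.1, 0) (n.1, 0)).2 0 j =
     \sum_i \sum_l (- y.1 0 i * n.1 0 l * bcoef h i l j)) //.
  rewrite -[(h _ _).2]/(bil h (- y.1) n.1) bilE.
  by apply: eq_bigr => i _; apply: eq_bigr => l _; rewrite mxE.
by apply: measurable_funM; exact: key.
Qed.

Lemma measurable_gker c beta P :
  measurable_fun setT (gker h c beta P : B -> R).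
Proof.
rewrite (_ : gker h c beta P = fun y => c * (P.2 `^ (2 * beta) *
  dens P.2 (nmul h (ninv y) P.1) `^ (- (rho R p k + beta)))); last first.
  by apply/funext => y; rewrite gkerE.
apply: measurable_funM => //; apply: measurable_funM => //.
apply: (measurableT_comp (measurable_powR _)) => //.
apply: measurable_funD; last by apply: measurable_funM => //; exact: measurable_vsq.
by apply: measurable_funX; apply: measurable_funD => //; exact: measurable_hsq.
Qed.

Lemma measurable_nball n r : 0 < r -> measurable (nball h n r : set B).
Proof.
move=> r0; have mg : measurable_fun setT ((fun y : N => gsq (nmul h (ninv y) n)) : B -> R).
  apply: measurable_funD; first by apply: measurable_funX; exact: measurable_hsq.
  by apply: measurable_funM => //; exact: measurable_vsq.
rewrite (_ : nball h n r = setT `&` (fun y : N => gsq (nmul h (ninv y) n)) @^-1` `]-oo, (r ^+ 2)[).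
  exact: mg.
by rewrite setTI; apply/seteqP; split => y; rewrite /nball /= in_itv/= (ngauge_lt _ r0).
Qed.

End measurability.

Section growth.
Context {R : realType} {p k : nat} (h : htype R p k).
Local Notation N := (carrier R p k).
Local Notation B := (borel R p k).
Variables (c beta : R).
Hypothesis c0 : 0 < c.
Hypothesis beta0 : 0 < beta.
Local Notation s := (rho R p k + beta).
Local Notation gker := (gker h c beta).

(** Away from a ball of radius K r the kernel at height 2 r is almost 2^(2 beta) times
    the kernel at height r, since the density hardly changes there. *)
Lemma gker_doubling : exists2 K, 0 < K & forall (n0 : N) r y, 0 < r ->
  gker (n0, r) y <= (c * 16 `^ (- s) * r ^- (p + k)) * \1_(nball h n0 (K * r)) y
     + 2 `^ (- beta) * gker (n0, 2 * r) y.
Proof.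
have s0 : 0 < s := s_gt0 beta0.
(* e is the relative increase of the density that costs a factor 2^beta, out of
   the factor 2^(2 beta) gained in the numerator; 56 = 48 + 8 bounds the two terms
   by which the density at height 2 r exceeds the one at height r. *)
pose e : R := 2 `^ (beta / s) - 1.
have e0 : 0 < e.
  rewrite subr_gt0 -[ltLHS](powRr0 2) /powR gt_eqF// ltr_expR ltr_pM2r ?ln_gt0 ?ltr1n//.
  by rewrite divr_gt0.
have es : (1 + e) `^ s = 2 `^ beta.
  by rewrite /e subrKC -powRrM divfK// gt_eqF.
pose K := Num.max 1 (56 / e).
have K1 : 1 <= K by rewrite le_max lexx.
have Ke : 56 <= e * K by rewrite mulrC -ler_pdivrMr// le_max lexx orbT.
have K0 : 0 < K by rewrite (lt_le_trans _ K1).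
exists K => // n0 r y r0.
have r20 : 0 < 2 * r by rewrite mulr_gt0.
set z := nmul h (ninv y) n0.
have dr := dens_gt0 z r0; have d2r := dens_gt0 z r20.
have [dlt|dge] := ltP (ngauge z) (K * r).
  rewrite indicE mem_set ?mulr1//; apply: ler_wpDr.
    by rewrite mulr_ge0 ?powR_ge0// ltW// gker_gt0.
  rewrite gkerE /= -/z -mulrA ler_wpM2l ?(ltW c0)//.
  have H : 16 * r ^+ 2 <= dens r z.
    rewrite densE -addrA lerDl addr_ge0 ?gsq_ge0//.
    by rewrite mulr_ge0 ?hsq_ge0// mulr_ge0// ltW.
  have H2 : dens r z `^ (- s) <= (16 * r ^+ 2) `^ (- s).
    have r2 : 0 < 16 * r ^+ 2 by rewrite mulr_gt0 ?exprn_gt0.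
    rewrite !powRN lef_pV2 ?posrE ?powR_gt0//.
    by apply: ge0_ler_powR H; rewrite ?nnegrE ltW.
  apply: (le_trans (ler_wpM2l (powR_ge0 _ _) H2)).
  rewrite powRM ?sqr_ge0// mulrCA ler_wpM2l ?powR_ge0//.
  rewrite -(@powR_mulrn _ r 2) ?(ltW r0)// -powRrM -powRD; last by rewrite (gt_eqF r0) implybT.
  rewrite (_ : 2 * beta + 2 * - s = - (p + k)%:R).
    by rewrite powRN powR_mulrn// ltW.
  by rewrite mulrN two_s; ring.
apply: ler_wpDl.
  by rewrite !mulr_ge0 ?powR_ge0 ?(ltW c0)// ?invr_ge0 ?exprn_ge0 ?(ltW r0).
rewrite !gkerE /= -/z [leRHS]mulrCA ler_wpM2l ?(ltW c0)//.
have D2 : dens (2 * r) z <= (1 + e) * dens r z.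
  have h1 := hsq_le_gauge z; have h2 := ngauge_sqr z; have h3 := hsq_ge0 z.
  have h4 : 48 * r ^+ 2 + 8 * r * hsq z <= e * ngauge z ^+ 2.
    set d := ngauge z in dge h1 h2 *.
    have d0 : 0 < d by rewrite (lt_le_trans _ dge)// mulr_gt0.
    have rd : r <= d by rewrite (le_trans _ dge)// ler_peMl// ltW.
    apply: (@le_trans _ _ (56 * (r * d))).
      have : r * r <= r * d by rewrite ler_wpM2l// ltW.
      have : r * hsq z <= r * d by rewrite ler_wpM2l// ltW.
      by rewrite expr2; lra.
    apply: (@le_trans _ _ (e * K * (r * d))).
      by rewrite ler_wpM2r// mulr_ge0// ltW.
    rewrite -mulrA ler_wpM2l ?(ltW e0)// mulrA expr2 ler_wpM2r// ltW//.
  rewrite !densE; rewrite h2 in h4.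
  have : 0 <= e * (16 * r ^+ 2 + 8 * r * hsq z).
    by rewrite mulr_ge0 ?(ltW e0)// addr_ge0 ?mulr_ge0 ?sqr_ge0 ?(ltW r0).
  by rewrite exprMn; lra.
have D3 : dens (2 * r) z `^ s <= 2 `^ beta * dens r z `^ s.
  have e1 : 0 <= 1 + e by lra.
  rewrite -es -powRM ?(ltW dr)//.
  apply: ge0_ler_powR D2; [exact: ltW|rewrite nnegrE; exact: ltW|].
  by rewrite nnegrE; apply: mulr_ge0 => //; exact: ltW.
rewrite powRM ?(ltW r0)// !powRN.
rewrite (_ : 2 `^ (2 * beta) = 2 `^ beta * 2 `^ beta); last first.
  rewrite -powRD; last by apply/implyP => _; rewrite pnatr_eq0.
  by congr (_ `^ _); ring.
have t0 : 0 < (2 : R) `^ beta by rewrite powR_gt0.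
have u0 : 0 < dens r z `^ s by rewrite powR_gt0.
have v0 : 0 < dens (2 * r) z `^ s by rewrite powR_gt0.
move: (r `^ (2 * beta)) (powR_ge0 r (2 * beta)) => w w0.
move: ((2:R) `^ beta) (dens r z `^ s) (dens (2 * r) z `^ s) D3 t0 u0 v0 => t u v vt t0 u0 v0.
rewrite (_ : t^-1 * _ = w * (t / v)); last by field; rewrite !gt_eqF.
by rewrite ler_wpM2l// ler_pdivlMr// mulrC ler_pdivrMr.
Qed.

Variable nu : {measure set B -> \bar R}.
Hypothesis nuint : forall (n : N) a, 0 < a ->
  nu.-integrable setT (EFin \o (gker (n, a) : B -> R)).
Variables (n0 : N) (t0 M : R).
Hypothesis t00 : 0 < t0.
Hypothesis M0 : 0 <= M.
Hypothesis nuball : forall r, 0 < r < t0 -> (nu (nball h n0 r) <= (M * r ^+ (p + k))%:E)%E.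

Local Notation F r := (\int[nu]_(y in setT) (gker (n0, r) y))%R.

(** By gker_doubling the integral F satisfies F(r) <= A1 + th F(2 r) with th < 1, as soon
    as the ball of radius K r obeys the growth bound; iterating up to a fixed scale,
    where F is bounded by Harnack's inequality, bounds F for all small r. *)
Lemma bounded_kernel_integral : exists A r1, [/\ 0 <= A, 0 < r1 &
  forall r, 0 < r <= r1 -> F r <= A].
Proof.
have [K K0 HK] := gker_doubling.
pose A1 := c * 16 `^ (- s) * M * K ^+ (p + k).
pose th : R := 2 `^ (- beta).
have th0 : 0 <= th by exact: powR_ge0.
have th1 : th < 1.
  rewrite /th powRN invf_lt1 ?powR_gt0// -[ltLHS](powRr0 2).
  by rewrite /powR gt_eqF// ltr_expR ltr_pM2r ?ln_gt0 ?ltr1n.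
have A10 : 0 <= A1 by rewrite !mulr_ge0 ?powR_ge0 ?exprn_ge0 ?(ltW c0) ?(ltW K0).
have step r : 0 < r -> K * r < t0 -> F r <= A1 + th * F (2 * r).
  move=> r0 rt; have r20 : 0 < 2 * r by rewrite mulr_gt0.
  have Kr0 : 0 < K * r by rewrite mulr_gt0.
  have mB := measurable_nball h n0 Kr0.
  have nB := nuball _; have {nB} := nB (K * r); rewrite Kr0 rt => /(_ isT) nB.
  have iI : nu.-integrable setT (EFin \o (\1_(nball h n0 (K * r)) : B -> R)).
    apply/integrableP; split; first by apply/measurable_EFinP; exact: measurable_indic.
    under eq_integral do rewrite /= ger0_norm ?indic_ge0//.
    by rewrite integral_indic// setIT (le_lt_trans nB)// ltey.
  pose a := c * 16 `^ (- s) * r ^- (p + k).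
  have iaI : nu.-integrable setT (EFin \o (fun y : B => a * \1_(nball h n0 (K * r)) y)).
    exact: (@integrableZl _ _ _ nu setT measurableT a (EFin \o _) iI).
  have itG : nu.-integrable setT (EFin \o (fun y : B => th * gker (n0, 2 * r) y)).
    exact: (@integrableZl _ _ _ nu setT measurableT th (EFin \o _) (nuint n0 r20)).
  apply: (@le_trans _ _ (\int[nu]_(y in setT) (a * \1_(nball h n0 (K * r)) y + th * gker (n0, 2 * r) y))%R).
    apply: le_Rintegral => //; first exact: nuint.
      exact: (@integrableD _ _ _ nu setT measurableT (EFin \o _) (EFin \o _) iaI itG).
    by move=> y _; exact: HK.
  rewrite RintegralD// (RintegralZl _ _ iI)//.
  rewrite (RintegralZl _ _ (nuint n0 r20))//.
  rewrite lerD2r /Rintegral integral_indic// setIT.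
  have : fine (nu (nball h n0 (K * r))) <= M * (K * r) ^+ (p + k).
    rewrite -lee_fin fineK// ge0_fin_numE//.
    by rewrite (le_lt_trans nB)// ltey.
  have a0 : 0 <= a by rewrite !mulr_ge0 ?powR_ge0 ?(ltW c0)// invr_ge0 exprn_ge0 ?(ltW r0).
  move=> /(ler_wpM2l a0) H; apply: (le_trans H).
  rewrite exprMn /a /A1 le_eqVlt; apply/orP; left; apply/eqP.
  have : r ^+ (p + k) != 0 by rewrite gt_eqF// exprn_gt0.
  by move=> ?; field.
pose t1 := t0 / K / 2.
have t10 : 0 < t1 by rewrite !divr_gt0.
have [C [C0 Cn0 C1 Ct]] : exists C, [/\ 0 <= C, cbound C n0, 1 <= C & 2 * t1 <= C].
  exists (1 + 2 * t1 + \sum_i `|n0.1 0 i| + \sum_j `|n0.2 0 j|).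
  have h1 : 0 <= \sum_i `|n0.1 0 i| by apply: sumr_ge0.
  have h2 : 0 <= \sum_j `|n0.2 0 j| by apply: sumr_ge0.
  split; [lra| |lra|lra]; split => i.
    apply: (@le_trans _ _ (\sum_i `|n0.1 0 i|)); last by lra.
    by rewrite (bigD1 i)//= lerDl sumr_ge0.
  apply: (@le_trans _ _ (\sum_i `|n0.2 0 i|)); last by lra.
  by rewrite (bigD1 i)//= lerDl sumr_ge0.
have a00 : 0 < Num.min t1 1 by rewrite lt_min t10 ltr01.
have [K' K'0 HK'] := gker_compare h c0 beta0 C0 a00.
pose Mx := Num.max (A1 / (1 - th)) (K' * F 1).
have Mbase : forall q, t1 <= q <= 2 * t1 -> F q <= Mx.
  move=> q /andP[r1 r2]; have r0 : 0 < q by rewrite (lt_le_trans t10).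
  rewrite le_max; apply/orP; right; rewrite -RintegralZl//; last exact: nuint.
  apply: le_Rintegral => //; first exact: nuint.
    exact: (@integrableZl _ _ _ nu setT measurableT K' (EFin \o _) (nuint n0 (@ltr01 R))).
  move=> y _; apply: HK' => //=.
    by rewrite ge_min r1/= (le_trans r2).
  by rewrite ge_min lexx orbT.
have Mx0 : A1 <= (1 - th) * Mx.
  by rewrite mulrC -ler_pdivrMr ?subr_gt0// le_max lexx.
exists Mx, t1; split => //.
  by rewrite le_max divr_ge0// subr_ge0 ltW.
move=> r /andP[r0 rt1].
have [n Hn] : exists n : nat, t1 <= 2 ^+ n * r.
  exists (Num.bound (t1 / r)); rewrite -ler_pdivrMr//.
  apply: le_trans (ltW (archi_boundP _)) _; first by rewrite divr_ge0// ltW.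
  by rewrite -natrX ler_nat ltnW// ltn_expl.
have r2 : r <= 2 * t1 by lra.
move: Hn r0 r2; clear rt1; move: n r; elim=> [|n IH] r Hn r0 r2t.
  by apply: Mbase; rewrite r2t andbT -[r]mul1r -(expr0 2).
have [t1r|rt1] := leP t1 r; first by apply: Mbase; rewrite t1r.
have Krt : K * r < t0.
  by rewrite mulrC -ltr_pdivlMr// (lt_le_trans rt1)// /t1 ler_pdivrMr// ler_peMr ?ler1n// divr_ge0 ?ltW.
apply: (le_trans (step r r0 Krt)).
have : F (2 * r) <= Mx.
  by apply: IH; rewrite ?mulr_gt0//; [rewrite mulrA -exprSr|lra].
move=> /(ler_wpM2l th0); lra.
Qed.

End growth.

(** * Volume of balls *)

Section volume.
Context {R : realType} {p k : nat} (h : htype R p k).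
Local Notation N := (carrier R p k).
Local Notation B := (borel R p k).

Definition box (lo hi : N) : set N :=
  [set x : N | (forall i, lo.1 0 i <= x.1 0 i <= hi.1 0 i) /\
    (forall j, lo.2 0 j <= x.2 0 j <= hi.2 0 j)].

Lemma measurable_box lo hi : measurable (box lo hi : set B).
Proof.
rewrite (_ : box lo hi =
  (\bigcap_(i in setT) (setT `&` (fun y : N => y.1 0 i) @^-1` `[lo.1 0 i, hi.1 0 i])) `&`
  (\bigcap_(j in setT) (setT `&` (fun y : N => y.2 0 j) @^-1` `[lo.2 0 j, hi.2 0 j]))).
  apply: measurableI; apply: fin_bigcap_measurable => // i _.
    exact: measurable_hcoord.
  exact: measurable_vcoord.
apply/seteqP; split => x /=.
  by move=> [h1 h2]; split=> i _; rewrite setTI/= in_itv/=.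
by move=> [h1 h2]; split=> i; [have := h1 i I|have := h2 i I]; rewrite setTI/= in_itv.
Qed.

Lemma measure_bigsetU_le (m : {measure set B -> \bar R}) (I : Type) (s : seq I)
    (F : I -> set B) : (forall i, measurable (F i)) ->
  (m (\big[setU/set0]_(i <- s) F i) <= \sum_(i <- s) m (F i))%E.
Proof.
move=> mF; elim: s => [|i s IH]; first by rewrite !big_nil measure0.
rewrite !big_cons; apply: le_trans (leeD (lexx _) IH).
by apply: measureU2 => //; apply: bigsetU_measurable.
Qed.

Lemma cell_index (n : nat) (t : R) : 0 <= t <= n.+1%:R ->
  exists f : 'I_n.+1, f%:R <= t <= f%:R + 1.
Proof.
elim: n => [|n IH] /andP[t0 tn]; first by exists ord0; rewrite t0 add0r.
have [tn1|tn1] := leP t n.+1%:R.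
  have [|f Hf] := IH; first by rewrite t0.
  by exists (widen_ord (leqnSn _) f).
by exists ord_max => /=; rewrite (ltW tn1) natr1.
Qed.

Variables (m : {measure set B -> \bar R}) (hm : is_lebesgue m).

(** Only closed boxes have a known volume. The ball lies in a bent cylinder of horizontal
    size sqrt r and vertical size r: horizontally it is divided into cubes of side w
    at most 2 r, so fine that over each of them the bending, which is linear in the
    horizontal variable, stays of order r. *)
Lemma nball_volume (n0 : N) : exists2 C, 0 <= C & forall r, 0 < r ->
  (m (nball h n0 r) <= (C * r ^+ (p + k))%:E)%E.
Proof.
(* K0 bounds the slope of the bending. *)
pose K0 := \sum_i \sum_l \sum_j (`|n0.1 0 l| * `|bcoef h i l j|).
have K00 : 0 <= K0 by do 3!(apply: sumr_ge0 => ? _); rewrite mulr_ge0.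
pose D := 1 + K0.
have bilK (X : 'rV[R]_p.*2) d j : 0 <= d -> (forall i, `|X 0 i| <= d) ->
    `|bil h X n0.1 0 j| <= K0 * d.
  move=> d0 Xd; rewrite bilE (le_trans (ler_norm_sum _ _ _))// /K0 mulr_suml.
  apply: ler_sum => i _; rewrite (le_trans (ler_norm_sum _ _ _))// mulr_suml.
  apply: ler_sum => l _; rewrite mulr_suml (bigD1 j)//=.
  apply: (@le_trans _ _ (`|n0.1 0 l| * `|bcoef h i l j| * d)).
    by rewrite !normrM -mulrA mulrC ler_wpM2l ?mulr_ge0.
  by rewrite lerDl; apply: sumr_ge0 => ? _; rewrite !mulr_ge0.
exists (4 ^+ p * (2 * D) ^+ k); first by rewrite mulr_ge0// !exprn_ge0// mulr_ge0// addr_ge0.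
move=> r r0; pose q := Num.sqrt r.
have q0 : 0 < q by rewrite sqrtr_gt0.
have qr : q ^+ 2 = r by rewrite sqr_sqrtr// ltW.
have [n Hn] : exists n : nat, q^-1 <= n.+1%:R.
  exists (Num.bound q^-1); apply: ltW; apply: lt_le_trans (archi_boundP _) _ => //.
    by rewrite invr_ge0 ltW.
  by rewrite ler_nat.
have n0R : 0 < n.+1%:R :> R by rewrite ltr0n.
pose w := 2 * q / n.+1%:R.
have w0 : 0 < w by rewrite divr_gt0// mulr_gt0.
have w2r : w <= 2 * r.
  rewrite /w ler_pdivrMr// -mulrA ler_wpM2l// -qr expr2 -mulrA.
  by rewrite ler_peMr ?(ltW q0)// mulrC -ler_pdivrMr// div1r.
pose T := {ffun 'I_p.*2 -> 'I_n.+1}.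
pose lo1 (f : T) : 'rV[R]_p.*2 := \row_i (n0.1 0 i - q + w * (f i)%:R).
pose cc f : 'rV[R]_k := n0.2 - 2^-1 *: bil h (lo1 f) n0.1.
pose lo f : N := (lo1 f, cc f - const_mx (D * r)).
pose hi f : N := (lo1 f + const_mx w, cc f + const_mx (D * r)).
have cover : nball h n0 r `<=` \big[setU/set0]_(f : T) box (lo f) (hi f).
  move=> x; rewrite /nball/= ngauge_lt//; set z := nmul h (ninv x) n0 => zr.
  have hz : hsq z < r.
    rewrite -(@ltr_pXn2r _ 2) ?nnegrE ?hsq_ge0 ?(ltW r0)//.
    by apply: le_lt_trans zr; rewrite lerDl mulr_ge0// vsq_ge0.
  have vz j : `|z.2 0 j| <= r.
    rewrite -(@ler_pXn2r _ 2) ?nnegrE ?(ltW r0)// real_normK ?num_real//.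
    apply: le_trans (coef_sqr_le _ _) _; apply: le_trans (ltW zr).
    rewrite /gsq -[dotr _ _]/(vsq z); have := sqr_ge0 (hsq z); have := vsq_ge0 z; lra.
  have xz i : `|x.1 0 i - n0.1 0 i| <= q.
    rewrite -(@ler_pXn2r _ 2) ?nnegrE ?(ltW q0)// real_normK ?num_real// qr.
    apply: le_trans (ltW hz); have := coef_sqr_le z.1 i.
    by rewrite !mxE -sqrrN opprD opprK.
  have cell i : exists j : 'I_n.+1, j%:R <= (x.1 0 i - n0.1 0 i + q) / w <= j%:R + 1.
    apply: cell_index; have := xz i; rewrite ler_norml => /andP[h1 h2].
    rewrite divr_ge0 ?(ltW w0)//=; last by lra.
    rewrite ler_pdivrMr// mulrC /w divfK ?gt_eqF//; lra.
  have [f0 Hf0] := choice cell.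
  pose f : T := [ffun i => f0 i].
  have xf i : lo1 f 0 i <= x.1 0 i <= lo1 f 0 i + w.
    have := Hf0 i; rewrite ler_pdivlMr// ler_pdivrMr// => /andP[h1 h2].
    by rewrite !mxE ffunE; apply/andP; split; lra.
  rewrite -bigcup_seq; exists f; first by rewrite /= mem_index_enum.
  split => [i|j]; first by rewrite [(hi f).1 0 i]mxE [const_mx _ _ _]mxE; exact: xf.
  have : `|bil h (x.1 - lo1 f) n0.1 0 j| <= K0 * (2 * r).
    apply: bilK => [|i]; first by rewrite mulr_ge0// ltW.
    rewrite !mxE; have := xf i; rewrite mxE => /andP[h1 h2].
    by rewrite ger0_norm; lra.
  have := vz j; rewrite !mxE -[(h _ _).2]/(bil h (- x.1) n0.1) bilNl bilDl bilNl !mxE.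
  rewrite !ler_norml => /andP[h1 h2] /andP[h3 h4].
  rewrite /D; apply/andP; split; lra.
have mbox f : (m (box (lo f) (hi f)) = (w ^+ p.*2 * (2 * D * r) ^+ k)%:E)%E.
  rewrite hm => [|i|j]; last 2 first.
  - by rewrite [(hi f).1 0 i]mxE [const_mx _ _ _]mxE lerDl ltW.
  - have Dr : 0 <= D * r by rewrite mulr_ge0 ?(ltW r0)// addr_ge0.
    by rewrite !mxE lerD2l; lra.
  congr (_ * _)%:E.
    rewrite -[in RHS](card_ord p.*2) -prodr_const; apply: eq_bigr => i _.
    by rewrite [(hi f).1 0 i]mxE [const_mx _ _ _]mxE addrAC subrr add0r.
  rewrite -[in RHS](card_ord k) -prodr_const; apply: eq_bigr => j _.
  by rewrite !mxE; ring.
have mB f : measurable (box (lo f) (hi f) : set B) by exact: measurable_box.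
apply: (@le_trans _ _ (m (\big[setU/set0]_(f : T) box (lo f) (hi f)))).
  apply: le_measure; rewrite ?inE//; first exact: measurable_nball.
  by apply: bigsetU_measurable.
apply: (le_trans (measure_bigsetU_le _ _ mB)).
under eq_bigr do rewrite mbox.
rewrite sumEFin sumr_const card_ffun !card_ord lee_fin le_eqVlt; apply/orP; left; apply/eqP.
have wE : w ^+ p.*2 * (n.+1 ^ p.*2)%:R = 4 ^+ p * r ^+ p.
  rewrite natrX -exprMn /w divfK ?gt_eqF// -mul2n exprM [(2 * q) ^+ 2]exprMn qr.
  by rewrite exprMn; congr (_ ^+ _ * _); ring.
by rewrite -[LHS]mulr_natr mulrAC wE !exprMn exprD; ring.
Qed.

End volume.

(** * Limits in families of power series *)

Section vitali.
Context {R : realType}.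

(** Dividing the expansion by t^n shows that the n-th coefficient is the limit of a
    quantity known to converge, up to an error proportional to t; only one nonzero t
    in the given interval is needed for each accuracy. *)
Lemma power_coef_cvg (f : R -> R -> R) (b : nat -> R -> R) (B C r1 L : R) :
  1 <= B -> 0 <= C -> 0 < r1 ->
  (forall r t n, 0 < r <= r1 -> B * `|t| <= 1 ->
    `|f t r - \sum_(j < n) b j r * t ^+ j| <= C * (B * `|t|) ^+ n) ->
  (exists2 d, 0 < d & forall t, - d < t < 0 -> f t r @[r --> 0^'+] --> L) ->
  forall n, b n r @[r --> 0^'+] --> (if n is 0%N then L else 0).
Proof.
move=> B1 C0 r10 fb [d d0 fL]; pose l n : R := if n is 0%N then L else 0.
suff: forall n, b n r @[r --> 0^'+] --> l n by [].
elim/ltn_ind => n IH; apply/cvgrPdist_le => e e0.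
(* t is taken so small that it lies in the interval, in the domain of the
   expansion, and makes the remainder at most e / 2. *)
pose D := B + C * B ^+ n.+1 / e * 2 + d^-1.
have B0 : 0 < B by apply: lt_le_trans B1.
have CB0 : 0 <= C * B ^+ n.+1 / e * 2.
  by rewrite mulr_ge0// divr_ge0 ?(ltW e0)// mulr_ge0// exprn_ge0// ltW.
have d'0 : 0 < d^-1 by rewrite invr_gt0.
have D0 : 0 < D by rewrite /D; lra.
pose t := - (2 * D)^-1.
have DD0 : 0 < (2 * D)^-1 by rewrite invr_gt0 mulr_gt0.
have t0 : t != 0 by rewrite oppr_eq0 gt_eqF.
have nt : `|t| = (2 * D)^-1 by rewrite normrN gtr0_norm.
have td : - d < t < 0.
  rewrite /t ltrN2 oppr_lt0 DD0 andbT -[d]invrK ltf_pV2 ?posrE ?mulr_gt0//.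
  by rewrite /D; lra.
have Bt : B * `|t| <= 1.
  rewrite nt ler_pdivrMr ?mulr_gt0// mul1r /D; lra.
have remB : C * B ^+ n.+1 * `|t| <= e / 2.
  have xe : C * B ^+ n.+1 / e <= D by rewrite /D; lra.
  have : C * B ^+ n.+1 <= D * e by rewrite -ler_pdivrMr.
  rewrite nt ler_pdivrMr ?mulr_gt0//; lra.
have mainL : (f t r - \sum_(j < n) b j r * t ^+ j) / t ^+ n @[r --> 0^'+] --> l n.
  have -> : l n = (L - \sum_(j < n) l j * t ^+ j) / t ^+ n.
    case: (n) => [|m] /=; first by rewrite big_ord0 subr0 expr0 divr1.
    rewrite big_ord_recl/= mulr1 big1 ?addr0 ?subrr ?mul0r// => i _.
    by rewrite mul0r.
  apply: cvgMl; apply: cvgB; first exact: fL.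
  apply: cvg_big => [|j _]; first exact: add_continuous.
  by apply: cvgMl; apply: IH.
move/cvgrPdist_le : mainL => /(_ (e / 2)); rewrite divr_gt0// => /(_ isT) mainL.
near=> r.
have rr1 : 0 < r <= r1.
  by apply/andP; split; near: r; [exact: nbhs_right_gt|exact: nbhs_right_le].
have H := fb r t n.+1 rr1 Bt.
rewrite big_ord_recr/= in H.
set m := (f t r - \sum_(j < n) b j r * t ^+ j) / t ^+ n.
have tn0 : t ^+ n != 0 by rewrite expf_neq0.
have -> : l n - b n r = (l n - m) + (m - b n r) by ring.
rewrite (le_trans (ler_normD _ _))// (splitr e) lerD//.
  by rewrite /m; near: r; exact: mainL.
apply: le_trans remB.
have -> : m - b n r = (f t r - (\sum_(j < n) b j r * t ^+ j + b n r * t ^+ n)) / t ^+ n.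
  by rewrite /m; field.
rewrite normrM normfV ler_pdivrMr ?normr_gt0// (le_trans H)//.
by rewrite exprMn normrX [`|t| ^+ n.+1]exprS -!mulrA.
Unshelve. all: by end_near. Qed.

(** A quantitative form of Vitali's theorem. All coefficients but the first tend to
    0, hence so does the sum at every t inside half the radius. *)
Lemma power_family_cvg (f : R -> R -> R) (b : nat -> R -> R) (B C r1 L : R) :
  1 <= B -> 0 <= C -> 0 < r1 ->
  (forall r t n, 0 < r <= r1 -> B * `|t| <= 1 ->
    `|f t r - \sum_(j < n) b j r * t ^+ j| <= C * (B * `|t|) ^+ n) ->
  (exists2 d, 0 < d & forall t, - d < t < 0 -> f t r @[r --> 0^'+] --> L) ->
  forall t, B * `|t| <= 2^-1 -> f t r @[r --> 0^'+] --> L.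
Proof.
move=> B1 C0 r10 fb fL t Bt; have bL := power_coef_cvg B1 C0 r10 fb fL.
apply/cvgrPdist_le => e e0.
have B0 : 0 <= B by apply: le_trans B1.
have [n Hn] : exists n : nat, C * 2^-1 ^+ n.+1 <= e / 2.
  exists (Num.bound (C / e * 2)).
  have := archi_boundP (_ : 0 <= C / e * 2).
  rewrite mulr_ge0 ?divr_ge0 ?(ltW e0)// => /(_ isT).
  set m := Num.bound _ => Hm.
  have m2 : m%:R <= 2 ^+ m.+1 :> R.
    by rewrite -natrX ler_nat ltnW// (ltn_trans (ltnSn m))// ltn_expl.
  have : C / e * 2 <= 2 ^+ m.+1 by rewrite (le_trans (ltW Hm)).
  rewrite exprVn ler_pdivrMr ?exprn_gt0// mulrAC ler_pdivrMr//; lra.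
have SL : \sum_(j < n.+1) b j r * t ^+ j @[r --> 0^'+] --> L.
  rewrite [X in _ --> X](_ : L = \sum_(j < n.+1) (if nat_of_ord j is 0%N then L else 0) * t ^+ j).
    apply: cvg_big => [|j _]; first exact: add_continuous.
    by apply: cvgMl; apply: bL.
  rewrite big_ord_recl/= mulr1 big1 ?addr0// => i _; by rewrite mul0r.
move/cvgrPdist_le : SL => /(_ (e / 2)); rewrite divr_gt0// => /(_ isT) SL.
near=> r.
have rr1 : 0 < r <= r1.
  by apply/andP; split; near: r; [exact: nbhs_right_gt|exact: nbhs_right_le].
have Bt1 : B * `|t| <= 1 by apply: le_trans Bt _; rewrite invf_le1// ler1n.
have H := fb r t n.+1 rr1 Bt1.
set m := \sum_(j < n.+1) _ in H.
have -> : L - f t r = (L - m) - (f t r - m) by ring.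
rewrite (le_trans (ler_normB _ _))// (splitr e) lerD//.
  by rewrite /m; near: r; exact: SL.
apply: (le_trans H); apply: le_trans Hn; rewrite ler_wpM2l//.
by apply: lerXn2r => //; rewrite nnegrE// mulr_ge0.
Unshelve. all: by end_near. Qed.

End vitali.

(** * Blow-up at a boundary point *)

Section functional.
Context {R : realType} {p k : nat} (h : htype R p k).
Local Notation N := (carrier R p k).
Local Notation B := (borel R p k).
Variables (c beta : R).
Hypothesis c0 : 0 < c.
Hypothesis beta0 : 0 < beta.
Local Notation gker := (gker h c beta).
Variable n0 : N.

(** The change of variables that moves the boundary point n0 to the identity and the
    scale r to 1. *)
Definition blowup (r : R) (y : N) : N := dil r^-1 (nmul h (ninv n0) y).


Lemma ninv_blowup r y n : 0 < r ->
  dil r (nmul h (ninv (blowup r y)) n) = nmul h (ninv y) (nmul h n0 (dil r n)).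
Proof.
move=> r0; rewrite dilM ?(ltW r0)// /blowup -dil_ninv dilD ?invr_ge0 ?(ltW r0)//.
by rewrite mulfV ?gt_eqF// dil1 ninvM ninvK nmulA.
Qed.

Lemma gker_blowup r a n y : 0 < r -> 0 < a ->
  gker (nmul h n0 (dil r n), r * a) y = r ^- (p + k) * gker (n, a) (blowup r y).
Proof. by move=> r0 a0; rewrite /gker /= -ninv_blowup// qker_dil. Qed.

(** The reference kernel, to which the size of all test functions is compared. *)
Definition gker0 : N -> R := gker (0, 1).

Lemma gker0_blowup r y : 0 < r -> gker0 (blowup r y) = r ^+ (p + k) * gker (n0, r) y.
Proof.
move=> r0; have := gker_blowup 0 y r0 (@ltr01 R).
rewrite dil0 nmuln0 mulr1 => ->; rewrite mulrA mulfV ?mul1r//.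
by rewrite gt_eqF// exprn_gt0.
Qed.

(** The test functions on which the rescaled functionals act. *)
Definition dominated (g : N -> R) :=
  (exists C, forall y, `|g y| <= C * gker0 y) /\
  forall r, 0 < r -> measurable_fun setT (g \o blowup r : B -> R).

Lemma cbound_ex (n : N) : exists2 C, 1 <= C & cbound C n.
Proof.
exists (1 + \sum_i `|n.1 0 i| + \sum_j `|n.2 0 j|).
  by rewrite -addrA lerDl addr_ge0// sumr_ge0.
have h1 : 0 <= \sum_i `|n.1 0 i| by apply: sumr_ge0.
have h2 : 0 <= \sum_j `|n.2 0 j| by apply: sumr_ge0.
split => i.
  apply: (@le_trans _ _ (\sum_i `|n.1 0 i|)); last by lra.
  by rewrite (bigD1 i)//= lerDl sumr_ge0.
apply: (@le_trans _ _ (\sum_i `|n.2 0 i|)); last by lra.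
by rewrite (bigD1 i)//= lerDl sumr_ge0.
Qed.

Lemma cboundW C C' (n : N) : C <= C' -> cbound C n -> cbound C' n.
Proof. by move=> CC [h1 h2]; split=> i; apply: le_trans CC. Qed.

Lemma gker_le_gker0 P : 0 < P.2 -> exists2 C, 0 < C & forall y, gker P y <= C * gker0 y.
Proof.
move=> P0; have [C1 C11 Cn] := cbound_ex P.1.
pose C := Num.max C1 P.2; pose a := Num.min P.2 1.
have CC : C1 <= C by rewrite le_max lexx.
have C0 : 0 <= C by rewrite (le_trans _ CC)// (le_trans _ C11).
have a0 : 0 < a by rewrite lt_min P0 ltr01.
have [K K0 HK] := gker_compare h c0 beta0 C0 a0; exists K => // y; apply: HK.
- exact: cboundW Cn.
- by split=> i; rewrite mxE normr0.
- by rewrite ge_min lexx/= le_max lexx orbT.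
- by rewrite ge_min lexx orbT/= (le_trans C11).
Qed.

Lemma dominated_gker P : 0 < P.2 -> dominated (gker P).
Proof.
move=> P0; split.
  have [C C0 HC] := gker_le_gker0 P0; exists C => y.
  by rewrite gtr0_norm ?HC// gker_gt0.
move=> r r0; rewrite (_ : gker P \o blowup r = fun y =>
   r ^+ (p + k) * gker (nmul h n0 (dil r P.1), r * P.2) y).
  by apply: measurable_funM => //; exact: measurable_gker.
apply/funext => y /=; rewrite gker_blowup// mulrA mulfV ?mul1r; first by case: (P).
by rewrite gt_eqF// exprn_gt0.
Qed.

Lemma dominatedD f g : dominated f -> dominated g -> dominated (fun y => f y + g y).
Proof.
move=> [[C fC] mf] [[D gD] mg]; split.
  by exists (C + D) => y; rewrite (le_trans (ler_normD _ _))// mulrDl lerD.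
by move=> r r0; apply: measurable_funD; [exact: mf|exact: mg].
Qed.

Lemma dominatedZ a f : dominated f -> dominated (fun y => a * f y).
Proof.
move=> [[C fC] mf]; split.
  by exists (`|a| * C) => y; rewrite normrM -mulrA ler_wpM2l.
by move=> r r0; apply: measurable_funM => //; exact: mf.
Qed.

Lemma dominatedB f g : dominated f -> dominated g -> dominated (fun y => f y - g y).
Proof.
move=> df dg; have := dominatedD df (dominatedZ (-1) dg).
by under [X in dominated X]eq_fun do rewrite mulN1r.
Qed.

Lemma dominated0 : dominated (fun=> 0).
Proof.
split; first by exists 0 => y; rewrite normr0 mul0r.
by move=> r r0; exact: measurable_cst.
Qed.

Lemma dominated_sum I (s : seq I) (F : I -> N -> R) :
  (forall i, dominated (F i)) -> dominated (fun y => \sum_(i <- s) F i y).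
Proof.
move=> dF; elim: s => [|i s IH].
  by under eq_fun do rewrite big_nil; exact: dominated0.
by under eq_fun do rewrite big_cons; exact: dominatedD.
Qed.

Lemma dominated_lim (F : nat -> N -> R) f C :
  (forall n, dominated (F n)) -> (forall y, F n y @[n --> \oo] --> f y) ->
  (forall y, `|f y| <= C * gker0 y) -> dominated f.
Proof.
move=> dF Ff fC; split; first by exists C.
move=> r r0; apply: (@measurable_fun_cvg _ B _ setT (fun n => F n \o blowup r)).
  by move=> n; have [_] := dF n; apply.
by move=> y _; exact: Ff.
Qed.

Variables nu1 nu2 : {measure set B -> \bar R}.
Definition transform (x : N * R) : R :=
  (\int[nu1]_(y in setT) (gker x y) - \int[nu2]_(y in setT) (gker x y))%R.

(** The difference of measures, rescaled at n0: its value at a kernel is a value of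
    the transform (Lam_gker). Linear in the test function, and bounded uniformly in
    r (Lam_bound), it turns statements about the transform near n0 into statements
    about kernels. *)
Definition Lam (r : R) (g : N -> R) : R := r ^- (p + k) *
  (\int[nu1]_(y in setT) (g (blowup r y)) - \int[nu2]_(y in setT) (g (blowup r y)))%R.

Definition kernel_integrable (nu : {measure set B -> \bar R}) :=
  forall (n : N) a, 0 < a -> nu.-integrable setT (EFin \o (gker (n, a) : B -> R)).

Hypotheses (int1 : kernel_integrable nu1) (int2 : kernel_integrable nu2).

Lemma dominated_integrable nu g r : kernel_integrable nu -> 0 < r -> dominated g ->
  nu.-integrable setT (EFin \o (g \o blowup r : B -> R)).
Proof.
move=> inu r0 [[C gC] mg].
apply: (@le_integrable _ _ _ nu setT measurableT _
  (EFin \o (fun y : B => (C * r ^+ (p + k)) * gker (n0, r) y))).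
- by apply/measurable_EFinP; exact: mg.
- move=> y _ /=; rewrite lee_fin (le_trans (gC _))// gker0_blowup// mulrA.
  exact: ler_norm.
- exact: (@integrableZl _ _ _ nu setT measurableT (C * r ^+ (p + k)) (EFin \o _) (inu n0 r r0)).
Qed.

Lemma LamD r f g : 0 < r -> dominated f -> dominated g ->
  Lam r (fun y => f y + g y) = Lam r f + Lam r g.
Proof.
move=> r0 df dg; rewrite /Lam !RintegralD//; try exact: dominated_integrable.
by rewrite -mulrDr; congr (_ * _); ring.
Qed.

Lemma LamZ r a f : 0 < r -> dominated f -> Lam r (fun y => a * f y) = a * Lam r f.
Proof.
move=> r0 df; rewrite /Lam.
rewrite (RintegralZl _ measurableT (dominated_integrable int1 r0 df)).
rewrite (RintegralZl _ measurableT (dominated_integrable int2 r0 df)).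
by rewrite -mulrBr mulrCA.
Qed.

Lemma Lam0 r : Lam r (fun=> 0) = 0.
Proof.
have E nu : (\int[nu]_(y in setT) (0:R))%R = 0 by rewrite /Rintegral integral0.
by rewrite /Lam !E subrr mulr0.
Qed.

Lemma LamB r f g : 0 < r -> dominated f -> dominated g ->
  Lam r (fun y => f y - g y) = Lam r f - Lam r g.
Proof.
move=> r0 df dg.
rewrite -[X in _ + X]mulN1r -LamZ// -LamD//; last exact: dominatedZ.
by congr Lam; apply/funext => y; rewrite mulN1r.
Qed.

Lemma Lam_sum r I (s : seq I) (F : I -> N -> R) : 0 < r ->
  (forall i, dominated (F i)) ->
  Lam r (fun y => \sum_(i <- s) F i y) = \sum_(i <- s) Lam r (F i).
Proof.
move=> r0 dF; elim: s => [|i s IH].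
  by under eq_fun do rewrite big_nil; rewrite big_nil Lam0.
under eq_fun do rewrite big_cons.
by rewrite big_cons LamD ?IH//; exact: dominated_sum.
Qed.

Lemma Lam_gker r n a : 0 < r -> 0 < a ->
  Lam r (gker (n, a)) = transform (nmul h n0 (dil r n), r * a).
Proof.
move=> r0 a0; rewrite /Lam /transform mulrBr.
have da : dominated (gker (n, a)) by apply: dominated_gker.
rewrite -(RintegralZl _ measurableT (dominated_integrable int1 r0 da)).
rewrite -(RintegralZl _ measurableT (dominated_integrable int2 r0 da)).
by congr (_ - _); apply: eq_Rintegral => y _; rewrite gker_blowup.
Qed.

Variables (A r1 : R).
Hypotheses (A0 : 0 <= A) (r10 : 0 < r1).
Hypothesis FA1 : forall r, 0 < r <= r1 -> (\int[nu1]_(y in setT) (gker (n0, r) y))%R <= A.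
Hypothesis FA2 : forall r, 0 < r <= r1 -> (\int[nu2]_(y in setT) (gker (n0, r) y))%R <= A.

(** The bound on the kernel integrals at height r is exactly a bound of the rescaled
    functional at gker0. *)
Lemma Lam_bound r g C : 0 < r <= r1 -> 0 <= C -> dominated g ->
  (forall y, `|g y| <= C * gker0 y) -> `|Lam r g| <= 2 * A * C.
Proof.
move=> rr1 C0 dg gC; have /andP[r0 _] := rr1.
have key nu : kernel_integrable nu -> (\int[nu]_(y in setT) (gker (n0, r) y))%R <= A ->
    `|\int[nu]_(y in setT) (g (blowup r y))|%R <= r ^+ (p + k) * C * A.
  move=> inu nuA; have di := dominated_integrable inu r0 dg.
  rewrite (le_trans (le_normr_Rintegral measurableT di))//.
  apply: (@le_trans _ _ (\int[nu]_(y in setT) (r ^+ (p + k) * C * gker (n0, r) y))%R).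
    apply: le_Rintegral => //.
    - exact: (@integrable_abse _ _ _ nu setT _ di).
    - exact: (@integrableZl _ _ _ nu setT measurableT (r ^+ (p + k) * C) (EFin \o _) (inu n0 r r0)).
    - move=> y _; apply: (le_trans (gC _)).
      by rewrite (gker0_blowup _ r0) mulrCA mulrA; exact: lexx.
  rewrite RintegralZl//; last exact: inu.
  by rewrite ler_wpM2l// mulr_ge0// exprn_ge0// ltW.
have H1 := key nu1 int1 (FA1 rr1); have H2 := key nu2 int2 (FA2 rr1).
have rp : 0 < r ^+ (p + k) by rewrite exprn_gt0.
rewrite /Lam normrM gtr0_norm ?invr_gt0// mulrC ler_pdivrMr//.
rewrite (le_trans (ler_normB _ _))//; apply: (le_trans (lerD H1 H2)).
by rewrite le_eqVlt; apply/orP; left; apply/eqP; ring.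
Qed.

Local Notation tends g L := (Lam r g @[r --> 0^'+] --> L).

(** The expansion of the kernel along the curve becomes, after applying Lam r, an
    expansion of numbers whose coefficients depend on r, with error bounds uniform in
    r; power_family_cvg applies. *)
Lemma tends_curve (g : pcurve) (L : R) : 0 < (apol g)`_0 ->
  (exists2 d, 0 < d & forall t, - d < t < 0 -> tends (gker (cpair g t)) L) ->
  exists2 e, 0 < e & forall t, `|t| <= e -> tends (gker (cpair g t)) L.
Proof.
move=> a0 [d d0 gL].
have [C C0 gb] := curve_bounded g.
have [D [D1 HD]] := kernel_expansion h beta c0 C0 a0.
have [apos /choice[cf Hcf]] := HD g gb.
have D0 : 0 < D by apply: lt_le_trans D1.
pose G := gker (cpair g 0).
have G00 : 0 < (cpair g 0).2 by rewrite /= horner_coef0.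
have [K K0 GK] := gker_le_gker0 G00.
have Gpos y : 0 < G y by exact: gker_gt0.
have dt t : D * `|t| <= 1 -> dominated (gker (cpair g t)).
  by move=> Dt; apply: dominated_gker; exact: apos.
have dG : dominated G by exact: dominated_gker.
pose cG j (y : N) := cf y j * G y.
have expand t n y : D * `|t| <= 1 ->
    `|gker (cpair g t) y - \sum_(j < n) t ^+ j * cG j y| <= D * (D * `|t|) ^+ n * G y.
  move=> Dt; have [_ _ _ _ /(_ t Dt n)] := Hcf y.
  rewrite mulr_suml (_ : \sum_(j < n) _ = \sum_(j < n) t ^+ j * cG j y)//.
  by apply: eq_bigr => j _; rewrite /cG mulrA (mulrC (t ^+ j)).
have cGle j y : `|cG j y| <= D ^+ j * K * gker0 y.
  have [_ _ _ cB _] := Hcf y; rewrite normrM (gtr0_norm (Gpos y)).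
  rewrite -mulrA; apply: ler_pM; [exact: normr_ge0|exact: ltW|exact: cB|exact: GK].
(* Measurability of the coefficients: each one is a pointwise limit of difference
   quotients built from the kernel and the preceding coefficients. *)
have dcG n : dominated (cG n).
  elim/ltn_ind: n => n IH.
  pose tt (m : nat) : R := (D * m.+1%:R)^-1.
  have tt0 m : 0 < tt m by rewrite invr_gt0 mulr_gt0// ltr0n.
  have Dtt m : D * `|tt m| = m.+1%:R^-1.
    by rewrite gtr0_norm// /tt invfM mulrA mulfV ?mul1r// gt_eqF.
  have Dtt1 m : D * `|tt m| <= 1 by rewrite Dtt invf_le1 ?ltr0n// ler1n.
  pose F m y := (tt m) ^- n * (gker (cpair g (tt m)) y + -1 * \sum_(j < n) (tt m) ^+ j * cG j y).
  apply: (@dominated_lim F _ (D ^+ n * K)) => //.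
    move=> m; apply: dominatedZ; apply: dominatedD; first exact: dt.
    apply: dominatedZ; rewrite (_ : (fun y => \sum_(j < n) _) =
      (fun y => \sum_(j <- enum 'I_n) (tt m) ^+ j * (if (j < n)%N then cG j y else 0))).
      apply: dominated_sum => j; apply: dominatedZ.
      by rewrite ltn_ord; exact: IH.
    apply/funext => y; rewrite big_enum/=; apply: eq_bigr => j _.
    by rewrite ltn_ord.
  move=> y; apply/cvgrPdist_le => e e0.
  pose M := D * D ^+ n * G y.
  have M0 : 0 < M by apply: mulr_gt0 => //; rewrite mulr_gt0 ?exprn_gt0.
  exists (Num.bound (M / e)); first by [].
  move=> m /= Hm.
  have tn0 : tt m ^+ n != 0 by rewrite expf_neq0// (gt_eqF (tt0 m)).
  have := expand (tt m) n.+1 y (Dtt1 m); rewrite big_ord_recr/= => H.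
  have -> : cG n y - F m y = - ((gker (cpair g (tt m)) y -
      (\sum_(j < n) tt m ^+ j * cG j y + tt m ^+ n * cG n y)) / tt m ^+ n).
    by rewrite /F; field.
  rewrite normrN normrM normfV ler_pdivrMr ?normr_gt0// (le_trans H)//.
  rewrite normrX (gtr0_norm (tt0 m)) exprSr.
  have -> : D * ((D * tt m) ^+ n * (D * tt m)) * G y = M * (D * tt m) * tt m ^+ n.
    by rewrite /M exprMn; ring.
  rewrite ler_wpM2r ?exprn_ge0 ?(ltW (tt0 _))//.
  have := Dtt m; rewrite gtr0_norm// => ->.
  rewrite ler_pdivrMr ?ltr0n// mulrC -ler_pdivrMr// ltW//.
  apply: (lt_le_trans (archi_boundP _)); first by rewrite divr_ge0// ltW.
  by rewrite ler_nat (leq_trans Hm).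
exists (2 * D)^-1; first by rewrite invr_gt0 mulr_gt0.
move=> t te.
pose CC := 2 * A * (D * K).
have CC0 : 0 <= CC by rewrite !mulr_ge0 ?(ltW K0) ?(ltW D0).
apply: (@power_family_cvg _ (fun t r => Lam r (gker (cpair g t)))
    (fun j r => Lam r (cG j)) D CC r1 L D1 CC0 r10) => //.
- move=> r t' n rr1 Dt; have /andP[r0 _] := rr1.
  have -> : \sum_(j < n) Lam r (cG j) * t' ^+ j = Lam r (fun y => \sum_(j < n) t' ^+ j * cG j y).
    rewrite Lam_sum//; last by move=> j; exact: dominatedZ.
    by apply: eq_bigr => j _; rewrite LamZ// mulrC.
  have ds : dominated (fun y => \sum_(j < n) t' ^+ j * cG j y).
    by apply: dominated_sum => j; exact: dominatedZ.
  rewrite -(LamB r0 (dt _ Dt) ds).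
  have -> : CC * (D * `|t'|) ^+ n = 2 * A * (D * (D * `|t'|) ^+ n * K).
    by rewrite /CC; ring.
  apply: Lam_bound => //.
  + by rewrite !mulr_ge0 ?exprn_ge0 ?mulr_ge0 ?(ltW D0) ?(ltW K0).
  + exact: (dominatedB (dt _ Dt) ds).
  + move=> y; apply: (le_trans (expand t' n y Dt)).
    rewrite -(mulrA _ K); apply: ler_wpM2l; last exact: GK.
    by rewrite mulr_ge0 ?exprn_ge0 ?mulr_ge0 ?(ltW D0).
- by exists d.
- rewrite mulrC -ler_pdivlMr// (le_trans te)// invfM; lra.
Qed.

End functional.

(** * Upper limits of a blow-up family *)

Section family.
Context {R : realType} {p k : nat} (h : htype R p k).
Local Notation N := (carrier R p k).
Variables (c beta : R).
Local Notation gker := (gker h c beta).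
Local Notation gker0 := (gker0 h c beta).

(** What the later arguments retain of the rescaled transform T P r, where P is a
    point of the half space and r the scale: homogeneity, a bound of linear
    combinations by the corresponding combinations of kernels, and the propagation of
    limits along analytic curves. *)
Record blowup_family (T : N * R -> R -> R) (A r1 : R) : Prop := BlowupFamily {
  family_ge0 : 0 <= A;
  family_range : 0 < r1;
  family_dil : forall r s n a, 0 < r -> 0 < s -> 0 < a ->
    T (dil s n, s * a) r = T (n, a) (r * s);
  family_bound : forall (I : finType) (w : I -> R) (P : I -> N * R) C r,
    0 < r <= r1 -> 0 <= C -> (forall i, 0 < (P i).2) ->
    (forall y, `|\sum_i w i * gker (P i) y| <= C * gker0 y) ->
    `|\sum_i w i * T (P i) r| <= 2 * A * C;
  family_curve : forall (g : pcurve) (L : R), 0 < (apol g)`_0 ->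
    (exists2 d, 0 < d &
      forall t, - d < t < 0 -> T (cpair g t) r @[r --> 0^'+] --> L) ->
    exists2 e, 0 < e &
      forall t, `|t| <= e -> T (cpair g t) r @[r --> 0^'+] --> L }.

End family.

Section limsup.
Context {R : realType} {p k : nat} (h : htype R p k).
Local Notation N := (carrier R p k).
Variables (c beta : R).
Hypothesis c0 : 0 < c.
Hypothesis beta0 : 0 < beta.
Local Notation gker := (gker h c beta).
Local Notation gker0 := (gker0 h c beta).
Variables (T : N * R -> R -> R) (A r1 : R).
Hypothesis HT : blowup_family h c beta T A r1.

Variable L : R.
Local Notation tends P := (T P r @[r --> 0^'+] --> L).

Definition shift_curve (g : @pcurve R p k) (t0 : R) := {|
  hpol := fun i => hpol g i \Po ('X + t0%:P);
  vpol := fun j => vpol g j \Po ('X + t0%:P);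
  apol := apol g \Po ('X + t0%:P) |}.

Lemma cpair_shift g t0 t : cpair (shift_curve g t0) t = cpair g (t + t0).
Proof.
have E (q : {poly R}) : (q \Po ('X + t0%:P)).[t] = q.[t + t0].
  by rewrite horner_comp !hornerE.
rewrite /cpair /cpoint /= E; congr ((_, _), _); apply/rowP => i; rewrite !mxE; exact: E.
Qed.

(** A limit that holds just before a parameter also holds around it, by family_curve;
    hence the supremum of the parameters up to which it holds is at least 1. *)
Lemma tends_propagate (g : pcurve) : (forall t, 0 <= t <= 1 -> 0 < (apol g).[t]) ->
  (exists2 d, 0 < d & forall t, 0 < t < d -> tends (cpair g t)) -> tends (cpair g 1).
Proof.
move=> apos [d d0 gd].
pose S := [set t : R | 0 < t <= 1 /\ forall u, 0 < u < t -> tends (cpair g u)].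
have Sd : S (Num.min d 1).
  split; first by rewrite lt_min d0 ltr01 ge_min lexx orbT.
  by move=> u /andP[u0]; rewrite lt_min => /andP[ud _]; apply: gd; rewrite u0.
have hS : has_sup S.
  by split; [exists (Num.min d 1)|exists 1 => t [/andP[_ ->]]].
pose tau := sup S.
have tau0 : 0 < tau.
  apply: (@lt_le_trans _ _ (Num.min d 1)); first by rewrite lt_min d0 ltr01.
  by apply: ub_le_sup => //; case: hS.
have tau1 : tau <= 1 by apply: ge_sup => [|t [/andP[_ ->]]] //; exists (Num.min d 1).
have below u : 0 < u < tau -> tends (cpair g u).
  move=> /andP[u0 /(sup_gt (proj1 hS))[t St ut]].
  by have [_] := St; apply; rewrite u0.
have a0 : 0 < (apol (shift_curve g tau))`_0.
  by rewrite -horner_coef0 horner_comp !hornerE apos// (ltW tau0).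
have [|e e0 He] := family_curve HT a0 (L := L).
  exists tau => // t /andP[t1 t2]; rewrite cpair_shift.
  by apply: below; apply/andP; split; lra.
have near_tau u : `|u - tau| <= e -> tends (cpair g u).
  by move=> ue; rewrite -[u](subrK tau) -cpair_shift; exact: He.
have [e1|e1] := leP 1 (tau + e).
  by apply: near_tau; rewrite ger0_norm ?subr_ge0//; lra.
have : S (tau + e).
  split; first by apply/andP; split; lra.
  move=> u /andP[u0 ue]; have [ut|tu] := ltP u tau; first by apply: below; rewrite u0.
  by apply: near_tau; rewrite ger0_norm ?subr_ge0//; lra.
move/(ub_le_sup (proj2 hS)); rewrite -/tau; lra.
Qed.

Definition eventually_le (P : N * R) (e : R) := \forall r \near 0^'+, `|T P r - L| <= e.

(** The upper limit of `|T P r - L| as r tends to 0. *)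
Definition lsup (P : N * R) : R := inf [set e | 0 <= e /\ eventually_le P e].

Lemma lsup_set_neq0 P : 0 < P.2 -> exists e, 0 <= e /\ eventually_le P e.
Proof.
have A0 := family_ge0 HT; have r10 := family_range HT.
move=> P0; have [C C0 HC] := gker_le_gker0 h c0 beta0 P0.
exists (2 * A * C + `|L|); split.
  by rewrite addr_ge0// !mulr_ge0// ltW.
near=> r.
have rr1 : 0 < r <= r1.
  by apply/andP; split; near: r; [exact: nbhs_right_gt|exact: nbhs_right_le].
rewrite (le_trans (ler_normB _ _))// lerD2r.
have := @family_bound _ _ _ _ _ _ _ _ _ HT unit (fun=> 1) (fun=> P) C r rr1 (ltW C0) (fun=> P0).
rewrite (big_pred1 tt) ?mul1r; last by case.
apply => y; rewrite (big_pred1 tt) ?mul1r; last by case.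
by rewrite gtr0_norm ?HC// gker_gt0.
Unshelve. all: by end_near. Qed.

Lemma lsup_has_inf P : 0 < P.2 -> has_inf [set e | 0 <= e /\ eventually_le P e].
Proof. by move=> /lsup_set_neq0 H; split=> //; exists 0 => e []. Qed.

Lemma lsup_ge0 P : 0 < P.2 -> 0 <= lsup P.
Proof. by move=> P0; apply: lb_le_inf => [|e []//]; exact: lsup_set_neq0. Qed.

Lemma lsup_le P e : 0 <= e -> eventually_le P e -> lsup P <= e.
Proof. by move=> e0 Pe; apply: ge_inf => //; exists 0 => ? []. Qed.

Lemma lsup_near P e : 0 < P.2 -> lsup P < e -> eventually_le P e.
Proof.
move=> P0 Pe; have [e' [e'0 H] e'e] := inf_lt (proj1 (lsup_has_inf P0)) Pe.
by apply: filterS H => r /le_trans; apply; exact: ltW.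
Qed.

Lemma tendsP P : 0 < P.2 -> tends P <-> lsup P = 0.
Proof.
move=> P0; split=> [/cvgrPdist_le PL|P00].
  apply/le_anti; rewrite lsup_ge0// andbT; apply/ler_addgt0Pr => e e0.
  rewrite add0r; apply: lsup_le; first exact: ltW.
  by have := PL _ e0; apply: filterS => r; rewrite distrC.
apply/cvgrPdist_le => e e0.
have : eventually_le P e by apply: lsup_near => //; rewrite P00.
by apply: filterS => r; rewrite distrC.
Qed.

Lemma lsup_dil s n a : 0 < s -> 0 < a -> lsup (dil s n, s * a) = lsup (n, a).
Proof.
move=> s0 a0.
have key (u : R) : 0 < u -> forall m b e, 0 < b -> eventually_le (m, b) e ->
    eventually_le (dil u m, u * b) e.
  move=> u0 m b e b0 [d /= d0 Hd]; exists (d / u) => /=; first by rewrite divr_gt0.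
  move=> r /= rd r0; rewrite (family_dil HT)//; apply: Hd => /=; last by rewrite mulr_gt0.
  move: rd; rewrite !sub0r !normrN normrM (gtr0_norm u0) ltr_pdivlMr//.
congr inf; apply/seteqP; split => e [e0 H]; split => //; last exact: key.
have := key s^-1 _ _ _ _ _ H; rewrite dilD ?invr_ge0 ?(ltW s0)// mulVf ?gt_eqF// dil1.
by rewrite mulKf ?gt_eqF//; apply; rewrite ?invr_gt0// mulr_gt0.
Qed.

(** The upper limit at P0 is bounded by a weighted mean of its values at the P i, up to
    the error by which the kernel fails to satisfy the same mean value identity. *)
Lemma lsup_comb (I : finType) (w : I -> R) (P : I -> N * R) P0 C :
  (forall i, 0 <= w i) -> (forall i, 0 < (P i).2) -> 0 < P0.2 -> 0 <= C ->
  (forall y, `|\sum_i w i * gker (P i) y - (\sum_i w i) * gker P0 y| <= C * gker0 y) ->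
  (\sum_i w i) * lsup P0 <= \sum_i w i * lsup (P i) + 2 * A * C.
Proof.
have A0 := family_ge0 HT; have r10 := family_range HT.
move=> w0 Pi0 P00 C0 H; set W := \sum_i w i.
have W0 : 0 <= W by apply: sumr_ge0.
have rhs0 : 0 <= \sum_i w i * lsup (P i) + 2 * A * C.
  by rewrite addr_ge0 ?mulr_ge0// sumr_ge0// => i _; rewrite mulr_ge0// lsup_ge0.
have [W00|W00] := eqVneq W 0; first by rewrite W00 mul0r.
have Wp : 0 < W by rewrite lt0r W00.
apply/ler_addgt0Pr => e e0; rewrite mulrC -ler_pdivlMr//.
apply: lsup_le; first by rewrite divr_ge0// addr_ge0// ltW.
have nearP i : eventually_le (P i) (lsup (P i) + e / W).
  by apply: lsup_near => //; rewrite ltrDl divr_gt0.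
have nearall : \forall r \near 0^'+, forall i, `|T (P i) r - L| <= lsup (P i) + e / W.
  exact: filter_forall.
near=> r.
have rr1 : 0 < r <= r1.
  by apply/andP; split; near: r; [exact: nbhs_right_gt|exact: nbhs_right_le].
have Hr : forall i, `|T (P i) r - L| <= lsup (P i) + e / W by near: r; exact: nearall.
rewrite ler_pdivlMr// mulrC -{1}(gtr0_norm Wp) -normrM.
(* P0 enters the family with the weight opposite to the total weight. *)
pose w' (o : option I) := if o is Some i then w i else - W.
pose P' (o : option I) := if o is Some i then P i else P0.
have sumE (F : option I -> R) : \sum_o F o = F None + \sum_i F (Some i).
  rewrite (bigD1 None)//=; congr (_ + _).
  rewrite (reindex_omap Some id)/=; last by case.
  by apply: eq_bigl => i; rewrite eqxx.
have B2 : `|\sum_i w i * T (P i) r - W * T P0 r| <= 2 * A * C.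
  have := @family_bound _ _ _ _ _ _ _ _ _ HT _ w' P' C r rr1 C0; rewrite sumE/= mulNr addrC; apply; first by case.
  by move=> y; rewrite sumE/= mulNr addrC.
have -> : W * (T P0 r - L) = \sum_i w i * (T (P i) r - L) - (\sum_i w i * T (P i) r - W * T P0 r).
  under eq_bigr do rewrite mulrBr; rewrite sumrB -mulr_suml -/W; ring.
rewrite (le_trans (ler_normB _ _))// addrAC lerD//.
rewrite (le_trans (ler_norm_sum _ _ _))//.
have -> : e = \sum_i w i * (e / W) by rewrite -mulr_suml -/W mulrC divfK.
rewrite -big_split/=; apply: ler_sum => i _.
by rewrite normrM (ger0_norm (w0 i)) -mulrDr ler_wpM2l.
Unshelve. all: by end_near. Qed.

Lemma lsup_close P P' C : 0 < P.2 -> 0 < P'.2 -> 0 <= C ->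
  (forall y, `|gker P' y - gker P y| <= C * gker0 y) -> lsup P <= lsup P' + 2 * A * C.
Proof.
move=> P0 P'0 C0 H.
have sumE (F : unit -> R) : \sum_i F i = F tt by rewrite (big_pred1 tt)//; case.
have E1 : \sum_(i : unit) (1 : R) = 1 := sumE (fun=> 1).
have E2 (x : R) : \sum_(i : unit) 1 * x = x by rewrite (sumE (fun=> 1 * x)) mul1r.
have H' y : `|\sum_(i : unit) 1 * gker P' y - (\sum_(i : unit) 1) * gker P y| <= C * gker0 y.
  by rewrite E2 E1 (mul1r (gker P y)); exact: H.
have := @lsup_comb unit (fun=> 1) (fun=> P') P C (fun=> ler01) (fun=> P'0) P0 C0 H'.
by rewrite E2 E1 (mul1r (lsup P)).
Qed.

(** Kernels at nearby points differ by a small multiple of the reference kernel. *)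
Lemma lsup_lip (C : R) : 1 <= C -> exists K d, [/\ 0 < K, 0 < d &
  forall n n' : N, cbound C n -> forall e, 0 < e <= d -> cbound e (n' - n) ->
    `|lsup (n', 1) - lsup (n, 1)| <= K * e].
Proof.
have A0 := family_ge0 HT; have r10 := family_range HT.
move=> C1; have C0 : 0 <= C by apply: le_trans C1.
have [B [B1 HB]] := @gker_lip R p k h c beta c0 C 1 C0 ltr01.
have [K K0 HK] := @gker_compare R p k h c beta c0 beta0 C 1 C0 ltr01.
have B0 : 0 < B by apply: lt_le_trans B1.
exists (2 * A * B * K + 1), B^-1; split.
- by rewrite ltr_wpDl// !mulr_ge0 ?(ltW B0) ?(ltW K0).
- by rewrite invr_gt0.
move=> n n' nC e /andP[e0 ed] nn'.
have Be : B * e <= 1 by rewrite mulrC -ler_pdivlMr// div1r.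
have dle y : `|gker (n', 1) y - gker (n, 1) y| <= (B * e * K) * gker0 y.
  apply: (le_trans (HB (n, 1) (n', 1) nC _ e e0 Be nn' _ y)) => /=.
  - by rewrite lexx.
  - by rewrite subrr normr0 ltW.
  rewrite -[leRHS]mulrA; apply: ler_wpM2l; first by rewrite mulr_ge0 ?(ltW B0) ?(ltW e0).
  by apply: HK => //=; rewrite ?lexx//; split=> i; rewrite mxE normr0.
have C'0 : 0 <= B * e * K by rewrite !mulr_ge0 ?(ltW B0) ?(ltW e0) ?(ltW K0).
have h1 := @lsup_close (n, 1) (n', 1) _ ltr01 ltr01 C'0 dle.
have h2 := @lsup_close (n', 1) (n, 1) _ ltr01 ltr01 C'0.
have {}h2 : lsup (n', 1) <= lsup (n, 1) + 2 * A * (B * e * K).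
  by apply: h2 => y; rewrite distrC.
have E : (2 * A * B * K + 1) * e = 2 * A * (B * e * K) + e by ring.
rewrite E ler_norml; apply/andP; split; lra.
Qed.

End limsup.

(** * The second-order equation of the kernel *)

Section htype_identities.
Context {R : realType} {p k : nat} (h : htype R p k).
Local Notation J := (jmap h).
Local Notation e_ i := (delta_mx 0 i).
Implicit Types (X Y : 'rV[R]_p.*2) (Z : 'rV[R]_k).

Lemma jmap_bil Z X Y : dotr (J Z X) Y = dotr Z (bil h X Y).
Proof. by rewrite jmapP. Qed.

(** The defining identity of type H says that J Z is a similarity of ratio the norm
    of Z. *)
Lemma jmap_norm Z X : dotr (J Z X) (J Z X) = dotr Z Z * dotr X X.
Proof.
rewrite jmap_bil bil_anti dotrNr -jmap_bil jmap_sqr scaleNr dotrNl dotrZl.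
by rewrite opprK enorm_sqr.
Qed.

Lemma jmap_coord Z X i : dotr Z (bil h X (e_ i)) = J Z X 0 i.
Proof. by rewrite -jmap_bil dotr_delta. Qed.

Lemma dotr_bil_self Z X : \sum_i X 0 i * dotr Z (bil h X (e_ i)) = 0.
Proof.
under eq_bigr do rewrite jmap_coord.
by rewrite -/(dotr X (J Z X)) dotrC jmap_bil bil_alt dotr0r.
Qed.

Lemma sum_dotr_bil_sqr Z X :
  \sum_i dotr Z (bil h X (e_ i)) ^+ 2 = dotr Z Z * dotr X X.
Proof.
rewrite -jmap_norm; apply: eq_bigr => i _; by rewrite jmap_coord expr2.
Qed.

Lemma sum_bil_sqr X :
  \sum_i dotr (bil h X (e_ i)) (bil h X (e_ i)) = k%:R * dotr X X.
Proof.
rewrite exchange_big/= -[k in RHS]card_ord -sum1_card natr_sum mulr_suml.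
apply: eq_bigr => j _; have -> : 1%:R * dotr X X = dotr (e_ j) (e_ j) * dotr X X.
  by congr (_ * _); rewrite dotr_delta mxE !eqxx.
rewrite -sum_dotr_bil_sqr; apply: eq_bigr => i _.
by rewrite [in RHS]dotrC dotr_delta expr2.
Qed.

End htype_identities.

Section pde.
Context {R : realType} {p k : nat} (h : htype R p k).
Local Notation N := (carrier R p k).
Variables (c beta : R).
Hypothesis c0 : 0 < c.
Hypothesis beta0 : 0 < beta.
Local Notation s := (rho R p k + beta).
Local Notation gker := (gker h c beta).
Local Notation gker0 := (gker0 h c beta).

Lemma dotr_line (n : nat) (x v : 'rV[R]_n) t :
  dotr (x + t *: v) (x + t *: v) = dotr x x + 2 * t * dotr x v + t ^+ 2 * dotr v v.
Proof. rewrite !dotrDl !dotrDr !dotrZl !dotrZr (dotrC v x); ring. Qed.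

Lemma dotr_delta_delta (n : nat) (i : 'I_n) : dotr (delta_mx 0 i) (delta_mx 0 i) = 1 :> R.
Proof. by rewrite dotr_delta mxE !eqxx. Qed.

Lemma horner_ext (q r : {poly R}) : (forall t, q.[t] = r.[t]) -> q = r.
Proof.
move=> qr; apply/eqP; rewrite -subr_eq0; apply: contraT => d0.
have := max_poly_roots d0 (_ : all (root (q - r)) [seq i%:R | i <- iota 0 (size (q - r))]).
rewrite size_map size_iota ltnn => -> //.
  by apply/allP => x _; rewrite rootE !hornerE qr subrr.
by rewrite map_inj_uniq ?iota_uniq// => i j /eqP; rewrite eqr_nat => /eqP.
Qed.

(** Directions of second differences: horizontal, vertical, and in the height. *)
Definition dir : finType := ('I_p.*2 + 'I_k + unit)%type.

(** Translates by nb of the coordinate axes: along them the density seen from y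
    depends on y and nb only through the product of the inverse of y with nb. *)
Definition dir_curve (nb : N) (o : dir) : pcurve :=
  match o with
  | inl (inl i) => lin_curve (nb, 1) (delta_mx 0 i, 2^-1 *: bil h nb.1 (delta_mx 0 i)) 0
  | inl (inr j) => lin_curve (nb, 1) (0, delta_mx 0 j) 0
  | inr _ => lin_curve (nb, 1) 0 1
  end.

(** The kernel is annihilated by an operator with a first order term in the height;
    it is accounted for by a change of the weights in the second differences. *)
Definition drift (o : dir) : R := if o is inr _ then (1 - 2 * beta) / 2 else 0.

(** Coefficients of order one and two of the density along a direction. *)
Definition dcoef (z : N) (o : dir) : R * R :=
  let B := 4 + hsq z in
  match o with
  | inl (inl i) => let b := bil h z.1 (delta_mx 0 i) in
     (4 * B * z.1 0 i + 16 * dotr z.2 b, 2 * B + 4 * z.1 0 i ^+ 2 + 4 * dotr b b)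
  | inl (inr j) => (32 * z.2 0 j, 16)
  | inr _ => (8 * B, 16)
  end.

Lemma dpol_dir nb o y (z := nmul h (ninv y) nb) : let g := dir_curve nb o in
  [/\ (dpol h g y)`_0 = dens 1 z, (dpol h g y)`_1 = (dcoef z o).1 &
      (dpol h g y)`_2 = (dcoef z o).2].
Proof.
move=> g; pose B := 4 + hsq z.
pose c34 : seq R := if o is inl (inl i) then [:: 4 * z.1 0 i; 1] else [::].
suff -> : dpol h g y = Poly ([:: dens 1 z; (dcoef z o).1; (dcoef z o).2] ++ c34).
  by rewrite !coef_Poly.
apply: horner_ext => t; rewrite dpolE horner_Poly /=.
have E P V b : (dens (apol (lin_curve P V b)).[t]
    (nmul h (ninv y) (cpoint (lin_curve P V b) t))) =
    dens (P.2 + t * b) (nmul h (ninv y) (P.1 + t *: V)).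
  by rewrite -[cpoint _ t]/((cpair _ t).1) cpair_lin /= horner_lin.
rewrite /g /c34; case: o {g c34} => [[i|j]|u]; rewrite E /=.
- set b := bil h z.1 (delta_mx 0 i).
  have -> : nmul h (ninv y) (nb + t *: (delta_mx 0 i, 2^-1 *: bil h nb.1 (delta_mx 0 i))) =
      (z.1 + t *: delta_mx 0 i, z.2 + (t / 2) *: b) :> N.
    rewrite /z !nmulE/= /b; congr (_, _); first by rewrite addrA.
    rewrite !bilDr !bilDl bilZr; apply/rowP => l; rewrite !mxE; ring.
  rewrite /dens /hsq /vsq /= !dotr_line dotr_delta_delta dotr_delta -/b; by field.
- have -> : nmul h (ninv y) (nb + t *: (0, delta_mx 0 j)) =
      (z.1, z.2 + t *: delta_mx 0 j) :> N.
    rewrite /z !nmulE/=; congr (_, _); first by rewrite scaler0 addr0.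
    by rewrite scaler0 addr0; apply/rowP => l; rewrite !mxE; ring.
  rewrite /dens /hsq /vsq /= !dotr_line dotr_delta_delta dotr_delta; ring.
- by rewrite scaler0 addr0 -/z /dens; ring.
Qed.

Definition ecoef (z : N) (o : dir) : R * R :=
  ((dcoef z o).1 / dens 1 z, (dcoef z o).2 / dens 1 z).

(** Coefficients of the kernel itself along a direction, divided by its value. *)
Definition taylor1 (z : N) (o : dir) : R :=
  2 * beta * (if o is inr _ then 1 else 0) - s * (ecoef z o).1.

Definition taylor2 (z : N) (o : dir) : R :=
  (if o is inr _ then beta * (2 * beta - 1) - 2 * beta * s * (ecoef z o).1 else 0)
  - s * (ecoef z o).2 + s * (s + 1) / 2 * (ecoef z o).1 ^+ 2.

(** The differential equation of the kernel at height 1, divided by the kernel: the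
    sum over all directions of the second order coefficients, plus the drift, vanishes. The
    identities of groups of type H evaluate the sums over horizontal and vertical
    directions, and what remains is an identity between rational functions of the
    squares of the norms of the two components of z. *)
Lemma kernel_equation z : \sum_o (taylor2 z o + drift o * taylor1 z o) = 0.
Proof.
have D0 : 0 < dens 1 z by apply: dens_gt0.
have Dn0 : dens 1 z != 0 by rewrite gt_eqF.
rewrite big_sumType/= big_sumType/= (big_pred1 tt); last by case.
set D := dens 1 z in Dn0 *; pose B := 4 + hsq z; pose u := hsq z; pose v := vsq z.
have DE : D = B ^+ 2 + 16 * v by rewrite /D /dens mulr1.
have pp : p.*2%:R = 2 * p%:R :> R by rewrite -mul2n natrM.
have hor : \sum_(i < p.*2) (taylor2 z (inl (inl i)) + drift (inl (inl i)) * taylor1 z (inl (inl i))) =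
    - s * ((2 * B * (2 * p%:R) + 4 * u + 4 * (k%:R * u)) / D) + s * (s + 1) / 2 * (16 * u / D).
  have S2 : \sum_(i < p.*2) (dcoef z (inl (inl i))).2 = 2 * B * (2 * p%:R) + 4 * u + 4 * (k%:R * u).
    rewrite /= !big_split/= -!mulr_sumr sum_bil_sqr -/(hsq z) -/u.
    rewrite sumr_const card_ord -[_ *+ p.*2]mulr_natr pp -/B.
    rewrite (_ : \sum_(i < p.*2) z.1 0 i ^+ 2 = u); last first.
      by apply: eq_bigr => i _; rewrite expr2.
    by ring.
  have S1 : \sum_(i < p.*2) (dcoef z (inl (inl i))).1 ^+ 2 = 16 * u * D.
    rewrite /= (eq_bigr (fun i => 16 * B ^+ 2 * (z.1 0 i * z.1 0 i) +
       128 * B * (z.1 0 i * dotr z.2 (bil h z.1 (delta_mx 0 i))) +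
       256 * (dotr z.2 (bil h z.1 (delta_mx 0 i))) ^+ 2)); last first.
      by move=> i _; rewrite -/B; ring.
    rewrite !big_split/= -!mulr_sumr dotr_bil_self sum_dotr_bil_sqr.
    rewrite -[\sum_i _]/(hsq z) -/u -[dotr z.2 z.2]/v -[dotr z.1 z.1]/u DE; ring.
  rewrite (eq_bigr (fun i => (- s / D) * (dcoef z (inl (inl i))).2 +
     (s * (s + 1) / 2 / D ^+ 2) * (dcoef z (inl (inl i))).1 ^+ 2)); last first.
    by move=> i _; rewrite /taylor2 /taylor1 /ecoef -/D; case: (dcoef _ _) => d1 d2 /=; field.
  by rewrite big_split/= -!mulr_sumr S2 S1; field.
have ver : \sum_(j < k) (taylor2 z (inl (inr j)) + drift (inl (inr j)) * taylor1 z (inl (inr j))) =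
    - s * (16 * k%:R / D) + s * (s + 1) / 2 * (1024 * v / D ^+ 2).
  rewrite (eq_bigr (fun j => (- s * 16 / D) +
     (s * (s + 1) / 2 / D ^+ 2 * 1024) * (z.2 0 j * z.2 0 j))); last first.
    by move=> i _; rewrite /taylor2 /taylor1 /ecoef /drift /= -/D; field.
  rewrite big_split/= sumr_const card_ord -[_ *+ k]mulr_natr.
  rewrite -[\sum_(i < k) _ * (_ * _)]mulr_sumr -[\sum_i z.2 0 i * z.2 0 i]/v; by field.
rewrite hor ver /taylor2 /taylor1 /ecoef /drift /= -/D -/B.
have sE : s = (p%:R + k%:R) / 2 + beta by rewrite /rho natrD.
have uE : u = B - 4 by rewrite /B /u addrC addKr.
(* With B and v as variables the identity holds for all values of p, k and beta. *)
rewrite uE sE; move: Dn0; rewrite DE => Dn0.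
by field.
Qed.

(** The weighted symmetric differences cancel to second order by kernel_equation and
    the odd terms cancel by symmetry; the third order remainder is uniform in y. *)
Lemma kernel_second_difference (nb : N) : exists K t0, [/\ 0 <= K, 0 < t0 &
  forall t, 0 < t <= t0 ->
  [/\ (forall o (b : bool), 0 < (cpair (dir_curve nb o) ((-1) ^+ b * t)).2),
      (forall o (b : bool), 0 <= 1 + drift o * ((-1) ^+ b * t)) &
   forall y,
  `| \sum_(x : dir * bool) (1 + drift x.1 * ((-1) ^+ x.2 * t)) *
        gker (cpair (dir_curve nb x.1) ((-1) ^+ x.2 * t)) y
     - (\sum_(x : dir * bool) (1 + drift x.1 * ((-1) ^+ x.2 * t))) * gker (nb, 1) y|
  <= K * t ^+ 3 * gker0 y] ].
Proof.
have expo o : exists B : R, [/\ 1 <= B,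
    (forall t, B * `|t| <= 1 -> 0 < (cpair (dir_curve nb o) t).2) &
    forall y t (z := nmul h (ninv y) nb), B * `|t| <= 1 ->
    `|gker (cpair (dir_curve nb o) t) y -
       (1 + taylor1 z o * t + taylor2 z o * t ^+ 2) * gker (nb, 1) y|
     <= B * (B * `|t|) ^+ 3 * gker (nb, 1) y].
  have [C C0 gb] := curve_bounded (dir_curve nb o).
  have aE i : (apol (dir_curve nb o))`_i =
      [:: 1; if o is inr _ then 1 else 0]`_i.
    case: o {gb} => [[?|?]|?] /=; rewrite coefD coefC coefZ coefX;
      by case: i => [|[|i]]; rewrite /= ?nth_nil ?mulr0 ?mul0r ?mulr1 ?addr0 ?add0r.
  have a0 : 0 < (apol (dir_curve nb o))`_0 by rewrite aE.
  have [B [B1 HB]] := kernel_expansion h beta c0 C0 a0.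
  have [apos Hexp] := HB _ gb; exists B; split => // y t z Bt.
  have [cf] := Hexp y; rewrite /= => -[cf0 cf1 cf2 _ /(_ t Bt 3)].
  have -> : cpair (dir_curve nb o) 0 = (nb, 1).
    by case: (o) => [[?|?]|?]; rewrite /dir_curve cpair_lin scale0r mul0r !addr0.
  have [d0 d1 d2] := dpol_dir nb o y.
  rewrite !aE d0 d1 d2 -/z !divr1 in cf1 cf2.
  have -> : \sum_(j < 3) cf j * t ^+ j = 1 + taylor1 z o * t + taylor2 z o * t ^+ 2.
    rewrite !big_ord_recr big_ord0/= cf0 cf1 cf2 /taylor1 /taylor2 /ecoef.
    have Dn0 : dens 1 z != 0 by rewrite gt_eqF// dens_gt0.
    by case: (o) => [[?|?]|?] /=; field.
  by [].
have [F HF] := choice expo.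
pose Bt := \sum_o F o.
have FB o : F o <= Bt.
  by rewrite /Bt (bigD1 o)//= lerDl sumr_ge0// => o' _; have [? _ _] := HF o'; lra.
have F1 o : 1 <= F o by have [] := HF o.
have Bt1 : 1 <= Bt := le_trans (F1 (inr tt)) (FB _).
have Bt0 : 0 < Bt by apply: lt_le_trans Bt1.
have [K' K'0 HK'] := @gker_le_gker0 R p k h c beta c0 beta0 (nb, 1) ltr01.
pose ka := \sum_o `|drift o|.
have kao o : `|drift o| <= ka by rewrite /ka (bigD1 o)//= lerDl sumr_ge0.
have ka0 : 0 <= ka by apply: sumr_ge0.
exists (4 * #|dir|%:R * Bt ^+ 4 * K'), (Bt + ka)^-1.
have Bk : 0 < Bt + ka by rewrite ltr_pwDl.
split; first by rewrite !mulr_ge0 ?exprn_ge0 ?(ltW Bt0) ?(ltW K'0).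
  by rewrite invr_gt0.
move=> t /andP[t0 tle].
have tB : (Bt + ka) * t <= 1 by rewrite mulrC -ler_pdivlMr// div1r.
have nt (b : bool) : `|(-1) ^+ b * t| = t by rewrite normrMsign gtr0_norm.
have FBt o (b : bool) : F o * `|(-1) ^+ b * t| <= 1.
  rewrite nt; apply: le_trans tB; rewrite ler_wpM2r ?(ltW t0)//.
  by rewrite (le_trans (FB o)) ?lerDl.
have wle o (b : bool) : `|drift o * ((-1) ^+ b * t)| <= 1.
  rewrite normrM nt; apply: le_trans tB; rewrite ler_wpM2r ?(ltW t0)//.
  by rewrite (le_trans (kao o)) ?lerDr ?(ltW Bt0).
split.
- by move=> o b; have [_ apos _] := HF o; exact: (apos _ (FBt o b)).
- by move=> o b; have := wle o b; rewrite ler_norml => /andP[]; lra.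
move=> y; set G := gker (nb, 1) y.
have G0 : 0 < G by rewrite gker_gt0.
have sum2 (H : dir * bool -> R) : \sum_x H x = \sum_o (H (o, true) + H (o, false)).
  rewrite (eq_bigr (fun x => H (x.1, x.2))); last by case.
  rewrite -(pair_bigA _ (fun o b => H (o, b)))/=; apply: eq_bigr => o _.
  by rewrite big_bool.
pose z := nmul h (ninv y) nb.
pose rem o (b : bool) := gker (cpair (dir_curve nb o) ((-1) ^+ b * t)) y -
   (1 + taylor1 z o * ((-1) ^+ b * t) + taylor2 z o * ((-1) ^+ b * t) ^+ 2) * G.
have remB o b : `|rem o b| <= Bt ^+ 4 * t ^+ 3 * G.
  have [_ _ /(_ y _ (FBt o b))] := HF o; rewrite nt => H; apply: (le_trans H).
  rewrite ler_wpM2r ?(ltW G0)// exprMn mulrA -exprS ler_wpM2r ?exprn_ge0 ?(ltW t0)//.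
  by apply: lerXn2r => //; rewrite nnegrE ?(ltW Bt0)// (le_trans _ (F1 o)).
rewrite sum2 [X in _ - X * _]sum2 /=.
have -> : \sum_o ((1 + drift o * ((-1) ^+ true * t)) * gker (cpair (dir_curve nb o) ((-1) ^+ true * t)) y
   + (1 + drift o * ((-1) ^+ false * t)) * gker (cpair (dir_curve nb o) ((-1) ^+ false * t)) y)
   - (\sum_o (1 + drift o * ((-1) ^+ true * t) + (1 + drift o * ((-1) ^+ false * t)))) * G
   = \sum_o ((1 + drift o * ((-1) ^+ true * t)) * rem o true
     + (1 + drift o * ((-1) ^+ false * t)) * rem o false)
     + 2 * t ^+ 2 * (\sum_o (taylor2 z o + drift o * taylor1 z o)) * G.
  rewrite mulr_suml -sumrB mulr_sumr mulr_suml -big_split/=; apply: eq_bigr => o _.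
  rewrite /rem; clearbody G.
  move: (gker (cpair (dir_curve nb o) ((-1) ^+ true * t)) y)
    (gker (cpair (dir_curve nb o) ((-1) ^+ false * t)) y) => x1 x2.
  move: (drift o) (taylor1 z o) (taylor2 z o) => x3 x4 x5.
  by rewrite expr0 expr1; ring.
rewrite kernel_equation mulr0 mul0r addr0.
apply: (le_trans (ler_norm_sum _ _ _)).
apply: (@le_trans _ _ (\sum_(o : dir) (4 * (Bt ^+ 4 * t ^+ 3 * G)))).
  apply: ler_sum => o _.
  have w2 (b : bool) : `|1 + drift o * ((-1) ^+ b * t)| <= 2.
    by have := wle o b; rewrite !ler_norml => /andP[? ?]; apply/andP; split; lra.
  rewrite (le_trans (ler_normD _ _))// !normrM.
  have E : 4 * (Bt ^+ 4 * t ^+ 3 * G) = 2 * (Bt ^+ 4 * t ^+ 3 * G) + 2 * (Bt ^+ 4 * t ^+ 3 * G).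
    by ring.
  by rewrite E; apply: lerD; apply: ler_pM => //.
rewrite sumr_const -[_ *+ _]mulr_natl.
have -> : 4 * #|dir|%:R * Bt ^+ 4 * K' * t ^+ 3 * gker0 y =
   #|dir|%:R * (4 * (Bt ^+ 4 * t ^+ 3 * (K' * gker0 y))) by ring.
apply: ler_wpM2l => //; apply: ler_wpM2l => //; apply: ler_wpM2l; last exact: HK'.
by rewrite mulr_ge0 ?exprn_ge0 ?(ltW Bt0) ?(ltW t0).
Qed.

End pde.

(** * A maximum principle in the cone *)

Section topology.
Context {R : realType} {p k : nat}.
Local Notation N := (carrier R p k).

Lemma continuous_hsq : continuous (@hsq R p k).
Proof.
move=> n; rewrite /hsq /dotr; apply: cvg_big => [|i _]; first exact: add_continuous.
by apply: cvgM; exact: continuous_hcoord.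
Qed.

Lemma continuous_vsq : continuous (@vsq R p k).
Proof.
move=> n; rewrite /vsq /dotr; apply: cvg_big => [|i _]; first exact: add_continuous.
by apply: cvgM; exact: continuous_vcoord.
Qed.

Lemma continuous_gsq : continuous (@gsq R p k).
Proof.
rewrite (_ : @gsq R p k = fun n => hsq n * hsq n + 16 * vsq n) => [n|].
  apply: cvgD; first by apply: cvgM; exact: continuous_hsq.
  by apply: cvgMr; exact: continuous_vsq.
by apply/funext => n; rewrite /gsq expr2.
Qed.

Lemma ball_cbound (n n' : N) e : ball n e n' -> cbound e (n' - n).
Proof.
move=> [[_ b1] [_ b2]]; split => i; rewrite !mxE distrC ltW//.
  exact: b1.
exact: b2.
Qed.

Lemma compact_gauge (r : R) : compact [set n : N | gsq n <= r].
Proof.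
pose c := 1 + `|r|.
have K : compact ([set X : 'rV[R]_p.*2 | forall i, `[- c, c]%classic (X ord0 i)] `*`
    [set Z : 'rV[R]_k | forall i, `[- c, c]%classic (Z ord0 i)] : set N).
  apply: compact_setX.
    by apply: (@rV_compact R _ (fun=> `[- c, c]%classic)) => i; exact: segment_compact.
  by apply: (@rV_compact R _ (fun=> `[- c, c]%classic)) => i; exact: segment_compact.
apply: (subclosed_compact _ K).
  rewrite (_ : mkset _ = gsq @^-1` [set x | x <= r]); last by [].
  apply: closed_comp; last exact: closed_le.
  by move=> n _; exact: continuous_gsq.
have r1 : `|r| <= c ^+ 2 by rewrite /c; have := normr_ge0 r; nra.
have c0 : 0 <= c by rewrite addr_ge0.
have sq (x : R) : x ^+ 2 <= c ^+ 2 -> - c <= x <= c.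
  by rewrite -[x ^+ 2]real_normK ?num_real// ler_pXn2r ?nnegrE// ler_norml.
move=> n /= nr; have rr := ler_norm r; have v0 := vsq_ge0 n.
have nrr : gsq n <= `|r| by lra.
have c1 : `|r| + 1 <= c ^+ 2 by rewrite /c; have := normr_ge0 r; nra.
split => i /=; rewrite in_itv/=; apply: sq.
  apply: le_trans (coef_sqr_le n.1 i) _; rewrite -/(hsq n).
  have : hsq n ^+ 2 <= `|r| by rewrite (le_trans _ nrr)// /gsq lerDl mulr_ge0.
  have := sqr_ge0 (hsq n - 1); have := sqr_ge0 c; rewrite /c; have := normr_ge0 r; nra.
apply: le_trans (coef_sqr_le n.2 i) _; rewrite -/(vsq n).
have : 16 * vsq n <= `|r| by rewrite (le_trans _ nrr)// /gsq lerDr sqr_ge0.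
lra.
Qed.

End topology.

Section max_principle.
Context {R : realType} {p k : nat} (h : htype R p k).
Local Notation N := (carrier R p k).
Variables (c beta : R).
Hypothesis c0 : 0 < c.
Hypothesis beta0 : 0 < beta.
Variables (T : N * R -> R -> R) (A r1 : R).
Hypothesis HT : blowup_family h c beta T A r1.
Variable L : R.
Local Notation M := (lsup T L).

Lemma lsup_continuous : continuous (fun n : N => M (n, 1)).
Proof.
move=> n; have [C C1 Cn] := cbound_ex n.
have [K [d [K0 d0 HK]]] := lsup_lip c0 beta0 HT L C1.
apply/cvgrPdist_le => e e0.
have m0 : 0 < Num.min d (e / K) by rewrite lt_min d0 divr_gt0.
have : nbhs n (ball n (Num.min d (e / K))) by apply: nbhsx_ballx.
apply: filterS => n' /ball_cbound nn'.
rewrite distrC; apply: le_trans (HK n n' Cn _ _ nn') _.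
  by rewrite m0 ge_min lexx.
by rewrite mulrC -ler_pdivlMr// ge_min lexx orbT.
Qed.

Lemma gsq_curve_neg (g : @pcurve R p k) (alpha : R) :
  gsq (cpoint g 0) < alpha * (apol g).[0] ^+ 2 ->
  \forall t \near (0 : R), gsq (cpoint g t) < alpha * (apol g).[t] ^+ 2.
Proof.
pose g0 := {| hpol := hpol g; vpol := vpol g; apol := 0 |}.
pose q := dpol h g0 0 - alpha *: (apol g) ^+ 2.
have qE t : q.[t] = gsq (cpoint g t) - alpha * (apol g).[t] ^+ 2.
  rewrite hornerD hornerN hornerZ horner_exp dpolE /= horner0; congr (_ - _).
  rewrite (_ : nmul h (ninv 0) _ = cpoint g t).
    by rewrite densE; ring.
  by rewrite (_ : ninv 0 = 0) ?nmul0// /ninv /= !oppr0.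
rewrite -subr_lt0 -qE => q0.
have : \forall t \near (0 : R), q.[t] < 0.
  have := @continuous_horner R q 0; move/cvgr_lt; exact.
by apply: filterS => t; rewrite qE subr_lt0.
Qed.

(** Suppose that lsup is positive somewhere at height 1 in the cone. By homogeneity
    it is a function on the cone invariant by dilations; adding the strictly
    subharmonic function e hsq / a keeps a positive maximum f nb, reached in the
    interior. By kernel_second_difference lsup at nb is at most its weighted mean over
    the neighbours, up to t^3, and the mean of hsq / a exceeds its value at nb by a
    multiple of p t^2: this is a contradiction for small t. *)
Lemma lsup_max_principle (alpha : R) : (0 < p)%N -> 0 < alpha ->
  (forall n, gsq n = alpha ^+ 2 -> M (n, 1) = 0) ->
  forall n, gsq n <= alpha ^+ 2 -> M (n, 1) = 0.
Proof.
move=> p0 a0 Mbd n1 n1le; apply/eqP; apply: contraT => m0.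
set m := M (n1, 1) in m0.
have mpos : 0 < m by rewrite lt0r m0 (lsup_ge0 c0 beta0 HT).
(* hsq is at most alpha on the cone at height 1, so the perturbation is at most m / 2. *)
pose e := m / (2 * alpha).
have e0 : 0 < e by rewrite divr_gt0// mulr_gt0.
pose f (n : N) := M (n, 1) + e * hsq n.
have cf : continuous f.
  move=> n; apply: cvgD; first exact: lsup_continuous.
  by apply: cvgMr; exact: continuous_hsq.
have [||nb] := compact_EVT_max _ (@compact_gauge R p k (alpha ^+ 2)) (f := f).
- by exists n1.
- exact: continuous_subspaceT.
rewrite inE/= => nble fmax.
have mf : m <= f nb.
  apply: le_trans (fmax n1 _); last by rewrite inE.
  by rewrite /f lerDl mulr_ge0 ?hsq_ge0// ltW.
have nblt : gsq nb < alpha ^+ 2.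
  rewrite lt_neqAle nble andbT; apply/eqP => nbE.
  have : hsq nb <= alpha.
    rewrite -(@ler_pXn2r _ 2) ?nnegrE ?hsq_ge0 ?(ltW a0)// -nbE.
    by rewrite /gsq lerDl mulr_ge0// vsq_ge0.
  move=> /(ler_wpM2l (ltW e0)); rewrite {2}/e => H.
  move: mf; rewrite /f (Mbd _ nbE) add0r => mf.
  have : m / (2 * alpha) * alpha = m / 2 by field; rewrite gt_eqF.
  lra.
have Mle n a : 0 < a -> gsq n <= alpha ^+ 2 * a ^+ 2 -> M (n, a) <= f nb - e * (hsq n / a).
  move=> aa gn; have ai : 0 < a^-1 by rewrite invr_gt0.
  have := fmax (dil a^-1 n); rewrite inE/= gsq_dil ?(ltW ai)//.
  rewrite exprVn mulrC ler_pdivrMr ?exprn_gt0// => /(_ gn).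
  rewrite /f hsq_dil ?(ltW ai)// mulrC.
  have M1 : M (dil a^-1 n, 1) = M (n, a) by rewrite -(mulVf (lt0r_neq0 aa)) (lsup_dil HT).
  by rewrite M1 -mulrA [_^-1 * _]mulrC; lra.
have [K [t0 [K0 t00 HK]]] := kernel_second_difference h c0 beta0 nb.
have A0 := family_ge0 HT.
have AK : 0 < 2 * A * K + 1 by rewrite ltr_wpDl// !mulr_ge0.
have cone_near : \forall t \near 0^'+, forall x : @dir p k * bool,
    gsq (cpair (dir_curve h nb x.1) ((-1) ^+ x.2 * t)).1 <=
    alpha ^+ 2 * (cpair (dir_curve h nb x.1) ((-1) ^+ x.2 * t)).2 ^+ 2.
  apply: filter_forall => x; case: x => o b /=.
  have h0 : gsq (cpoint (dir_curve h nb o) 0) < alpha ^+ 2 * (apol (dir_curve h nb o)).[0] ^+ 2.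
    have : cpair (dir_curve h nb o) 0 = (nb, 1).
      by case: (o) => [[?|?]|?]; rewrite /dir_curve cpair_lin scale0r mul0r !addr0.
    by move=> [-> ->]; rewrite expr1n mulr1.
  have [d /= d0 Hd] := gsq_curve_neg h0.
  exists d => //= t /=; rewrite !sub0r !normrN => td _.
  by apply: ltW; apply: Hd => /=; rewrite sub0r normrN normrMsign.
have : \forall t \near (0:R)^'+, False; last by move/filter_ex => [].
near=> t.
have tpos : 0 < t by near: t; exact: nbhs_right_gt.
have tt0 : 0 < t <= t0 by rewrite tpos; near: t; exact: nbhs_right_le.
have t1 : t < 1 by near: t; exact: nbhs_right_lt.
have tK : t < e * (4 * p%:R) / (2 * A * K + 1).
  near: t; apply: nbhs_right_lt; apply: divr_gt0 => //.
  by apply: mulr_gt0 => //; apply: mulr_gt0; rewrite ltr0n.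
have tcone : forall x : @dir p k * bool,
    gsq (cpair (dir_curve h nb x.1) ((-1) ^+ x.2 * t)).1 <=
    alpha ^+ 2 * (cpair (dir_curve h nb x.1) ((-1) ^+ x.2 * t)).2 ^+ 2.
  by near: t; exact: cone_near.
have [apos w0 HKt] := HK t tt0.
pose w (x : @dir p k * bool) := 1 + drift beta x.1 * ((-1) ^+ x.2 * t).
pose P (x : @dir p k * bool) := cpair (dir_curve h nb x.1) ((-1) ^+ x.2 * t).
have Kt0 : 0 <= K * t ^+ 3 by rewrite mulr_ge0// exprn_ge0// ltW.
have comb := @lsup_comb _ _ _ h c beta c0 beta0 T A r1 HT L _ w P (nb, 1) (K * t ^+ 3)
  (fun x => w0 x.1 x.2) (fun x => apos x.1 x.2) ltr01 Kt0 HKt.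
pose Phi (P : N * R) := hsq P.1 / P.2.
have MP x : M (P x) <= f nb - e * Phi (P x).
  have := @Mle (P x).1 (P x).2 (apos x.1 x.2) (tcone x).
  by rewrite -surjective_pairing.
have : (\sum_x w x) * M (nb, 1) <= (\sum_x w x) * f nb - e * (\sum_x w x * Phi (P x)) + 2 * A * (K * t ^+ 3).
  apply: (le_trans comb); rewrite lerD2r mulr_suml mulr_sumr -sumrB.
  apply: ler_sum => x _; have := ler_wpM2l (w0 x.1 x.2) (MP x); rewrite -/(w x).
  by rewrite mulrBr [w x * (e * _)]mulrCA.
have sum2 (H : @dir p k * bool -> R) : \sum_x H x = \sum_o (H (o, true) + H (o, false)).
  rewrite (eq_bigr (fun x => H (x.1, x.2))); last by case.
  rewrite -(pair_bigA _ (fun o b => H (o, b)))/=; apply: eq_bigr => o _.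
  by rewrite big_bool.
have wsum : \sum_x w x = \sum_(o : @dir p k) 2.
  by rewrite sum2; apply: eq_bigr => o _; rewrite /w /= expr0 expr1; ring.
have Phisum : (\sum_x w x) * hsq nb + 4 * p%:R * t ^+ 2 <= \sum_x w x * Phi (P x).
  rewrite wsum sum2 !big_sumType/= !(big_pred1 tt); try by case.
  have S1 : (\sum_(i < p.*2) 2) * hsq nb + 4 * p%:R * t ^+ 2 =
      \sum_(i < p.*2) (w (inl (inl i), true) * Phi (P (inl (inl i), true)) +
                      w (inl (inl i), false) * Phi (P (inl (inl i), false))).
    have pp : p.*2%:R = 2 * p%:R :> R by rewrite -mul2n natrM.
    rewrite (_ : 4 * p%:R * t ^+ 2 = \sum_(i < p.*2) (2 * t ^+ 2)).
      rewrite mulr_suml -big_split/=; apply: eq_bigr => i _.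
      rewrite /w /Phi /P /dir_curve !cpair_lin /= !mulr0 !addr0 !mul0r !addr0 !divr1.
      rewrite /hsq /= !dotr_line dotr_delta_delta expr0 expr1; ring.
    by rewrite sumr_const card_ord -[(2 * t ^+ 2) *+ _]mulr_natr pp; ring.
  have S2 : (\sum_(j < k) 2) * hsq nb =
      \sum_(j < k) (w (inl (inr j), true) * Phi (P (inl (inr j), true)) +
                      w (inl (inr j), false) * Phi (P (inl (inr j), false))).
    rewrite mulr_suml; apply: eq_bigr => j _.
    rewrite /w /Phi /P /dir_curve !cpair_lin /= !mulr0 !addr0 !mul0r !addr0 !divr1.
    by rewrite /hsq /= !scaler0 !addr0; ring.
  have S3 : 2 * hsq nb <= w (inr tt, true) * Phi (P (inr tt, true)) +
                      w (inr tt, false) * Phi (P (inr tt, false)).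
    rewrite /w /Phi /P /dir_curve !cpair_lin /= !scaler0 !addr0 expr0 expr1 !mulr1 mulN1r mul1r.
    have u0 := hsq_ge0 nb; move: (hsq nb) u0 => u u0.
    have tp : 0 < 1 + t by rewrite addr_gt0.
    have tm : 0 < 1 - t by rewrite subr_gt0.
    have -> : (1 + (1 - 2 * beta) / 2 * - t) * (u / (1 - t)) +
       (1 + (1 - 2 * beta) / 2 * t) * (u / (1 + t)) =
       2 * u + (1 + 2 * beta) * t ^+ 2 * u / ((1 + t) * (1 - t)).
      by field; rewrite !gt_eqF.
    have h1 : 0 <= (1 + 2 * beta) * t ^+ 2 * u.
      by rewrite mulr_ge0// mulr_ge0 ?sqr_ge0// addr_ge0// mulr_ge0// ltW.
    by rewrite lerDl divr_ge0// mulr_ge0 ?(ltW tp) ?(ltW tm).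
  by move: S1 S3; rewrite !mulrDl S2; lra.
move=> Hineq; move: Phisum => /(ler_wpM2l (ltW e0)) Phisum.
have : e * (4 * p%:R * t ^+ 2) <= 2 * A * (K * t ^+ 3).
  move: Hineq Phisum; rewrite {1}/f; move: (\sum_x w x) (\sum_x w x * Phi (P x)) => W S; rewrite !mulrDr. lra.
have t2 : 0 < t ^+ 2 by rewrite exprn_gt0.
rewrite (_ : e * _ = e * (4 * p%:R) * t ^+ 2); last by ring.
rewrite (_ : 2 * A * _ = 2 * A * K * t * t ^+ 2); last by ring.
rewrite ler_pM2r// => H.
move: tK; rewrite ltr_pdivlMr// mulrDr mulr1; lra.
Unshelve. all: by end_near. Qed.

End max_principle.

(** * The boundary of the cone and its sectors *)

Section sector.
Context {R : realType} {p k : nat}.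
Local Notation N := (carrier R p k).

Lemma cvg_coord (S : Type) (F : set_system S) (FF : Filter F) (f : S -> N) (n : N) :
  (forall i, (f t).1 0 i @[t --> F] --> n.1 0 i) ->
  (forall j, (f t).2 0 j @[t --> F] --> n.2 0 j) -> f t @[t --> F] --> n.
Proof.
move=> f1 f2; apply/cvg_ballP => e e0.
have H1 : \forall t \near F, forall i, `|n.1 0 i - (f t).1 0 i| < e.
  by apply: filter_forall => i; have /cvgrPdist_lt := f1 i; apply.
have H2 : \forall t \near F, forall i, `|n.2 0 i - (f t).2 0 i| < e.
  by apply: filter_forall => i; have /cvgrPdist_lt := f2 i; apply.
near=> t; split; split => // i j; rewrite (ord1 i).
  have K : forall i, `|n.1 0 i - (f t).1 0 i| < e by near: t; exact: H1.
  exact: K.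
have K : forall i, `|n.2 0 i - (f t).2 0 i| < e by near: t; exact: H2.
exact: K.
Unshelve. all: by end_near. Qed.

(** The rays of a sector are the orbits of these points under dilations, translated
    to n0. *)
Definition sector_point (alpha : R) (omega : 'rV[R]_p.*2) (zeta : 'rV[R]_k) (theta : R) : N :=
  (Num.sqrt (alpha * `|cos theta|) *: omega, (4^-1 * (alpha * `|sin theta|)) *: zeta).

(** Where the cosine or the sine vanishes, a sector is not a neighbourhood of the
    ray in the boundary of the cone; nearby angles avoid these values. *)
Lemma exists_generic_angle (U : set R) th : 0 <= th < 2 * pi -> open U -> U th ->
  exists th0, [/\ U th0, 0 < th0 < 2 * pi, cos th0 != 0 & sin th0 != 0].
Proof.
move=> /andP[th0 th2] oU Uth.
have pi0 : 0 < pi :> R by exact: pi_gt0.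
have [/andP[cn sn]|] := boolP ((cos th != 0) && (sin th != 0)).
  exists th; split => //; rewrite th2 andbT lt0r th0 andbT.
  by apply: contraNneq sn => ->; rewrite sin0.
rewrite negb_and !negbK => cs.
have : \forall d \near 0^'+, [/\ U (th + d), th + d < 2 * pi & d < pi / 2].
  have c1 : th + d @[d --> 0^'+] --> th.
    rewrite -[X in _ --> X](addr0 th); apply: cvgD; first exact: cvg_cst.
    by apply: cvg_at_right_filter; exact: cvg_id.
  near=> d; split.
  - by near: d; apply: c1; exact: open_nbhs_nbhs.
  - by near: d; move/cvgr_lt : c1; apply.
  - by near: d; apply: nbhs_right_lt; rewrite divr_gt0.
move=> Hd.
have : \forall d \near (0:R)^'+, [/\ U (th + d), th + d < 2 * pi, d < pi / 2 & 0 < d].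
  near=> d; have [? ? ?] : [/\ U (th + d), th + d < 2 * pi & d < pi / 2] by near: d; exact: Hd.
  by split => //; near: d; exact: nbhs_right_gt.
move/filter_ex => [d [Ud d2 dpi d0]].
have sd : 0 < sin d by apply: sin_gt0_pi; apply/andP; split; lra.
have cd : 0 < cos d by apply: cos_gt0_pihalf; apply/andP; split; lra.
exists (th + d); split => //; first by apply/andP; split; lra.
- rewrite cosD; have := cos2Dsin2 th; case/orP: cs => /eqP E; rewrite E.
    rewrite mul0r sub0r oppr_eq0 expr0n add0r => /eqP; rewrite sqrf_eq1.
    by case/orP => /eqP ->; rewrite ?mulN1r ?mul1r ?oppr_eq0 gt_eqF.
  rewrite mul0r subr0 expr0n addr0 => /eqP; rewrite sqrf_eq1.
  by case/orP => /eqP ->; rewrite ?mulN1r ?mul1r ?oppr_eq0 gt_eqF.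
- rewrite sinD; have := cos2Dsin2 th; case/orP: cs => /eqP E; rewrite E.
    rewrite mul0r addr0 expr0n add0r => /eqP; rewrite sqrf_eq1.
    by case/orP => /eqP ->; rewrite ?mulN1r ?mul1r ?oppr_eq0 gt_eqF.
  rewrite mul0r add0r expr0n addr0 => /eqP; rewrite sqrf_eq1.
  by case/orP => /eqP ->; rewrite ?mulN1r ?mul1r ?oppr_eq0 gt_eqF.
Unshelve. all: by end_near. Qed.

(** The coordinates of a sector depend on the angle through the absolute values of its
    cosine and sine only; th + sg (phi - phi0) is the angle near th, whatever the
    quadrant of th, with the same absolute values as phi. *)
Lemma reflected_angle (th : R) (phi0 := acos `|cos th|) phi :
  let sg := Num.sg (cos th) * Num.sg (sin th) in
  cos th != 0 -> sin th != 0 ->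
  `|cos (th + sg * (phi - phi0))| = `|cos phi| /\
  `|sin (th + sg * (phi - phi0))| = `|sin phi|.
Proof.
move=> sg cn sn.
have c01 : -1 <= `|cos th| <= 1.
  by rewrite (le_trans (lerN10 R) (normr_ge0 _))/= ler_norml cos_geN1 cos_le1.
have cphi : cos phi0 = `|cos th| by rewrite acosK// in_itv.
have sphi : sin phi0 = `|sin th|.
  rewrite sin_acos// real_normK ?num_real// -sqrtr_sqr; congr Num.sqrt.
  by rewrite -(cos2Dsin2 th); ring.
have sc : Num.sg (cos th) ^+ 2 = 1 by rewrite sqr_sg cn.
have ss : Num.sg (sin th) ^+ 2 = 1 by rewrite sqr_sg sn.
have sgE : (sg == 1) || (sg == -1).
  by rewrite -sqrf_eq1 /sg exprMn sc ss mulr1.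
have cosg x : cos (sg * x) = cos x.
  by case/orP: sgE => /eqP ->; rewrite ?mul1r ?mulN1r ?cosN.
have sing x : sin (sg * x) = sg * sin x.
  by case/orP: sgE => /eqP ->; rewrite ?mul1r ?mulN1r ?sinN.
have cE : cos th = Num.sg (cos th) * cos phi0 by rewrite cphi -numEsg.
have sE : sin th = Num.sg (sin th) * sin phi0 by rewrite sphi -numEsg.
have E1 : cos (th + sg * (phi - phi0)) = Num.sg (cos th) * cos phi.
  rewrite cosD cosg sing {1}cE {1}sE -[in RHS](subrK phi0 phi) (cosD (phi - phi0)).
  move: sgE; rewrite /sg; move: ss; move: (Num.sg (cos th)) (Num.sg (sin th)) => a b ss _.
  have -> : b * sin phi0 * (a * b * sin (phi - phi0)) = b ^+ 2 * (a * (sin phi0 * sin (phi - phi0))) by ring.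
  by rewrite ss; ring.
have E2 : sin (th + sg * (phi - phi0)) = Num.sg (sin th) * sin phi.
  rewrite sinD cosg sing {1}cE {1}sE -[in RHS](subrK phi0 phi) (sinD (phi - phi0)).
  move: sgE; rewrite /sg; move: sc; move: (Num.sg (cos th)) (Num.sg (sin th)) => a b sc _.
  have -> : a * cos phi0 * (a * b * sin (phi - phi0)) = a ^+ 2 * (b * (cos phi0 * sin (phi - phi0))) by ring.
  by rewrite sc; ring.
by rewrite E1 E2 !normrM !normr_sg cn sn !mul1r.
Qed.

End sector.

Section boundary.
Context {R : realType} {p k : nat}.
Local Notation N := (carrier R p k).

(** At a generic angle a sector contains a neighbourhood of its ray in the boundary of
    the cone: the polar coordinates of n depend continuously on n. *)
Lemma sector_neighbourhood (alpha : R) (U1 : set 'rV[R]_p.*2) (U2 : set 'rV[R]_k) (U3 : set R)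
    omega zeta theta : 0 < alpha -> open U1 -> open U2 -> open U3 ->
  U1 omega -> U2 zeta -> U3 theta -> dotr omega omega = 1 -> dotr zeta zeta = 1 ->
  0 < theta < 2 * pi -> cos theta != 0 -> sin theta != 0 ->
  \forall n \near sector_point alpha omega zeta theta, gsq n = alpha ^+ 2 ->
  exists o z t, [/\ U1 o /\ dotr o o = 1, U2 z /\ dotr z z = 1,
    U3 t /\ 0 <= t < 2 * pi & n = sector_point alpha o z t].
Proof.
move=> a0 oU1 oU2 oU3 U1o U2z U3t oo zz /andP[t0 t2] ct st.
set ns := sector_point alpha omega zeta theta.
have hns : hsq ns = alpha * `|cos theta|.
  by rewrite /hsq dotrZl dotrZr oo mulr1 -expr2 sqr_sqrtr// mulr_ge0// ltW.
have vns : vsq ns = (4^-1 * (alpha * `|sin theta|)) ^+ 2.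
  by rewrite /vsq dotrZl dotrZr zz mulr1 -expr2.
have hns0 : 0 < hsq ns by rewrite hns mulr_gt0// normr_gt0.
have vs0 : 0 < 4^-1 * (alpha * `|sin theta|) by rewrite mulr_gt0// mulr_gt0// normr_gt0.
have vns0 : 0 < vsq ns by rewrite vns exprn_gt0.
have ch : hsq n @[n --> ns] --> hsq ns by exact: continuous_hsq.
have cv : vsq n @[n --> ns] --> vsq ns by exact: continuous_vsq.
have co : (Num.sqrt (hsq n))^-1 *: n.1 @[n --> ns] --> omega.
  have -> : omega = (Num.sqrt (hsq ns))^-1 *: ns.1.
    by rewrite hns scalerA mulVf ?scale1r// gt_eqF// sqrtr_gt0 mulr_gt0// normr_gt0.
  apply: cvgZ; last exact: cvg_fst.
  apply: cvgV; first by rewrite gt_eqF// sqrtr_gt0.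
  by apply: (cvg_comp _ _ ch); exact: sqrt_continuous.
have cz : (Num.sqrt (vsq n))^-1 *: n.2 @[n --> ns] --> zeta.
  have -> : zeta = (Num.sqrt (vsq ns))^-1 *: ns.2.
    rewrite vns sqrtr_sqr (gtr0_norm vs0) scalerA mulVf ?scale1r//.
    by rewrite gt_eqF.
  apply: cvgZ; last exact: cvg_snd.
  apply: cvgV; first by rewrite gt_eqF// sqrtr_gt0.
  by apply: (cvg_comp _ _ cv); exact: sqrt_continuous.
pose sg := Num.sg (cos theta) * Num.sg (sin theta).
pose phi (n : N) := acos (hsq n / alpha).
pose th (n : N) := theta + sg * (phi n - acos `|cos theta|).
have cth : th n @[n --> ns] --> theta.
  rewrite -[X in _ --> X]addr0; apply: cvgD; first exact: cvg_cst.
  rewrite -[X in _ --> X](mulr0 sg); apply: cvgMr.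
  rewrite -(subrr (acos `|cos theta|)); apply: cvgB; last exact: cvg_cst.
  rewrite (_ : `|cos theta| = hsq ns / alpha); last by rewrite hns mulrC mulKf// gt_eqF.
  apply: (@cvg_comp _ _ _ (fun n => hsq n / alpha) acos).
    by apply: cvgMl; exact: ch.
  apply: continuous_acos; rewrite hns mulrC mulKf ?gt_eqF//.
  rewrite (lt_le_trans (_ : -1 < 0) (normr_ge0 _)) ?ltrN10//=.
  have s0 : 0 < sin theta ^+ 2 by rewrite lt0r sqr_ge0 sqrf_eq0 st.
  have := cos2Dsin2 theta; rewrite -(@real_normK _ (cos theta)) ?num_real// => H.
  rewrite -(@ltr_pXn2r _ 2) ?nnegrE// expr1n; lra.
near=> n => gn.
have hn0 : 0 < hsq n by near: n; move/cvgr_gt : ch; apply.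
have vn0 : 0 < vsq n by near: n; move/cvgr_gt : cv; apply.
exists ((Num.sqrt (hsq n))^-1 *: n.1), ((Num.sqrt (vsq n))^-1 *: n.2), (th n).
have hle : hsq n / alpha <= 1.
  rewrite ler_pdivrMr// mul1r -(@ler_pXn2r _ 2) ?nnegrE ?(ltW a0) ?(ltW hn0)// -gn.
  by rewrite lerDl mulr_ge0// ltW.
have hge : 0 <= hsq n / alpha by rewrite divr_ge0// ltW.
have h01 : -1 <= hsq n / alpha <= 1 by rewrite hle (le_trans (lerN10 R)).
have [E1 E2] := reflected_angle (phi n) ct st.
split.
- split; first by near: n; apply: co; exact: open_nbhs_nbhs.
  rewrite dotrZl dotrZr mulrA -expr2 exprVn sqr_sqrtr ?(ltW hn0)//.
  by rewrite mulVf// gt_eqF.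
- split; first by near: n; apply: cz; exact: open_nbhs_nbhs.
  rewrite dotrZl dotrZr mulrA -expr2 exprVn sqr_sqrtr ?(ltW vn0)//.
  by rewrite mulVf// gt_eqF.
- split; first by near: n; apply: cth; exact: open_nbhs_nbhs.
  apply/andP; split; last by near: n; move/cvgr_lt : cth; apply.
  by apply: ltW; near: n; move/cvgr_gt : cth; apply.
rewrite /sector_point E1 E2 /phi acosK ?in_itv// sin_acos// (ger0_norm hge).
rewrite (ger0_norm (sqrtr_ge0 _)) mulrC divfK ?gt_eqF//.
have -> : 4^-1 * (alpha * Num.sqrt (1 - (hsq n / alpha) ^+ 2)) = Num.sqrt (vsq n).
  rewrite mulrA -[4^-1 * alpha]gtr0_norm ?mulr_gt0// -sqrtr_sqr -sqrtrM ?sqr_ge0//.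
  congr Num.sqrt; have -> : vsq n = (alpha ^+ 2 - hsq n ^+ 2) / 16 by rewrite -gn /gsq; field.
  by field; rewrite gt_eqF.
rewrite !scalerA !mulfV ?gt_eqF ?sqrtr_gt0// !scale1r.
by case: (n).
Unshelve. all: by end_near. Qed.

End boundary.

Section boundary_curve.
Context {R : realType} {p k : nat}.
Local Notation N := (carrier R p k).

(** Modulo dilations the boundary of the cone is a compact hypersurface, not
    parametrised polynomially. Choosing the height so that alpha a - 4 <Z, e> = 1
    turns the equation |X|^4 + 16 |Z|^2 = alpha^2 a^2 into one that is affine in the
    component of Z along e: its solutions are a graph over X and the part of Z
    orthogonal to e, polynomial in these variables. Any two points of this graph are
    joined by a segment in the variables of the base. *)
Lemma boundary_curve (alpha : R) (e : 'rV[R]_k) (n0 n1 : N) : 0 < alpha ->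
  dotr e e = 1 -> gsq n0 = alpha ^+ 2 -> gsq n1 = alpha ^+ 2 ->
  4 * dotr n0.2 e < alpha -> 4 * dotr n1.2 e < alpha ->
  exists (g : @pcurve R p k) s0 s1, [/\ 0 < s0 /\ 0 < s1,
    forall t, 0 < (apol g).[t], forall t, gsq (cpoint g t) = alpha ^+ 2 * (apol g).[t] ^+ 2,
    cpair g 0 = (dil s0 n0, s0) & cpair g 1 = (dil s1 n1, s1)].
Proof.
move=> a0 ee g0 g1 e0 e1.
pose s (n : N) := (alpha - 4 * dotr n.2 e)^-1.
have s0 : 0 < s n0 by rewrite invr_gt0 subr_gt0.
have s1 : 0 < s n1 by rewrite invr_gt0 subr_gt0.
pose X (n : N) := Num.sqrt (s n) *: n.1.
pose W (n : N) := s n *: (n.2 - dotr n.2 e *: e).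
have We n : dotr (W n) e = 0.
  by rewrite dotrZl dotrDl dotrNl dotrZl ee mulr1 subrr mulr0.
pose Xl t := X n0 + t *: (X n1 - X n0).
pose Wl t := W n0 + t *: (W n1 - W n0).
pose Xp i := (X n0 0 i)%:P + (X n1 - X n0) 0 i *: 'X : {poly R}.
pose Wp j := (W n0 0 j)%:P + (W n1 - W n0) 0 j *: 'X : {poly R}.
pose qp := (\sum_i Xp i ^+ 2) ^+ 2 + 16 *: (\sum_j Wp j ^+ 2).
pose g := {| hpol := Xp;
  vpol := fun j => Wp j + (e 0 j / 8) *: (qp - 1);
  apol := (2 * alpha)^-1 *: (1 + qp) |}.
pose q t := dotr (Xl t) (Xl t) ^+ 2 + 16 * dotr (Wl t) (Wl t).
have XpE i t : (Xp i).[t] = Xl t 0 i by rewrite horner_lin !mxE.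
have WpE i t : (Wp i).[t] = Wl t 0 i by rewrite horner_lin !mxE.
have qE t : qp.[t] = q t.
  rewrite hornerD horner_exp hornerZ !horner_sum; congr (_ ^+ 2 + 16 * _).
    by apply: eq_bigr => i _; rewrite horner_exp XpE expr2.
  by apply: eq_bigr => i _; rewrite horner_exp WpE expr2.
have q0 t : 0 <= q t by rewrite addr_ge0 ?sqr_ge0// mulr_ge0// dotr_ge0.
have aE t : (apol g).[t] = (2 * alpha)^-1 * (1 + q t) by rewrite hornerZ hornerD hornerC qE.
have cE t : cpoint g t = (Xl t, Wl t + ((q t - 1) / 8) *: e).
  rewrite /cpoint; congr (_, _); apply/rowP => i; rewrite mxE /= ?XpE//.
  rewrite hornerD WpE hornerZ hornerD hornerN hornerC qE !mxE; by field.
have Wle t : dotr (Wl t) e = 0.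
  by rewrite (dotrDl (W n0)) (dotrZl t) (dotrDl (W n1)) dotrNl !We; ring.
have key n : gsq n = alpha ^+ 2 -> 0 < s n ->
  let qn := dotr (X n) (X n) ^+ 2 + 16 * dotr (W n) (W n) in
  (2 * alpha)^-1 * (1 + qn) = s n /\
  (X n, W n + ((qn - 1) / 8) *: e) = dil (s n) n.
  move=> gn sn qn.
  pose d := dotr n.2 e.
  have snE : s n * (alpha - 4 * d) = 1 by rewrite mulVf// gt_eqF// -invr_gt0.
  have qnE : qn = s n * (alpha + 4 * d).
    have -> : qn = s n ^+ 2 * (gsq n - 16 * d ^+ 2).
      rewrite /qn /W /X !dotrZl !dotrZr mulrA -expr2 sqr_sqrtr ?(ltW sn)//.
      rewrite dotrDl !dotrDr !dotrNl !dotrNr !dotrZl !dotrZr ee (dotrC e) -/d.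
      by rewrite /gsq /hsq /vsq; ring.
    rewrite gn (_ : alpha ^+ 2 - 16 * d ^+ 2 = (alpha - 4 * d) * (alpha + 4 * d)); last by ring.
    by rewrite expr2 mulrA -(mulrA (s n)) snE mulr1.
  split.
    have -> : 1 + qn = 2 * alpha * s n by rewrite qnE -[X in X + _ = _]snE; ring.
    by rewrite mulKf// gt_eqF// mulr_gt0.
  rewrite /dil; congr (_, _).
  have -> : (qn - 1) / 8 = s n * d by rewrite qnE -[X in (_ - X) / _ = _]snE; field.
  by rewrite /W scalerBr scalerA subrK.
have X0 : Xl 0 = X n0 by rewrite /Xl scale0r addr0.
have W0 : Wl 0 = W n0 by rewrite /Wl scale0r addr0.
have X1 : Xl 1 = X n1 by rewrite /Xl scale1r subrKC.
have W1 : Wl 1 = W n1 by rewrite /Wl scale1r subrKC.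
exists g, (s n0), (s n1); split => //.
- by move=> t; rewrite aE mulr_gt0 ?invr_gt0 ?mulr_gt0// ltr_pwDl.
- move=> t; rewrite aE cE.
  have : q t = dotr (Xl t) (Xl t) ^+ 2 + 16 * dotr (Wl t) (Wl t) by [].
  move: (Wle t) (q t) => + qt; move: (Wl t) (Xl t) => w x we qtE.
  rewrite /gsq /hsq /vsq [(x, _).1]/= [(x, _).2]/= dotrDl !dotrDr !dotrZl !dotrZr (dotrC e) we ee.
  have -> : dotr x x ^+ 2 = qt - 16 * dotr w w by rewrite qtE; ring.
  by field; rewrite gt_eqF.
- have [h1 h2] := key n0 g0 s0.
  by rewrite /cpair cE aE /q X0 W0 h1 h2.
- have [h1 h2] := key n1 g1 s1.
  by rewrite /cpair cE aE /q X1 W1 h1 h2.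
Qed.

End boundary_curve.

(** * From a sector to all cones *)

Section vanishing.
Context {R : realType} {p k : nat} (h : htype R p k).
Local Notation N := (carrier R p k).
Variables (c beta : R).
Hypothesis c0 : 0 < c.
Hypothesis beta0 : 0 < beta.
Variables (T : N * R -> R -> R) (A r1 : R).
Hypothesis HT : blowup_family h c beta T A r1.
Variable L : R.
Local Notation M := (lsup T L).

Lemma lsup_normalise (n : N) a : 0 < a -> M (n, a) = M (dil a^-1 n, 1).
Proof.
move=> a0; rewrite -(lsup_dil HT L (dil a^-1 n) a0 ltr01) mulr1.
by rewrite dilD ?invr_ge0 ?(ltW a0)// mulfV ?gt_eqF// dil1.
Qed.

Lemma lsup_propagate (g : @pcurve R p k) : (forall t, 0 < (apol g).[t]) ->
  (\forall t \near (0 : R), M (cpair g t) = 0) -> M (cpair g 1) = 0.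
Proof.
move=> apos [d /= d0 gd]; apply/(tendsP c0 beta0 HT L (P := cpair g 1) (apos 1)).
apply: (tends_propagate HT) => [t _|]; first exact: apos.
exists d => // t /andP[t0 td]; apply/(tendsP c0 beta0 HT L (P := cpair g t) (apos t)); apply: gd => /=.
by rewrite sub0r normrN gtr0_norm.
Qed.

Lemma gsq_sector_point (alpha : R) o z t : 0 < alpha -> dotr o o = 1 -> dotr z z = 1 ->
  gsq (sector_point alpha o z t : N) = alpha ^+ 2.
Proof.
move=> a0 oo zz; rewrite /gsq /hsq /vsq !dotrZl !dotrZr oo zz !mulr1 -!expr2.
rewrite sqr_sqrtr; last by rewrite mulr_ge0// ltW.
rewrite !exprMn !real_normK ?num_real//.
by rewrite -[RHS]mulr1 -[X in _ = _ * X](cos2Dsin2 t); field.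
Qed.

(** The limit is known in a neighbourhood of one point of the boundary of the cone, by
    sector_neighbourhood, and propagates to any other point along the curve of
    boundary_curve. *)
Lemma lsup_boundary (alpha : R) (U1 : set 'rV[R]_p.*2) (U2 : set 'rV[R]_k) (U3 : set R)
    w z th : 0 < alpha -> open U1 -> open U2 -> open U3 ->
  U1 w -> dotr w w = 1 -> U2 z -> dotr z z = 1 -> U3 th -> 0 <= th < 2 * pi ->
  (forall o z t, U1 o -> dotr o o = 1 -> U2 z -> dotr z z = 1 ->
     U3 t -> 0 <= t < 2 * pi -> M (sector_point alpha o z t, 1) = 0) ->
  forall n, gsq n = alpha ^+ 2 -> M (n, 1) = 0.
Proof.
move=> a0 oU1 oU2 oU3 U1w ww U2z zz U3th thr Mz n1 gn1.
have [t0 [U3t0 t0r ct st]] := exists_generic_angle thr oU3 U3th.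
pose ns : N := sector_point alpha w z t0.
have gns : gsq ns = alpha ^+ 2 by exact: gsq_sector_point.
(* The curve requires 4 <Z, e> < alpha at both ends. With e = z or - z the target is
   fine for one of the signs, and the origin for both since its angle is generic. *)
pose sg : R := if dotr n1.2 z <= 0 then 1 else -1.
have sg1 : sg ^+ 2 = 1 by rewrite /sg; case: ifP => _; rewrite ?sqrrN expr1n.
have sgle : `|sg| <= 1 by rewrite /sg; case: ifP => _; rewrite ?normrN normr1.
pose e := sg *: z.
have ee : dotr e e = 1 by rewrite dotrZl dotrZr zz mulr1 -expr2.
have e1 : 4 * dotr n1.2 e < alpha.
  apply: le_lt_trans a0; rewrite mulr_ge0_le0// dotrZr /sg; case: (leP (dotr n1.2 z) 0) => H; first by rewrite mul1r.
  by rewrite mulN1r oppr_le0 ltW.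
have st1 : `|sin t0| < 1.
  have c2 : 0 < cos t0 ^+ 2 by rewrite lt0r sqr_ge0 sqrf_eq0 ct.
  have := cos2Dsin2 t0; rewrite -(@real_normK _ (sin t0)) ?num_real// => H.
  rewrite -(@ltr_pXn2r _ 2) ?nnegrE// expr1n; lra.
have e0 : 4 * dotr ns.2 e < alpha.
  rewrite dotrZr [dotr ns.2 z]dotrZl zz mulr1 mulrCA mulrA.
  have -> : sg * 4 * (4^-1 * (alpha * `|sin t0|)) = alpha * (sg * `|sin t0|) by field.
  rewrite -[ltRHS]mulr1 ltr_pM2l//; apply: le_lt_trans st1.
  by apply: (le_trans (ler_norm _)); rewrite normrM normr_id ler_piMl.
have [g [s0 [s1 [[s00 s10] apos gg g0 g1]]]] := boundary_curve a0 ee gns gn1 e0 e1.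
have {e0 e1} : M (cpair g 1) = 0; last first.
  by rewrite g1 lsup_normalise// dilD ?invr_ge0 ?(ltW s10)// mulVf ?gt_eqF// dil1.
apply: lsup_propagate => //.
have nsE : dil ((apol g).[0])^-1 (cpoint g 0) = ns.
  rewrite (congr1 fst g0 : cpoint g 0 = _) (congr1 snd g0 : (apol g).[0] = _) /=.
  by rewrite dilD ?invr_ge0 ?(ltW s00)// mulVf ?gt_eqF// dil1.
have ca : (apol g).[t]^-1 @[t --> (0 : R)] --> (apol g).[0]^-1.
  by apply: cvgV; [rewrite gt_eqF|exact: continuous_horner].
have cn : dil ((apol g).[t])^-1 (cpoint g t) @[t --> (0 : R)] --> ns.
  rewrite -nsE; apply: cvg_coord => i.
    rewrite (_ : (fun t => _) = fun t => Num.sqrt (apol g).[t]^-1 * (hpol g i).[t]).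
      rewrite !mxE; apply: cvgM; last exact: continuous_horner.
      by apply: (cvg_comp _ _ ca); exact: sqrt_continuous.
    by apply/funext => t; rewrite !mxE.
  rewrite (_ : (fun t => _) = fun t => (apol g).[t]^-1 * (vpol g i).[t]).
    by rewrite !mxE; apply: cvgM; [exact: ca|exact: continuous_horner].
  by apply/funext => t; rewrite !mxE.
have Hn := cn _ (sector_neighbourhood a0 oU1 oU2 oU3 U1w U2z U3t0 ww zz t0r ct st).
apply: (@filterS _ (nbhs (0 : R)) _ _ _ _ Hn) => t /= H.
have at0 := apos t.
have [|o [z' [t' [[? ?] [? ?] [? ?] nE]]]] := H.
  rewrite gsq_dil ?invr_ge0 ?(ltW at0)// gg exprVn mulrCA mulVf ?mulr1//.
  by rewrite gt_eqF// exprn_gt0.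
by rewrite /cpair lsup_normalise// nE Mz.
Qed.

(** A segment from the axis of the cone to any point starts inside the cone. *)
Lemma lsup_everywhere (alpha : R) : 0 < alpha ->
  (forall n, gsq n <= alpha ^+ 2 -> M (n, 1) = 0) -> forall n, M (n, 1) = 0.
Proof.
move=> a0 Mz n.
pose g := lin_curve ((0 : N), 1) n 0.
have gE t : cpair g t = (t *: n, 1) by rewrite cpair_lin /= add0r mulr0 addr0.
have := @lsup_propagate g; rewrite gE scale1r; apply.
  by move=> t; rewrite (congr1 snd (gE t) : (apol g).[t] = 1).
have cn : t *: n @[t --> (0 : R)] --> (0 : R) *: n.
  by apply: cvgZ; [exact: cvg_id|exact: cvg_cst].
have cg : gsq (t *: n : N) @[t --> (0 : R)] --> gsq (0 : N).
  rewrite scale0r in cn.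
  exact: (@cvg_comp _ _ _ (fun t : R => t *: n) (@gsq R p k) _ _ _ cn (@continuous_gsq R p k 0)).
have g0 : gsq (0 : N) = 0 by rewrite /gsq /hsq /vsq /= !dotr0l expr0n mulr0 addr0.
have : \forall t \near (0 : R), gsq (t *: n : N) < alpha ^+ 2.
  by move/cvgr_lt : cg; apply; rewrite g0 exprn_gt0.
by apply: filterS => t H; rewrite gE; apply: Mz; exact: ltW.
Qed.

(** Pointwise convergence is uniform on compact sets because the family is
    equicontinuous, by gker_lip and family_bound. *)
Lemma uniform_limit : (forall n, M (n, 1) = 0) ->
  forall b e : R, 0 < e -> \forall a \near 0^'+, forall n, gsq n <= b -> `|T (n, 1) a - L| < e.
Proof.
move=> Mz b e e0.
have := @compact_gauge R p k b.
move/compact_near_coveringP/(_ _ (0:R)^'+ (fun a n => `|T (n, 1) a - L| < e)); apply.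
move=> n _; have A0 := family_ge0 HT; have r10 := family_range HT.
have [C C1 Cn] := cbound_ex n.
have C0 : 0 <= C by apply: le_trans C1.
have [B [B1 HB]] := @gker_lip R p k h c beta c0 C 1 C0 ltr01.
have B0 : 0 < B by apply: lt_le_trans B1.
have [K K0 HK] := @gker_compare R p k h c beta c0 beta0 C 1 C0 ltr01.
have A1 : 0 < 4 * A + 1 by rewrite ltr_wpDl// mulr_ge0.
pose d := Num.min B^-1 (e / (B * K * (4 * A + 1))).
have d0 : 0 < d by rewrite lt_min invr_gt0 B0 divr_gt0// !mulr_gt0.
have Bd : B * d <= 1 by rewrite mulrC -ler_pdivlMr// div1r ge_min lexx.
have dE : 2 * A * (B * d * K) < e / 2.
  have : d <= e / (B * K * (4 * A + 1)) by rewrite ge_min lexx orbT.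
  have K1 : 0 < B * K * d by rewrite !mulr_gt0.
  rewrite ler_pdivlMr ?mulr_gt0// => H.
  have E : d * (B * K * (4 * A + 1)) = 2 * (2 * A * (B * d * K)) + B * K * d by ring.
  move: H K1; rewrite E; move: (2 * A * _) (B * K * d) => u v; lra.
have Tn : \forall a \near 0^'+, `|T (n, 1) a - L| < e / 2.
  have /cvgrPdist_lt : T (n, 1) a @[a --> 0^'+] --> L by apply/(tendsP c0 beta0 HT L).
  by move/(_ (e / 2)); rewrite divr_gt0// => /(_ isT); apply: filterS => a; rewrite distrC.
have HF r n' : 0 < r <= r1 -> cbound d (n' - n) -> `|T (n', 1) r - T (n, 1) r| < e / 2.
  move=> rr1 nn'; apply: le_lt_trans dE.
  have sumE (F : bool -> R) : \sum_i F i = F true + F false by exact: big_bool.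
  pose w (i : bool) : R := if i then 1 else -1.
  pose P (i : bool) : N * R := if i then (n', 1) else (n, 1).
  have C'0 : 0 <= B * d * K by rewrite !mulr_ge0 ?(ltW B0) ?(ltW d0) ?(ltW K0).
  have := @family_bound _ _ _ _ _ _ _ _ _ HT bool w P _ r rr1 C'0.
  rewrite sumE /w /P mul1r mulN1r; apply; first by case.
  move=> y; rewrite sumE mul1r mulN1r.
  apply: (le_trans (HB (n, 1) (n', 1) Cn _ d d0 Bd nn' _ y)) => /=.
  - by rewrite lexx.
  - by rewrite subrr normr0 ltW.
  rewrite -[leRHS]mulrA; apply: ler_wpM2l; first by rewrite mulr_ge0 ?(ltW B0) ?(ltW d0).
  by apply: HK => //=; rewrite ?lexx//; split=> i; rewrite mxE normr0.
exists (ball n d, [set a | 0 < a <= r1 /\ `|T (n, 1) a - L| < e / 2]).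
  split; first exact: nbhsx_ballx.
  near=> a; split; last by near: a.
  by apply/andP; split; near: a; [exact: nbhs_right_gt|exact: nbhs_right_le].
case=> n' a /= [/ball_cbound nn' [ar aL]].
rewrite (_ : T (n', 1) a - L = (T (n', 1) a - T (n, 1) a) + (T (n, 1) a - L)); last by ring.
by rewrite (le_lt_trans (ler_normD _ _))// [ltRHS]splitr ltrD// HF.
Unshelve. all: by end_near. Qed.

End vanishing.

(** * Boundary limits of differences of kernel integrals *)

Section transform_limit.
Context {R : realType} {p k : nat} (h : htype R p k).
Local Notation N := (carrier R p k).
Local Notation B := (borel R p k).
Variables (c beta : R).
Hypothesis c0 : 0 < c.
Hypothesis beta0 : 0 < beta.
Local Notation gker := (gker h c beta).
Variable n0 : N.
Variables nu1 nu2 : {measure set B -> \bar R}.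
Hypotheses (int1 : kernel_integrable h c beta nu1) (int2 : kernel_integrable h c beta nu2).
Local Notation Lam := (Lam h n0 nu1 nu2).
Local Notation transform := (transform h c beta nu1 nu2).

Lemma transform_family (A r1 : R) : 0 <= A -> 0 < r1 ->
  (forall r, 0 < r <= r1 -> (\int[nu1]_(y in setT) (gker (n0, r) y))%R <= A) ->
  (forall r, 0 < r <= r1 -> (\int[nu2]_(y in setT) (gker (n0, r) y))%R <= A) ->
  blowup_family h c beta (fun P r => Lam r (gker P)) A r1.
Proof.
move=> A0 r10 FA1 FA2.
have dP P : 0 < P.2 -> dominated h c beta n0 (gker P) := fun H => dominated_gker h c0 beta0 n0 H.
split; [exact: A0|exact: r10| | |].
- move=> r s n a r0 s0 a0.
  rewrite (Lam_gker c0 beta0 n0 int1 int2 (dil s n) r0 (mulr_gt0 s0 a0)).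
  rewrite (Lam_gker c0 beta0 n0 int1 int2 n (mulr_gt0 r0 s0) a0).
  by rewrite (dilD _ (ltW r0) (ltW s0)) mulrA.
- move=> I w P C r rr1 C0 P0 H; have /andP[r0 _] := rr1.
  have dw i : dominated h c beta n0 (fun y => w i * gker (P i) y).
    by apply: dominatedZ; exact: dP.
  have -> : \sum_i w i * Lam r (gker (P i)) = Lam r (fun y => \sum_i w i * gker (P i) y).
    rewrite (Lam_sum int1 int2 (index_enum I) r0 dw).
    by apply: eq_bigr => i _; rewrite (LamZ int1 int2 (w i) r0 (dP _ (P0 i))).
  exact: (Lam_bound int1 int2 FA1 FA2 rr1 C0 (dominated_sum (index_enum I) dw) H).
- move=> g L; exact: (tends_curve c0 beta0 int1 int2 A0 r10 FA1 FA2).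
Qed.

Variables (t0 G : R).
Hypotheses (t00 : 0 < t0) (G0 : 0 <= G).
Hypothesis ball1 : forall r, 0 < r < t0 -> (nu1 (nball h n0 r) <= (G * r ^+ (p + k))%:E)%E.
Hypothesis ball2 : forall r, 0 < r < t0 -> (nu2 (nball h n0 r) <= (G * r ^+ (p + k))%:E)%E.

Lemma family_exists : exists A r1, blowup_family h c beta (fun P r => Lam r (gker P)) A r1.
Proof.
have [A1 [r1 [A10 r10 H1]]] := bounded_kernel_integral c0 beta0 int1 t00 G0 ball1.
have [A2 [r2 [A20 r20 H2]]] := bounded_kernel_integral c0 beta0 int2 t00 G0 ball2.
exists (Num.max A1 A2), (Num.min r1 r2); apply: transform_family.
- by rewrite le_max A10.
- by rewrite lt_min r10 r20.
- move=> r; rewrite le_min => /andP[r0 /andP[rr1 _]].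
  by rewrite le_max H1 ?r0.
- move=> r; rewrite le_min => /andP[r0 /andP[_ rr2]].
  by rewrite le_max H2 ?r0 ?orbT.
Qed.

Lemma dil_sector_point a alpha o z t : 0 <= a ->
  dil a (sector_point alpha o z t) =
  (Num.sqrt (alpha * a * `|cos t|) *: o, (4^-1 * (alpha * a * `|sin t|)) *: z) :> N.
Proof.
move=> a0; rewrite /dil /sector_point !scalerA -sqrtrM//; congr (_ *: _, _ *: _).
  by congr Num.sqrt; ring.
by ring.
Qed.

(** A point of a cone at height a is the dilate by a of a point at height 1 with bounded
    gauge, so the uniform limit of the blow-up is the limit in the cone. *)
Lemma transform_limit (alpha : R) (U1 : set 'rV[R]_p.*2) (U2 : set 'rV[R]_k) (U3 : set R)
    w z th (L : R) : 0 < alpha -> open U1 -> open U2 -> open U3 ->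
  U1 w -> dotr w w = 1 -> U2 z -> dotr z z = 1 -> U3 th -> 0 <= th < 2 * pi ->
  (forall o z t, U1 o -> dotr o o = 1 -> U2 z -> dotr z z = 1 -> U3 t -> 0 <= t < 2 * pi ->
    transform (ray h n0 alpha o z t a) @[a --> 0^'+] --> L) ->
  forall b e, 0 < b -> 0 < e -> \forall a \near 0^'+, forall n, cone h b n0 (n, a) ->
    `|transform (n, a) - L| < e.
Proof.
move=> al0 oU1 oU2 oU3 U1w ww U2z zz U3th thr HL b e b0 e0.
have [A [r1 HT]] := family_exists.
have p0 : (0 < p)%N.
  rewrite lt0n; apply/negP => /eqP pE; move: ww; rewrite /dotr; clear -pE; subst p.
  by rewrite big_ord0 => /esym/eqP; rewrite oner_eq0.
have Mz o z' t : U1 o -> dotr o o = 1 -> U2 z' -> dotr z' z' = 1 -> U3 t -> 0 <= t < 2 * pi ->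
    lsup (fun P r => Lam r (gker P)) L (sector_point alpha o z' t, 1) = 0.
  move=> h1 h2 h3 h4 h5 h6; have := HL o z' t h1 h2 h3 h4 h5 h6 => Ht.
  apply/(tendsP c0 beta0 HT L (P := (_, 1)) ltr01).
  apply: cvg_trans Ht; apply: near_eq_cvg; near=> a.
  have a0 : 0 < a by near: a; exact: nbhs_right_gt.
  rewrite (Lam_gker c0 beta0 n0 int1 int2 _ a0 ltr01) mulr1.
  by rewrite dil_sector_point ?(ltW a0).
have Mb := lsup_boundary c0 beta0 HT al0 oU1 oU2 oU3 U1w ww U2z zz U3th thr Mz.
have Mi := lsup_max_principle c0 beta0 HT p0 al0 Mb.
have Mall := lsup_everywhere c0 beta0 HT al0 Mi.
have := uniform_limit c0 beta0 HT Mall (b ^+ 2) e0.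
move=> H; near=> a => n' [/= a0 Hn].
have Ha : forall n, gsq n <= b ^+ 2 -> `|Lam a (gker (n, 1)) - L| < e by near: a; exact: H.
have ai : 0 <= a^-1 by rewrite invr_ge0 ltW.
have := Ha (dil a^-1 (nmul h (ninv n0) n')).
rewrite (Lam_gker c0 beta0 n0 int1 int2 _ a0 ltr01) mulr1.
rewrite (dilD _ (ltW a0) ai) mulfV ?gt_eqF// dil1 nmulKV; apply.
rewrite gsq_dil// exprVn mulrC ler_pdivrMr ?exprn_gt0// -exprMn.
by apply: ltW; rewrite -ngauge_lt// mulr_gt0.
Unshelve. all: by end_near. Qed.

End transform_limit.

(** * Real and imaginary parts of a complex measure *)

Section complex_parts.
Context {R : realType}.
Implicit Types z w : R[i].

Lemma cvg_normc (T : Type) (F : set_system T) {FF : Filter F} (f : T -> R[i]) (l : R[i]) :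
  f x @[x --> F] --> (l : R[i]^o) ->
  forall e : R, 0 < e -> \forall x \near F, Normc.normc (f x - l) < e.
Proof.
move=> fl e e0.
have e0' : 0 < e%:C%C by rewrite ltcR.
have /(_ e%:C%C e0') := proj1 (@cvgrPdist_lt R[i] R[i]^o T F FF f l) fl.
apply: filterS => x; rewrite distrC.
by rewrite -[X in X < _]/((Normc.normc (f x - l))%:C%C) ltcR.
Qed.

(** The two instances are the real and the imaginary part. *)
Definition coordinate (pr : R[i] -> R) :=
  (forall z w, pr (z + w) = pr z + pr w) /\ (forall z, `|pr z| <= Normc.normc z).

Lemma coordinate_Re : coordinate (@complex.Re R).
Proof.
split=> [[a b] [d e] //|[a b]] /=.
by rewrite -sqrtr_sqr ler_wsqrtr// lerDl sqr_ge0.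
Qed.

Lemma coordinate_Im : coordinate (@complex.Im R).
Proof.
split=> [[a b] [d e] //|[a b]] /=.
by rewrite -sqrtr_sqr ler_wsqrtr// lerDr sqr_ge0.
Qed.

Lemma normc_le_parts z : Normc.normc z <= `|complex.Re z| + `|complex.Im z|.
Proof.
case: z => a b /=; rewrite -[leRHS]ger0_norm ?addr_ge0// -sqrtr_sqr ler_wsqrtr//.
have := mulr_ge0 (normr_ge0 a) (normr_ge0 b).
by rewrite sqrrD !real_normK ?num_real//; lra.
Qed.

Variables (pr : R[i] -> R) (pr_coord : coordinate pr).

Lemma coordinateB z w : pr (z - w) = pr z - pr w.
Proof. by apply: (addIr (pr w)); rewrite -(proj1 pr_coord) !subrK. Qed.

Lemma coordinate_sum I (s : seq I) (F : I -> R[i]) :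
  pr (\sum_(i <- s) F i) = \sum_(i <- s) pr (F i).
Proof.
elim/big_rec2 : _ => [|i x y _ <-]; last exact: (proj1 pr_coord).
by rewrite -(subrr 0) coordinateB subrr.
Qed.

Lemma cvg_coordinate (T : Type) (F : set_system T) {FF : Filter F} (f : T -> R[i]) (l : R[i]) :
  f x @[x --> F] --> (l : R[i]^o) -> pr (f x) @[x --> F] --> pr l.
Proof.
move=> /cvg_normc fl; apply/cvgrPdist_lt => e e0.
have := fl e e0; apply: filterS => x; apply: le_lt_trans.
by rewrite distrC -coordinateB; exact: (proj2 pr_coord).
Qed.

Lemma coordinate_sigma_add p k (mu : cradon R p k) : sigma_add (fun A => pr (mu A)).
Proof.
move=> E bE tE bU.
rewrite (_ : series _ = fun n => pr (series (fun i => mu (E i)) n)).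
  exact: cvg_coordinate (cradon_sigma_additive bE tE bU).
by apply/funext => n; rewrite /series /= coordinate_sum.
Qed.

End complex_parts.

Section real_part.
Context {R : realType} {p k : nat} (h : htype R p k).
Local Notation N := (carrier R p k).
Local Notation B := (borel R p k).
Variables (c beta : R).
Hypothesis c0 : 0 < c.
Hypothesis beta0 : 0 < beta.
Local Notation gker := (gker h c beta).

Lemma sigma_addN (s : set N -> R) : sigma_add s -> sigma_add (fun A => - s A).
Proof.
move=> sadd E bE tE bU.
rewrite (_ : series _ = fun n => - series (fun i => s (E i)) n).
  exact: cvgN (sadd E bE tE bU).
by apply/funext => n; rewrite /series /= sumrN.
Qed.

Variable mu : cradon R p k.

Lemma cradon0 : mu set0 = 0.
Proof.
have := sigma_add0 (coordinate_sigma_add (@coordinate_Re R) (mu := mu)).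
have := sigma_add0 (coordinate_sigma_add (@coordinate_Im R) (mu := mu)).
by case: (mu set0) => a b /= -> ->.
Qed.

Lemma tvar_cradon0 : tvar mu set0 = 0%E.
Proof. by apply: tvar0; rewrite cradon0 Normc.normc0. Qed.

Lemma tvar_ge0 A : (0 <= tvar mu A)%E.
Proof.
apply: ereal_sup_ubound; exists 0%N, (fun=> set0).
by split; [case|case|case|rewrite big_ord0].
Qed.

(** A ball of measure 0 has infinite inverse measure, so a finite quotient forces its
    variation to vanish. *)
Lemma tvar_ball_growth (m : {measure set B -> \bar R}) n0 t0 : is_lebesgue m ->
  (ereal_sup [set tvar mu (nball h n0 r) / m (nball h n0 r)
             | r in [set r : R | (0 < r < t0)%R]] < +oo)%E ->
  exists2 G, 0 <= G & forall r, 0 < r < t0 ->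
    (tvar mu (nball h n0 r) <= (G * r ^+ (p + k))%:E)%E.
Proof.
move=> hm; set S := ereal_sup _ => Sfin.
have [C C0 HC] := nball_volume h hm n0.
pose M := fine (maxe S 0%E).
have M0 : 0 <= M by apply: fine_ge0; rewrite le_max lexx orbT.
have SM : (S <= M%:E)%E.
  rewrite fineK; first by rewrite le_max lexx.
  by rewrite ge0_fin_numE ?le_max ?lexx ?orbT// gt_max Sfin ltry.
exists (M * C); first by rewrite mulr_ge0.
move=> r rt; have /andP[r0 _] := rt.
have rC : 0 <= C * r ^+ (p + k) by rewrite mulr_ge0// exprn_ge0// ltW.
have : (tvar mu (nball h n0 r) / m (nball h n0 r) <= M%:E)%E.
  by apply: le_trans SM; apply: ereal_sup_ubound; exists r.
have wC : (m (nball h n0 r) <= (C * r ^+ (p + k))%:E)%E := HC r r0.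
have w0 : (0 <= m (nball h n0 r))%E := measure_ge0 m _.
have := tvar_ge0 (nball h n0 r); move: (tvar _ _) => v v0.
move: (m (nball h n0 r)) w0 wC => w w0 wC.
have wf : w \is a fin_num by rewrite (ge0_fin_numE w0); exact: le_lt_trans wC (ltry _).
move: w0 wC; rewrite -(fineK wf); move: (fine w) => {wf}w.
rewrite !lee_fin => w0 wC.
rewrite inver; case: eqVneq => [_|wn0].
  have [->|vn0] := eqVneq v 0%E; first by move=> _; rewrite lee_fin -mulrA mulr_ge0.
  by rewrite gt0_muley ?lt0e ?vn0// leye_eq.
rewrite lee_pdivrMr ?lt0r ?wn0// => H; apply: (le_trans H).
by rewrite -EFinM lee_fin -mulrA ler_wpM2l.
Qed.

Hypothesis hmu : Qwell_defined h c beta mu.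

(** The Jordan part of s is at most the variation of mu, for which the kernel is
    integrable by assumption. *)
Lemma jordan_kernel_integrable (s : set N -> R) (sadd : sigma_add s) :
  (forall A, s A <= Normc.normc (mu A)) -> kernel_integrable h c beta (jordan_pos sadd).
Proof.
move=> smu n a a0; apply/integrableP; split.
  by apply/measurable_EFinP; exact: measurable_gker.
apply: le_lt_trans (hmu n a0).
rewrite (_ : (fun x => _) = fun y => (gker (n, a) y)%:E).
  apply: le_integral_setfun => //.
  - exact: tvar_cradon0.
  - by move=> A; exact: jpos_le_tvar.
  - by move=> y; rewrite lee_fin ltW// gker_gt0.
by apply/funext => y /=; rewrite gtr0_norm// gker_gt0.
Qed.

Lemma signed_limit (s : set N -> R) (m : {measure set B -> \bar R}) n0 t0
    (alpha : R) (U1 : set 'rV[R]_p.*2) (U2 : set 'rV[R]_k) (U3 : set R)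
    w z th (L : R) : sigma_add s -> (forall A, `|s A| <= Normc.normc (mu A)) ->
  is_lebesgue m -> 0 < t0 ->
  (ereal_sup [set tvar mu (nball h n0 r) / m (nball h n0 r)
             | r in [set r : R | (0 < r < t0)%R]] < +oo)%E ->
  0 < alpha -> open U1 -> open U2 -> open U3 ->
  U1 w -> dotr w w = 1 -> U2 z -> dotr z z = 1 -> U3 th -> 0 <= th < 2 * pi ->
  (forall o z t, U1 o -> dotr o o = 1 -> U2 z -> dotr z z = 1 -> U3 t -> 0 <= t < 2 * pi ->
    rintegral_signed s (gker (ray h n0 alpha o z t a)) @[a --> 0^'+] --> L) ->
  forall b e, 0 < b -> 0 < e -> \forall a \near 0^'+, forall n, cone h b n0 (n, a) ->
    `|rintegral_signed s (gker (n, a)) - L| < e.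
Proof.
move=> sadd sle hm t00 hsup a0 oU1 oU2 oU3 U1w ww U2z zz U3th thr HL.
have nadd := sigma_addN sadd.
have sle1 A : s A <= Normc.normc (mu A) by apply: le_trans (sle A); exact: ler_norm.
have sle2 A : - s A <= Normc.normc (mu A).
  by apply: le_trans (sle A); rewrite -normrN; exact: ler_norm.
have [G G0 HG] := tvar_ball_growth hm hsup.
apply: (@transform_limit R p k h c beta c0 beta0 n0 (jordan_pos sadd) (jordan_pos nadd)
  _ _ t0 G t00 G0 _ _ alpha U1 U2 U3 w z th L) => //.
- exact: jordan_kernel_integrable.
- exact: jordan_kernel_integrable.
- by move=> r /HG; apply: le_trans; exact: jpos_le_tvar.
- by move=> r /HG; apply: le_trans; exact: jpos_le_tvar.
Qed.

End real_part.

Theorem theorem1p2 (R : realType) (p k : nat) (h : htype R p k)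
  (m : {measure set (borel R p k) -> \bar R}) (hm : is_lebesgue m)
  (beta : R) (hbeta : 0 < beta) (c : R) (hc : is_qconst m beta c)
  (mu : cradon R p k) (hmu : Qwell_defined h c beta mu)
  (n0 : carrier R p k)
  (hsup : exists2 t0 : R, 0 < t0 &
    (ereal_sup [set tvar mu (nball h n0 r) / m (nball h n0 r)
               | r in [set r : R | (0 < r < t0)%R]] < +oo)%E)
  (L : R[i]) (hL : sectorial_limit h (Qtrans h c beta mu) n0 L) :
  admissible_limit h (Qtrans h c beta mu) n0 L.
Proof.
have [c0 _] := hc; have [t0 t00 growth] := hsup.
have [alpha [E [a0 [S1 [S2 [S3 [[rel1 [w Sw]] [rel2 [z Sz]] [rel3 [th Sth]] EE]]]] HL]]] := hL.
have [[U1 oU1 S1E] [U2 oU2 S2E] [U3 oU3 S3E]] := And3 rel1 rel2 rel3.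
move: Sw Sz Sth; rewrite S1E S2E S3E => - [/esphereE ww U1w] [/esphereE zz U2z] [/= + U3th].
rewrite in_itv /= => thr.
have ray_lim o z' t : U1 o -> dotr o o = 1 -> U2 z' -> dotr z' z' = 1 -> U3 t ->
    0 <= t < 2 * pi ->
    Qtrans h c beta mu (ray h n0 alpha o z' t a) @[a --> 0^'+] --> (L : R[i]^o).
  move=> U1o oo U2z' zz' U3t tr; apply: HL; [exact/esphereE|exact/esphereE|by rewrite in_itv|].
  rewrite EE => x Hx; exists o; first by rewrite S1E; split => //; exact/esphereE.
  exists z'; first by rewrite S2E; split => //; exact/esphereE.
  by exists t => //; rewrite S3E; split => //=; rewrite in_itv.
move=> b b0 e e0.
have part pr : coordinate pr ->
    (forall x, pr (Qtrans h c beta mu x) = rintegral_signed (fun A => pr (mu A)) (gker h c beta x)) ->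
    \forall a \near 0^'+, forall n, cone h b n0 (n, a) ->
      `|pr (Qtrans h c beta mu (n, a) - L)| < e / 2.
  move=> prc prE.
  have e20 : 0 < e / 2 by rewrite divr_gt0.
  have H := @signed_limit R p k h c beta c0 hbeta mu hmu (fun A => pr (mu A)) m n0 t0 alpha
    U1 U2 U3 w z th (pr L) (coordinate_sigma_add prc (mu := mu)) (fun A => proj2 prc (mu A))
    hm t00 growth a0 oU1 oU2 oU3 U1w ww U2z zz U3th thr.
  have {}H := H _ b (e / 2) b0 e20.
  near=> a => n nab; rewrite (coordinateB prc) prE; move: n nab; near: a; apply: H.
  move=> o z' t h1 h2 h3 h4 h5 h6.
  rewrite (_ : (fun a => _) = fun a => pr (Qtrans h c beta mu (ray h n0 alpha o z' t a))).
    exact: (@cvg_coordinate R pr prc R (0^'+) _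
      (fun a => Qtrans h c beta mu (ray h n0 alpha o z' t a)) L (ray_lim o z' t h1 h2 h3 h4 h5 h6)).
  by apply/funext => a; rewrite prE.
have HRe := part _ (@coordinate_Re R) (fun=> erefl).
have HIm := part _ (@coordinate_Im R) (fun=> erefl).
near=> a => n nab; apply: (le_lt_trans (normc_le_parts _)); rewrite [ltRHS]splitr.
apply: ltrD; move: n nab; near: a; [exact: HRe|exact: HIm].
Unshelve. all: by end_near. Qed.
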